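(* There exist absolute constants $C>0$ and $C_1>0$ such that the following holds. Let $n\geqslant 2$ and let $X_1,\dots,X_n$ be independent real random variables with $\mathbb{E}X_j=0$ and $\mathbb{E}X_j^2=1$ for all $j=1,\dots,n$. Put $S_n=(X_1+\cdots+X_n)/\sqrt{n}$ and $\Delta=\frac1n\sum_{j=1}^n\chi^2(X_j,\mathcal N)$. (i) If $\Delta\leqslant 0.82$, then \[ \chi^2(S_n,\mathcal N)\leqslant \frac{1}{n-1}\left(\Delta+C\Delta^2\right). \] (ii) If in addition each $X_j$ is symmetric (i.e. $-X_j$ and $X_j$ have the same distribution) and $\Delta\leqslant 1.69$, then \[ \chi^2(S_n,\mathcal N)\leqslant \frac{1}{n^2-1}\left(\Delta+C_1\Delta^2\right). \]
   Context: $\varphi(x)=e^{-x^2/2}/\sqrt{2\pi}$ denotes the standard normal density. For a real random variable $Y$ with density $p$, the $\chi^2$ distance to the standard normal distribution is $\chi^2(Y,\mathcal N)=\int_{-\infty}^{\infty}\left(\frac{p(x)}{\varphi(x)}-1\right)^2\varphi(x)\,dx$ (taken to be $+\infty$ if $Y$ has no density). *)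

(* Defs.v *)
From HB Require Import structures.
From mathcomp Require Import all_boot all_order all_algebra.
From mathcomp Require Import all_classical all_reals all_analysis.
Set Implicit Arguments. Unset Strict Implicit. Unset Printing Implicit Defensive.
Import Order.TTheory GRing.Theory Num.Theory.
Import numFieldNormedType.Exports.
Local Open Scope classical_set_scope.
Local Open Scope ring_scope.

Definition std_normal_density (R : realType) (x : R) : R :=
  expR (- (x ^+ 2) / 2) / Num.sqrt (2 * pi).

Definition is_density (d : measure_display) (T : measurableType d)
  (R : realType) (P : probability T R) (Y : T -> R) (p : R -> R) : Prop :=
  measurable_fun setT p /\ (forall x, 0 <= p x) /\
  forall A : set R, measurable A ->
    P (Y @^-1` A) = (\int[@lebesgue_measure R]_(x in A) (p x)%:E)%E.

(* chi^2 distance of Y to the standard normal law: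
   int (p/phi - 1)^2 phi dx for a density p of Y, and +oo if Y has no density.
   Densities are unique a.e., so all candidate values coincide; taking the
   infimum makes the value +oo exactly when no density exists. *)
Definition chi2_normal (d : measure_display) (T : measurableType d)
  (R : realType) (P : probability T R) (Y : T -> R) : \bar R :=
  ereal_inf [set v | exists p, is_density P Y p /\
    v = (\int[@lebesgue_measure R]_x
          (((p x / std_normal_density x - 1) ^+ 2) * std_normal_density x)%:E)%E].

Definition mutually_independent (d : measure_display) (T : measurableType d)
  (R : realType) (P : probability T R) (n : nat) (X : 'I_n -> T -> R) : Prop :=
  forall B : 'I_n -> set R, (forall i, measurable (B i)) ->
    P (\bigcap_(i in [set: 'I_n]) (X i @^-1` B i)) =
    (\prod_(i < n) P (X i @^-1` B i))%E.

Definition symmetric_rv (d : measure_display) (T : measurableType d)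
  (R : realType) (P : probability T R) (Y : T -> R) : Prop :=
  forall A : set R, measurable A ->
    P ((fun t => - Y t) @^-1` A) = P (Y @^-1` A).

(* Main.v *)
Require Import Defs.
From HB Require Import structures.
From mathcomp Require Import all_boot all_order all_algebra.
From mathcomp Require Import all_classical all_reals all_analysis.
From mathcomp Require Import measurable_realfun zify ring lra.
Set Implicit Arguments. Unset Strict Implicit. Unset Printing Implicit Defensive.
Import Order.TTheory GRing.Theory Num.Theory.
Import numFieldNormedType.Exports.
Local Open Scope classical_set_scope.
Local Open Scope ring_scope.

(* Expand in the polynomials [hermite s k] (Hermite of variance [s], divided by
   [k`!]).  With [T] the partial sums and [c_k(m)] the mean of [hermite m k] at
   [T_m], the addition formula and independence give
   [c_k(m+1) = \sum_i B_i c_(k-i)(m)], where [B_i] are the Hermite moments of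
   the new summand, [B_0 = 1] and [B_1 = B_2 = 0]; and [chi2(S_n)] equals
   [\sum_(k >= 1) k! c_k(n)^2 / n^k].  Bessel's inequality bounds
   [\sum_i i! B_i^2] by [chi2(X_j)].  Split [c_k(n)] by the number of factors
   with [i >= 3]: one factor gives the main term [Delta / (n^p - 1)], and two or
   more are handled by Cauchy-Schwarz against the deterministic quantity
   [occupancy], Maclaurin's inequality for the sums of [i! B_i^2], and a bound
   [occupancy <= C / n^(2 p)], with [p = 1] in general and [p = 2] when the odd
   moments vanish.
   The existence of a density of [S_n] is part of the claim.  It follows from
   duality: [|E q(S_n)| <= K ||q||] in [L^2(gauss)] for polynomials [q], and
   polynomials are dense in [L^2(gauss + law S_n)] because all exponential
   moments are finite. *)

(** * The weighted sum over Hermite coefficients *)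

(** The thresholds on [Delta] come from a saddle point. For [k = s n] the coefficient of order [k]
    is estimated at the point [s], and k! / k^k contributes about exp(-k). Let g(s) be the series of
    the nontrivial terms: exp(s) without its terms of order at most 2, or cosh(s) without them in
    the symmetric case. One binomial comes from the weighting and one from choosing the [m] factors,
    so the sum over [m] is governed by (1 + sqrt(g(s))/t)^(2n). This is beaten by exp(-k) =
    exp(-s/2)^(2n) when g(s) < t^2 (exp(s/2) - 1)^2. The dual side is a geometric series in t^2
    [Delta]. So [t] must be large enough for g and still satisfy t^2 [Delta] < 1: t^2 = 1.21 serves
    up to 0.82, and t^2 = 0.589824 up to 1.69. The spare factor 99/100 in the bound on g yields
    exponential decay in [k], which pays for polynomial losses. It does so only for bounded [s];
    beyond [s = 8] a separate estimate avoids these losses and decays in [n]. The exact denominator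
    n^p - 1 is produced by an unequal split of the square (u + v)^2. *)

Section BivariateCoefficients.
Context {R : realType}.
Implicit Types (B G H : nat -> nat -> R) (n k m : nat).

(* Coefficient of [x^k z^m] in [\prod_(j < n) (1 + z * \sum_i B j i * x^i)]. *)
Fixpoint mcoef B n k m : R :=
  if n is n'.+1 then
    mcoef B n' k m +
    (if m is m'.+1 then \sum_(i < k.+1) B n' i * mcoef B n' (k - i) m' else 0)
  else ((k == 0%N) && (m == 0%N))%:R.

Lemma mcoefS B n k m :
  mcoef B n.+1 k m = mcoef B n k m +
    (if m is m'.+1 then \sum_(i < k.+1) B n i * mcoef B n (k - i) m' else 0).
Proof. by []. Qed.

Lemma mcoef_ge0 B n k m : (forall j i, 0 <= B j i) -> 0 <= mcoef B n k m.
Proof.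
move=> B0; elim: n k m => [|n IH] k m; first by rewrite ler0n.
rewrite mcoefS addr_ge0//; case: m => // m.
by apply: sumr_ge0 => i _; rewrite mulr_ge0.
Qed.

Lemma mcoef_gt B n k m : (n < m)%N -> mcoef B n k m = 0.
Proof.
elim: n k m => [|n IH] k m; first by case: m => //= m _; rewrite andbF.
move=> nm; rewrite mcoefS IH ?add0r ?(ltn_trans _ nm)//.
case: m nm => // m nm; rewrite big1// => i _.
by rewrite IH// mulr0.
Qed.

Lemma mcoef_0 B n k : mcoef B n k 0 = (k == 0%N)%:R.
Proof. by elim: n => [|n IH]; rewrite ?mcoefS ?IH ?addr0//= andbT. Qed.

Lemma mcoef_1 B n k : mcoef B n k 1 = \sum_(j < n) B j k.
Proof.
elim: n => [|n IH]; first by rewrite big_ord0 /= andbF.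
rewrite mcoefS IH [RHS]big_ord_recr/=; congr (_ + _).
rewrite big_ord_recr/= subnn mcoef_0 eqxx mulr1 big1 ?add0r// => i _.
by rewrite mcoef_0 subn_eq0 leqNgt ltn_ord mulr0.
Qed.

(** The cross term satisfies (ab)^2 <= (de')(d'e), and the arithmetic-geometric mean inequality then
    bounds 2ab by de' + d'e. Stating the hypotheses on squares keeps square roots out of the
    recursion. *)
Lemma cauchy_schwarzD (a b d e d' e' : R) : 0 <= d -> 0 <= e -> 0 <= d' ->
  0 <= e' -> a ^+ 2 <= d * e -> b ^+ 2 <= d' * e' ->
  (a + b) ^+ 2 <= (d + d') * (e + e').
Proof.
move=> d0 e0 d'0 e'0 ha hb.
suff h : 2 * (a * b) <= d * e' + d' * e.
  by rewrite sqrrD -[a * b *+ 2]mulr_natl; nra.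
have s0 : 0 <= d * e' + d' * e by rewrite addr_ge0// mulr_ge0.
have [ab|/ltW ab] := leP (a * b) 0; first by nra.
rewrite -ler_sqr ?nnegrE//; last by rewrite mulr_ge0// ltW.
have h1 : (a * b) ^+ 2 <= (d * e') * (d' * e).
  rewrite exprMn (_ : _ * _ = (d * e) * (d' * e')); last by ring.
  by apply: ler_pM => //; exact: sqr_ge0.
have h2 := sqr_ge0 (d * e' - d' * e).
rewrite exprMn; nra.
Qed.

Lemma cauchy_schwarz_sum (I : Type) (s : seq I) (P : pred I) (a d e : I -> R) :
  (forall i, P i -> 0 <= d i) -> (forall i, P i -> 0 <= e i) ->
  (forall i, P i -> a i ^+ 2 <= d i * e i) ->
  (\sum_(i <- s | P i) a i) ^+ 2 <=
  (\sum_(i <- s | P i) d i) * (\sum_(i <- s | P i) e i).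
Proof.
move=> d0 e0 ade.
suff : [/\ 0 <= \sum_(i <- s | P i) d i, 0 <= \sum_(i <- s | P i) e i &
  (\sum_(i <- s | P i) a i) ^+ 2 <=
  (\sum_(i <- s | P i) d i) * (\sum_(i <- s | P i) e i)] by case.
apply: (big_rec3 (fun x y z : R => [/\ 0 <= y, 0 <= z & x ^+ 2 <= y * z])).
  by rewrite expr0n mulr0.
move=> i x y z Pi [y0 z0 xyz]; split; rewrite ?addr_ge0 ?d0 ?e0//.
by apply: cauchy_schwarzD => //; [exact: d0|exact: e0|exact: ade].
Qed.

(** The coefficient is a sum of monomials in [B] with nonnegative integer coefficients. The
    hypothesis multiplies along each monomial, Cauchy-Schwarz sums over the monomials, and the
    recursion does both at once. *)
Lemma mcoef_cauchy_schwarz B G H n k m :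
  (forall j i, 0 <= G j i) -> (forall j i, 0 <= H j i) ->
  (forall j i, B j i ^+ 2 <= G j i * H j i) ->
  mcoef B n k m ^+ 2 <= mcoef G n k m * mcoef H n k m.
Proof.
move=> G0 H0 BGH; elim: n k m => [|n IH] k m.
  by rewrite /= -natrX -natrM; case: (_ && _).
rewrite !mcoefS; apply: cauchy_schwarzD; rewrite ?mcoef_ge0//.
- by case: m => // m; apply: sumr_ge0 => i _; rewrite mulr_ge0 ?mcoef_ge0.
- by case: m => // m; apply: sumr_ge0 => i _; rewrite mulr_ge0 ?mcoef_ge0.
case: m => [|m]; first by rewrite expr0n mulr0.
apply: cauchy_schwarz_sum => i _; rewrite ?mulr_ge0 ?mcoef_ge0//.
rewrite exprMn (_ : _ * _ * _ = (G n i * H n i) *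
  (mcoef G n (k - i) m * mcoef H n (k - i) m)); last by ring.
by apply: ler_pM; rewrite ?sqr_ge0.
Qed.

(** This is the evaluation of the generating product at z = 1; degrees in z above [n] do not
    occur. *)
Lemma mcoef_sum B (c : nat -> nat -> R) n k :
  (forall k, c 0%N k = (k == 0%N)%:R) ->
  (forall n k, c n.+1 k = c n k + \sum_(i < k.+1) B n i * c n (k - i)%N) ->
  c n k = \sum_(m < n.+1) mcoef B n k m.
Proof.
move=> c0 cS; elim: n k => [|n IH] k.
  by rewrite c0 big_ord_recl big_ord0 addr0 /= andbT.
rewrite cS IH; under [X in _ + X = _]eq_bigr do rewrite IH.
under [RHS]eq_bigr do rewrite mcoefS.
rewrite big_split/=; congr (_ + _).
  by rewrite [RHS]big_ord_recr/= mcoef_gt// addr0.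
rewrite [RHS]big_ord_recl/= add0r exchange_big/=.
by apply: eq_bigr => i _; rewrite mulr_sumr.
Qed.

(** [T] is any supersolution of the convolution recursion for identical factors, and the binomial
    counts the choices of the [m] nontrivial ones. The cutoff [K] allows a [T] that only dominates
    up to the order under study. *)
Lemma mcoef_le (g : nat -> R) (T : nat -> nat -> R) K n k m :
  (forall i, 0 <= g i) -> (forall k, (k <= K)%N -> (k == 0%N)%:R <= T 0%N k) ->
  (forall m k, (k <= K)%N ->
    \sum_(i < k.+1) g i * T m (k - i)%N <= T m.+1 k) ->
  (k <= K)%N -> mcoef (fun=> g) n k m <= 'C(n, m)%:R * T m k.
Proof.
move=> g0 T0 TS; elim: n k m => [|n IH] k m kK.
  case: m => [|m]; first by rewrite bin0 mul1r /= andbT T0.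
  by rewrite /= andbF bin0n mul0r.
rewrite mcoefS; case: m => [|m]; first by rewrite addr0 (le_trans (IH _ _ kK))// !bin0.
rewrite binS natrD mulrDl lerD ?IH//.
apply: (@le_trans _ _ (\sum_(i < k.+1) g i * ('C(n, m)%:R * T m (k - i)%N))).
  by apply: ler_sum => i _; rewrite ler_wpM2l ?IH// (leq_trans (leq_subr _ _)).
under eq_bigr do rewrite mulrCA; rewrite -mulr_sumr ler_wpM2l//.
exact: TS.
Qed.

(** The pairs (i, j) with i + j < N form a triangle inside the square i, j < N, and all terms are
    nonnegative. *)
Lemma sum_convolution_le (f h : nat -> R) N :
  (forall i, 0 <= f i) -> (forall i, 0 <= h i) ->
  \sum_(k < N) \sum_(i < k.+1) f i * h (k - i)%N <=
  (\sum_(i < N) f i) * (\sum_(k < N) h k).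
Proof.
move=> f0 h0; elim: N f f0 => [|N IH] f f0; first by rewrite !big_ord0 mul0r.
have -> : \sum_(k < N.+1) \sum_(i < k.+1) f i * h (k - i)%N =
    f 0%N * \sum_(k < N.+1) h k +
    \sum_(k < N) \sum_(i < k.+1) f i.+1 * h (k - i)%N.
  rewrite mulr_sumr [LHS]big_ord_recl [in RHS]big_ord_recl/= big_ord1 subnn -addrA.
  congr (_ + _); rewrite -big_split/=; apply: eq_bigr => k _.
  by rewrite [LHS]big_ord_recl/= subn0.
rewrite [X in _ <= X * _]big_ord_recl mulrDl lerD2l.
apply: (le_trans (IH (f \o S) _)) => [i|]; first exact: f0.
apply: ler_wpM2l; first by apply: sumr_ge0 => i _; exact: f0.
by rewrite [leRHS]big_ord_recr/= lerDl.
Qed.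

(** Multiplying the case [m] by a + t >= 0 gives the next tangent line plus the nonnegative
    remainder (m+1) a^m t^2. *)
Lemma bernoulli_tangent (a t : R) m : 0 <= a -> 0 <= a + t ->
  a ^+ m.+1 + m.+1%:R * a ^+ m * t <= (a + t) ^+ m.+1.
Proof.
move=> a0 at0; elim: m => [|m IH]; first by rewrite expr0 !expr1 !mul1r.
rewrite [leRHS]exprS; apply: le_trans (ler_wpM2l at0 IH).
rewrite [m.+2%:R]mulrSr [a ^+ m.+2]exprS [in leLHS]mulrDl mul1r.
rewrite -subr_ge0 [X in 0 <= X](_ : _ = m.+1%:R * a ^+ m * t ^+ 2).
  by rewrite mulr_ge0 ?sqr_ge0// mulr_ge0 ?exprn_ge0.
by rewrite exprS; ring.
Qed.

(* Adding one factor is the tangent line inequality for [x ^+ m] at the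
   previous average. *)
Lemma mcoef_maclaurin (H : nat -> nat -> R) (chi : nat -> R) N n m :
  (forall j i, 0 <= H j i) -> (forall j, \sum_(i < N) H j i <= chi j) ->
  \sum_(k < N) mcoef H n k m <= 'C(n, m)%:R * ((\sum_(j < n) chi j) / n%:R) ^+ m.
Proof.
move=> H0 Hchi.
have chi0 j : 0 <= chi j by apply: le_trans (Hchi j); exact: sumr_ge0.
elim: n m => [|n IH] m.
  case: m => [|m] /=; last by rewrite big1 ?mulr_ge0 ?exprn_ge0 ?big_ord0 ?mul0r// => i _; rewrite andbF.
  rewrite bin0 expr0 mul1r; case: N {Hchi} => [|N]; first by rewrite big_ord0.
  by rewrite big_ord_recl big1 ?addr0.
case: m => [|m].
  by under eq_bigr do rewrite mcoefS addr0; rewrite (le_trans (IH _))// !bin0 !expr0.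
under eq_bigr do rewrite mcoefS; rewrite big_split/=.
apply: (@le_trans _ _ ('C(n, m.+1)%:R * ((\sum_(j < n) chi j) / n%:R) ^+ m.+1 +
  chi n * ('C(n, m)%:R * ((\sum_(j < n) chi j) / n%:R) ^+ m))).
  rewrite lerD ?IH//.
  apply: (le_trans (@sum_convolution_le _ (fun k => mcoef H n k m) _ _ _)) => //.
    by move=> i; exact: mcoef_ge0.
  apply: ler_pM => //; first exact: sumr_ge0.
  by apply: sumr_ge0 => i _; exact: mcoef_ge0.
set a := _ / n%:R; rewrite big_ord_recr/=.
have a0 : 0 <= a by rewrite divr_ge0 ?sumr_ge0.
(* For [n = 0] division by zero makes [a] equal to 0, and both sides vanish. *)
have -> : \sum_(j < n) chi j = n%:R * a.
  rewrite /a; case: n {IH a a0} => [|n]; first by rewrite big_ord0 mul0r.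
  by rewrite mulrCA divff ?mulr1// pnatr_eq0.
have n1 : (n.+1%:R : R) != 0 by rewrite pnatr_eq0.
have e : (n%:R * a + chi n) / n.+1%:R = a + (chi n - a) / n.+1%:R.
  by rewrite -natr1 in n1 *; field.
have t0 : 0 <= a + (chi n - a) / n.+1%:R.
  by rewrite -e divr_ge0// addr_ge0// mulr_ge0.
rewrite e; apply: (le_trans _ (ler_wpM2l _ (bernoulli_tangent m a0 t0))) => //.
have C1 : 'C(n, m)%:R = m.+1%:R * 'C(n.+1, m.+1)%:R / n.+1%:R :> R.
  by rewrite -natrM -mul_bin_diag natrM mulrC mulKf.
have C2 : 'C(n, m.+1)%:R = 'C(n.+1, m.+1)%:R - 'C(n, m)%:R :> R.
  by rewrite binS natrD addrK.
rewrite C2 C1 exprS le_eqVlt; apply/orP; left; apply/eqP.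
by rewrite -[n.+1%:R]natr1 in n1 *; field.
Qed.

End BivariateCoefficients.

(** * Exponential estimates and moments of random signs *)

Section ExponentialBounds.
Context {R : realType}.
Implicit Types (x y s : R) (k m n : nat).

Lemma cvg_exp_sum x :
  (\sum_(i < n) x ^+ i / i`!%:R) @[n --> \oo] --> expR x.
Proof.
have -> : (fun n => \sum_(i < n) x ^+ i / i`!%:R) = series (exp_coeff x).
  by apply/funext => n; rewrite /series/= big_mkord.
exact: is_cvg_series_exp_coeff.
Qed.

Lemma le_expR_fact x k : 0 <= x -> x ^+ k <= k`!%:R * expR x.
Proof.
move=> x0; case: k => [|k]; first by rewrite fact0 mul1r expr0 -expR0 ler_expR.
have := expR_ge1Dxn k x0; rewrite -(ler_pM2l (_ : 0 < k.+1`!%:R)) ?ltr0n ?fact_gt0//.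
by apply: le_trans; rewrite mulrDr mulr1 mulrCA divff ?mulr1 ?lerDr// pnatr_eq0 -lt0n fact_gt0.
Qed.

Lemma nonneg_of_derive (f df : R -> R) :
  (forall x, is_derive x 1 f (df x)) -> 0 <= f 0 ->
  (forall x, 0 <= x -> 0 <= df x) -> forall x, 0 <= x -> 0 <= f x.
Proof.
move=> fdf f0 df0 x x0.
have cf : {within `[0, x], continuous f}.
  apply: derivable_within_continuous => y _.
  by have [] := fdf y.
have [c /[!in_itv]/= /andP[c0 _] e] := MVT_segment x0 (fun y _ => fdf y) cf.
by rewrite -(subrK (f 0) (f x)) e addr_ge0// mulr_ge0 ?subr_ge0// df0.
Qed.

(** One parameter serves both statements: divided by i! these are the Taylor coefficients of
    [cosh_mean a], which is exp for a = 1 and cosh for a = 1/2. *)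
Definition cosh_weight (a : R) (i : nat) : R := a + (1 - a) * (-1) ^+ i.

Definition cosh_mean (a x : R) : R := a * expR x + (1 - a) * expR (- x).

Lemma cosh_weight_ge0 a i : 1 / 2 <= a <= 1 -> 0 <= cosh_weight a i.
Proof.
move=> a1; rewrite /cosh_weight -signr_odd; case: (odd i); rewrite ?expr1 ?expr0; lra.
Qed.

Lemma cosh_weight_le1 a i : 1 / 2 <= a <= 1 -> cosh_weight a i <= 1.
Proof.
move=> a1; rewrite /cosh_weight -signr_odd; case: (odd i); rewrite ?expr1 ?expr0; lra.
Qed.

Lemma cosh_mean_ge0 a x : 1 / 2 <= a <= 1 -> 0 <= cosh_mean a x.
Proof.
by move=> /andP[a2 a1]; rewrite addr_ge0// mulr_ge0 ?expR_ge0//; lra.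
Qed.

Lemma sum_cosh_weight_le a s k : 1 / 2 <= a <= 1 -> 0 <= s ->
  \sum_(i < k) cosh_weight a i * (s ^+ i / i`!%:R) <= cosh_mean a s.
Proof.
move=> a1 s0.
pose u n := \sum_(i < n) cosh_weight a i * (s ^+ i / i`!%:R).
have uc : u n @[n --> \oo] --> cosh_mean a s.
  have -> : u = (fun n => a * (\sum_(i < n) s ^+ i / i`!%:R) +
                 (1 - a) * \sum_(i < n) (- s) ^+ i / i`!%:R).
    apply/funext => n; rewrite !mulr_sumr -big_split/=; apply: eq_bigr => i _.
    by rewrite [(- s) ^+ _]exprNn /cosh_weight; ring.
  by apply: cvgD; apply: cvgMr; exact: cvg_exp_sum.
rewrite -(cvg_lim _ uc)//; apply: (@nondecreasing_cvgn_le _ u); last first.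
  by apply/cvg_ex; exists (cosh_mean a s).
apply/nondecreasing_seqP => n; rewrite /u big_ord_recr/= lerDl.
by rewrite mulr_ge0 ?cosh_weight_ge0// divr_ge0 ?exprn_ge0.
Qed.

(* [k`! * [x^k] (cosh_mean a x)^m] is [walk a m 0 k], the [k]-th moment of a
   sum of [m] independent signs that are positive with probability [a]. *)
Fixpoint walk (a : R) m y k : R :=
  if m is m'.+1 then a * walk a m' (y + 1) k + (1 - a) * walk a m' (y - 1) k
  else y ^+ k.

(** The binomial theorem in one sign turns a step of the walk into a convolution. After division by
    k! it is the recursion that [mcoef_le] asks of its majorant. *)
Lemma walkS a m y k : walk a m.+1 y k =
  \sum_(i < k.+1) 'C(k, i)%:R * cosh_weight a i * walk a m y (k - i).
Proof.
elim: m y k => [|m IH] y k.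
  rewrite /= [y + 1]addrC [y - 1]addrC [1 + y]addrC [-1 + y]addrC.
  rewrite (exprDn y 1) (exprDn y (- 1)) !mulr_sumr -big_split/=.
  apply: eq_bigr => i _; rewrite expr1n -[X in a * X]mulr_natl -[X in (1 - a) * X]mulr_natl /cosh_weight.
  by move: ((-1) ^+ i) (y ^+ (k - i)) ('C(k, i)%:R : R) => u v w; ring.
have -> : walk a m.+2 y k =
  a * walk a m.+1 (y + 1) k + (1 - a) * walk a m.+1 (y - 1) k by [].
rewrite !IH !mulr_sumr -big_split/=; apply: eq_bigr => i _.
move: (walk _ _ (y + 1) _) (walk _ _ (y - 1) _) ('C(k, i)%:R : R) => u v w; ring.
Qed.

Lemma walk_ge0 a m k : 1 / 2 <= a <= 1 -> 0 <= walk a m 0 k.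
Proof.
move=> a1; elim: m k => [|m IH] k; first by rewrite /= exprn_ge0.
rewrite walkS; apply: sumr_ge0 => i _.
by rewrite !mulr_ge0 ?cosh_weight_ge0.
Qed.

(** This is x/k <= exp(x/k - 1) raised to the power [k]. Equality holds at x = k, so no polynomial
    factor in [k] is lost. *)
Lemma expr_le_expR x k : 0 <= x -> x ^+ k <= k%:R ^+ k * expR (x - k%:R).
Proof.
move=> x0; have [->|k0] := posnP k; first by rewrite !expr0 mul1r subr0 -expR0 ler_expR.
have k0' : 0 < (k%:R : R) by rewrite ltr0n.
have -> : x - k%:R = k%:R * (x / k%:R - 1) by field; rewrite gt_eqF.
rewrite expRM_natl -exprMn ler_pXn2r ?nnegrE ?mulr_ge0 ?expR_ge0//.
have := expR_ge1Dx (x / k%:R - 1); rewrite addrC subrK => /(ler_wpM2l (ltW k0')).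
by rewrite mulrCA divff ?mulr1 ?gt_eqF.
Qed.

(** A Chernoff bound: the power y^k is dominated by exponentials of slope [s] and [- s], and each
    sign of the walk then multiplies the bound by its exponential mean. *)
Lemma walk_le a m y s n k : 1 / 2 <= a <= 1 -> (0 < n)%N -> (0 < k)%N ->
  s = k%:R / n%:R ->
  walk a m y k <= n%:R ^+ k * expR (- k%:R) *
    (expR (s * y) + expR (- (s * y))) * cosh_mean a s ^+ m.
Proof.
move=> a1 n0 k0 sE.
have [n0' k0'] : (0 < n%:R :> R) /\ (0 < k%:R :> R) by rewrite !ltr0n.
have s0 : 0 < s by rewrite sE divr_gt0.
have a01 := andP a1.
elim: m y => [|m IH] y.
  rewrite expr0 mulr1 /=.
  rewrite [in leLHS](_ : y = n%:R * (s * y / k%:R)); last first.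
    by rewrite sE; field; rewrite !gt_eqF.
  rewrite exprMn -[leRHS]mulrA ler_wpM2l ?exprn_ge0//.
  apply: (le_trans (ler_norm _)).
  rewrite normrX normrM normfV (ger0_norm (ltW k0')) exprMn exprVn.
  rewrite ler_pdivrMr ?exprn_gt0//.
  apply: (le_trans (expr_le_expR _ (normr_ge0 _))).
  rewrite mulrC ler_wpM2r ?exprn_ge0// addrC expRD ler_wpM2l ?expR_ge0//.
  by case: (ger0P (s * y)) => _; [rewrite lerDl expR_ge0|rewrite lerDr expR_ge0].
rewrite /= exprS.
apply: (le_trans (lerD (ler_wpM2l _ (IH (y + 1))) (ler_wpM2l _ (IH (y - 1))))); [lra|lra|].
set c := n%:R ^+ k * _; set d := cosh_mean a s ^+ m.
have c0 : 0 <= c by rewrite mulr_ge0 ?exprn_ge0 ?expR_ge0.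
have d0 : 0 <= d by rewrite exprn_ge0 ?cosh_mean_ge0.
have -> : a * (c * (expR (s * (y + 1)) + expR (- (s * (y + 1)))) * d) +
  (1 - a) * (c * (expR (s * (y - 1)) + expR (- (s * (y - 1)))) * d) =
  c * ((a * expR s + (1 - a) * expR (- s)) * expR (s * y) +
       (a * expR (- s) + (1 - a) * expR s) * expR (- (s * y))) * d.
  have -> : s * (y + 1) = s * y + s by ring.
  have -> : s * (y - 1) = s * y - s by ring.
  by rewrite !opprD !opprK !expRD; ring.
rewrite [leRHS](_ : _ = c * (cosh_mean a s * (expR (s * y) + expR (- (s * y)))) * d); last by ring.
rewrite ler_wpM2r// ler_wpM2l// mulrDr lerD// ler_wpM2r ?expR_ge0//.
rewrite /cosh_mean.
(* The exponential of slope [- s] collects the factor [cosh_mean a (- s)], which is at most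
   [cosh_mean a s] because a >= 1/2. *)
have : expR (- s) <= expR s by rewrite ler_expR; lra.
move: a1 => /andP[a2 a1]; nra.
Qed.

(** A Stirling bound that is off by a factor of order sqrt(k). The induction step is (1 -
    1/(k+1))^(k+1) <= exp(-1). *)
Lemma fact_le k : (0 < k)%N ->
  (k`!%:R : R) <= expR 1 * k%:R ^+ k.+1 * expR (- k%:R).
Proof.
elim: k => // -[_ _|k /(_ isT) IH _].
  by rewrite expr1n mulr1 -expRD subrr expR0.
move: (ltn0Sn k) IH; move: k.+1 => {}k k0 IH.
rewrite factS natrM; apply: (le_trans (ler_wpM2l _ IH)) => //.
have h : k%:R ^+ k.+1 * expR 1 <= k.+1%:R ^+ k.+1 :> R.
  have k1 : (0 : R) < k.+1%:R by rewrite ltr0n.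
  have : (k%:R / k.+1%:R) ^+ k.+1 <= expR (- k.+1%:R^-1) ^+ k.+1 :> R.
    rewrite ler_pXn2r ?nnegrE ?expR_ge0 ?divr_ge0//.
    apply: le_trans (expR_ge1Dx _).
    by rewrite -[k.+1%:R]natr1 in k1 *; rewrite ler_pdivrMr// mulrBl mul1r mulVf ?gt_eqF// addrK.
  rewrite -expRM_natl mulrN divff ?gt_eqF// exprMn exprVn.
  rewrite ler_pdivrMr ?exprn_gt0// => /(ler_wpM2r (expR_ge0 1)) /le_trans; apply.
  by rewrite mulrAC -expRD addrC subrr expR0 mul1r.
have -> : expR (- k.+1%:R) = expR (- k%:R) * expR (-1) :> R.
  by rewrite -expRD -opprD natr1.
have e1 : expR 1 * expR (-1) = 1 :> R by rewrite -expRD subrr expR0.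
have -> : k.+1%:R * (expR 1 * k%:R ^+ k.+1 * expR (- k%:R)) =
  (k.+1%:R * expR (- k%:R)) * (k%:R ^+ k.+1 * expR 1) :> R by ring.
have -> : expR 1 * k.+1%:R ^+ k.+2 * (expR (- k%:R) * expR (-1)) =
  (k.+1%:R * expR (- k%:R)) * k.+1%:R ^+ k.+1 * (expR 1 * expR (-1)) :> R.
  by rewrite [_ ^+ k.+2]exprS; ring.
by rewrite e1 mulr1 ler_wpM2l// mulr_ge0 ?expR_ge0.
Qed.

End ExponentialBounds.

(** * Uniform bounds on [occupancy] *)

Section OccupancyBound.
Context {R : realType}.
Implicit Types (a t s : R) (p k m n : nat).

Lemma sum_sqr_le_sqr_sum (I : Type) (r : seq I) (F : I -> R) :
  (forall i, 0 <= F i) -> \sum_(i <- r) F i ^+ 2 <= (\sum_(i <- r) F i) ^+ 2.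
Proof.
move=> F0; elim: r => [|i r IH]; first by rewrite !big_nil expr0n.
rewrite !big_cons sqrrD -addrA lerD2l (le_trans IH)// lerDr mulrn_wge0//.
by rewrite mulr_ge0// sumr_ge0.
Qed.

(** Squares of nonnegative terms sum to at most the square of the sum, which the binomial theorem
    evaluates. *)
Lemma sum_sqr_binomial_le (u v : R) n : 0 <= u -> 0 <= v ->
  \sum_(m < n.+1) ('C(n, m)%:R * (u ^+ m * v ^+ (n - m))) ^+ 2 <= (u + v) ^+ (2 * n).
Proof.
move=> u0 v0; rewrite mulnC exprM addrC exprDn.
apply: le_trans (sum_sqr_le_sqr_sum _ _) _ => [m|].
  by rewrite !mulr_ge0 ?exprn_ge0.
rewrite le_eqVlt; apply/orP; left; apply/eqP; congr (_ ^+ 2).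
by apply: eq_bigr => i _; rewrite -[RHS]mulr_natl [v ^+ _ * _]mulrC.
Qed.

Lemma sum_shift2_le (F : nat -> R) n : (forall m, 0 <= F m) ->
  \sum_(m < n.-1) F m.+2 <= \sum_(m < n.+1) F m.
Proof.
case: n => [|[|n]] F0; [by rewrite big_ord0 sumr_ge0..|].
rewrite -[n.+2.-1]/n.+1 [leRHS]big_ord_recl [X in _ <= _ + X]big_ord_recl/=.
by rewrite addrA lerDr addr_ge0.
Qed.

(* Indices below 3 do not occur: the summands are centred with variance 1. *)
Definition cosh_tail a (i : nat) : R :=
  if (i < 3)%N then 0 else cosh_weight a i / i`!%:R.

Lemma cosh_tail_ge0 a i : 1 / 2 <= a <= 1 -> 0 <= cosh_tail a i.
Proof.
move=> a1; rewrite /cosh_tail; case: ifP => // _.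
by rewrite divr_ge0 ?cosh_weight_ge0.
Qed.

(* What Cauchy-Schwarz leaves after splitting [B j i ^+ 2] into [1 / i`!] and
   [i`! * B j i ^+ 2], and weighting the number [m] of nontrivial factors by
   [t ^+ (2 * m) / 'C(n, m)]. *)
Definition occupancy a t n k : R := k`!%:R / n%:R ^+ k *
  \sum_(m < n.-1) 'C(n, m.+2)%:R / (t ^+ m.+2) ^+ 2 *
     mcoef (fun=> cosh_tail a) n k m.+2.

(** The binomial from the choice of factors meets the one in the weight. The result is a sum of
    squared binomials, the shape that [sum_sqr_binomial_le] handles. *)
Lemma occupancy_le a t n k (T : R) (x : nat -> R) :
  (forall m, mcoef (fun=> cosh_tail a) n k m <= 'C(n, m)%:R * (T * x m)) ->
  0 <= t ->
  occupancy a t n k <= k`!%:R / n%:R ^+ k * T *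
    \sum_(m < n.-1) 'C(n, m.+2)%:R ^+ 2 / (t ^+ m.+2) ^+ 2 * x m.+2.
Proof.
move=> hT t0; rewrite /occupancy -[leRHS]mulrA ler_wpM2l ?divr_ge0 ?exprn_ge0//.
rewrite mulr_sumr; apply: ler_sum => m _.
apply: (le_trans (ler_wpM2l _ (hT _))).
  by rewrite divr_ge0// exprn_ge0// exprn_ge0.
rewrite le_eqVlt; apply/orP; left; apply/eqP.
move: (x _) ((t ^+ m.+2) ^+ 2)^-1 ('C(n, m.+2)%:R : R) => u v w; ring.
Qed.

(** Restoring the orders below 3 only enlarges the coefficients, and for the full series the
    convolution is exactly [walkS]. *)
Lemma mcoef_walk a n k m : 1 / 2 <= a <= 1 ->
  mcoef (fun=> cosh_tail a) n k m <= 'C(n, m)%:R * (walk a m 0 k / k`!%:R).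
Proof.
move=> a1; apply: (@mcoef_le _ _ (fun m k => walk a m 0 k / k`!%:R) k) => //.
- by move=> i; exact: cosh_tail_ge0.
- by move=> {}k _; case: k => [|k]; rewrite ?divr1 ?expr0//= divr_ge0 ?exprn_ge0.
move=> {}m {}k _; rewrite walkS mulr_suml; apply: ler_sum => i _.
have hi : (i <= k)%N by rewrite -ltnS.
rewrite mulrA [leRHS](_ : _ = (cosh_weight a i / i`!%:R * walk a m 0 (k - i)) / (k - i)`!%:R).
  rewrite ler_wpM2r ?invr_ge0// ler_wpM2r ?walk_ge0//.
  by rewrite /cosh_tail; case: ifP => // _; rewrite divr_ge0 ?cosh_weight_ge0.
have f0 j : (j`!%:R : R) != 0 by rewrite pnatr_eq0 -lt0n fact_gt0.
rewrite -(bin_fact hi) !natrM.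
have c0 : ('C(k, i)%:R : R) != 0 by rewrite pnatr_eq0 -lt0n bin_gt0.
move: (f0 i) (f0 (k - i)%N) c0 => /= f1 f2 c0.
by field; rewrite f1 f2 c0.
Qed.

(** The factorial cancels exactly against the one in [mcoef_walk], so the Chernoff bound leaves no
    power of [k]. This matters because [k] is unbounded in terms of [n] here, and only decay in [n]
    is gained. *)
Lemma occupancy_large a t s n k : 1 / 2 <= a <= 1 -> 0 < t -> (0 < n)%N ->
  (0 < k)%N -> s = k%:R / n%:R -> 8 <= s ->
  cosh_mean a s * expR (- s) <= (93 / 100 * t) ^+ 2 ->
  occupancy a t n k <= 2 * (199 / 200) ^+ (2 * n).
Proof.
move=> a1 t0 n0 k0 sE s8 hs.
have [n0' k0'] : (0 < n%:R :> R) /\ (0 < k%:R :> R) by rewrite !ltr0n.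
(* exp(-k) equals v^(2n). Splitting v^n as v^(n-m) v^m makes each summand the square of a term of
   the expansion of (u + v)^n. From s >= 8 one has v <= exp(-4) <= 1/16, and 93/100 + 1/16 <
   199/200. *)
pose u := Num.sqrt (cosh_mean a s * expR (- s)) / t.
pose v := expR (- (s / 2)).
have u0 : 0 <= u by rewrite divr_ge0 ?sqrtr_ge0 ?ltW.
have u1 : u <= 93 / 100.
  rewrite ler_pdivrMr// -ler_sqr ?nnegrE ?sqrtr_ge0//; last by apply: mulr_ge0; lra.
  by rewrite sqr_sqrtr// mulr_ge0 ?expR_ge0 ?cosh_mean_ge0.
have v1 : v <= 1 / 16.
  have e2 : (2 : R) <= expR 1 by have := expR_ge1Dx (1 : R); lra.
  have -> : v = (expR (s / 2))^-1 by rewrite /v expRN.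
  rewrite div1r lef_pV2 ?posrE ?expR_gt0//.
  have -> : (16 : R) = 2 ^+ 4 by ring.
  apply: (@le_trans _ _ (expR 1 ^+ 4)); first by rewrite ler_pXn2r ?nnegrE ?expR_ge0.
  by rewrite -expRM_natl ler_expR; lra.
have v0 : 0 <= v by exact: expR_ge0.
apply: (@le_trans _ _ (2 * (u + v) ^+ (2 * n))); last first.
  have uv0 : 0 <= u + v by rewrite addr_ge0.
  have uv1 : u + v <= 199 / 200 by apply: (le_trans (lerD u1 v1)); lra.
  move: (199 / 200) uv1 => c uv1; rewrite ler_wpM2l//; apply: lerXn2r => //.
  by rewrite nnegrE (le_trans uv0).
have : forall m, mcoef (fun=> cosh_tail a) n k m <= 'C(n, m)%:R *
    ((2 * n%:R ^+ k * expR (- k%:R) / k`!%:R) * cosh_mean a s ^+ m).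
  move=> m; apply: (le_trans (mcoef_walk _ _ _ a1)); rewrite ler_wpM2l//.
  have /(ler_wpM2r (_ : 0 <= k`!%:R^-1)) := walk_le m 0 a1 n0 k0 sE.
  rewrite invr_ge0 ler0n => /(_ isT)/le_trans; apply.
  rewrite mulr0 oppr0 expR0 le_eqVlt; apply/orP; left; apply/eqP; ring.
move=> /occupancy_le /(_ (ltW t0)) /le_trans; apply => //.
have f0 : (k`!%:R : R) != 0 by rewrite pnatr_eq0 -lt0n fact_gt0.
rewrite [X in X * _ <= _](_ : _ = 2 * expR (- k%:R)); last first.
  by field; rewrite f0 expf_neq0// gt_eqF.
rewrite -mulrA ler_wpM2l// mulr_sumr.
apply: (le_trans _ (sum_sqr_binomial_le n u0 v0)).
have ek : expR (- k%:R) = (v ^+ n) ^+ 2.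
  rewrite /v -!expRM_natl; congr expR; rewrite sE; field; rewrite gt_eqF//.
rewrite ek.
pose F m : R := ('C(n, m)%:R * (u ^+ m * v ^+ (n - m))) ^+ 2.
have F0 m : 0 <= F m by exact: sqr_ge0.
apply: (@le_trans _ _ (\sum_(m < n.-1) F m.+2)); last first.
  exact: sum_shift2_le.
rewrite le_eqVlt; apply/orP; left; apply/eqP; apply: eq_bigr => m _.
have mn : (m.+2 <= n)%N by move: (ltn_ord m); rewrite ltn_predRL.
rewrite /F; move: m.+2 mn => {}m mn.
have vn0 : v != 0 by rewrite gt_eqF ?expR_gt0.
have tn0 : t != 0 by rewrite gt_eqF.
have uE : cosh_mean a s = u ^+ 2 * t ^+ 2 * v ^- 2.
  rewrite /u expr_div_n sqr_sqrtr ?mulr_ge0 ?expR_ge0 ?cosh_mean_ge0//.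
  have -> : expR (- s) = v ^+ 2 by rewrite /v -expRM_natl; congr expR; field.
  by field; rewrite tn0 vn0.
have vE : v ^+ n = v ^+ (n - m) * v ^+ m by rewrite -exprD subnK.
rewrite uE vE; clearbody u v.
have -> : (u ^+ 2 * t ^+ 2 / v ^+ 2) ^+ m = (u ^+ m) ^+ 2 * (t ^+ m) ^+ 2 / (v ^+ m) ^+ 2.
  by rewrite [LHS]exprMn [(u ^+ 2 * _) ^+ m]exprMn exprVn !(exprAC _ 2 m).
have := expf_neq0 m vn0; have := expf_neq0 m tn0.
move: (v ^+ m) (t ^+ m) (u ^+ m) (v ^+ (n - m)) => v' t' u' w t'0 v'0.
by field; rewrite t'0 v'0.
Qed.

Lemma bin_shift2_le n m : 'C(n.+2, m.+2)%:R <= n.+2%:R ^+ 2 * 'C(n, m)%:R :> R.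
Proof.
rewrite -natrX -natrM ler_nat.
have h j i : ('C(j.+1, i.+1) <= j.+1 * 'C(j, i))%N.
  by rewrite mul_bin_diag leq_pmull.
apply: (leq_trans (h _ _)); rewrite -mulnn -mulnA leq_mul2l/=.
by apply: (leq_trans (h _ _)); rewrite leq_mul2r leqnSn orbT.
Qed.

(** The left side is 99/100 + exp(-s/2)/100, which does not tend to 0, so the range of [s] must be
    bounded. With exp(-s/2) <= 1/(1 + s/2) and the tangent 1 - s/1000 on the right, the claim
    becomes 1 + s/2 <= 5: this is the origin of the cut at 8. *)
Lemma expR_decay s : 0 <= s <= 8 ->
  expR (- (s / 2)) * (1 + 99 / 100 * (expR (s / 2) - 1)) <= expR (- (s / 1000)).
Proof.
move=> /andP[s0 s8].
have e1 : expR (- (s / 2)) * expR (s / 2) = 1.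
  by rewrite -expRD addrC subrr expR0.
have e0 := expR_ge0 (- (s / 2)).
have h1 := expR_ge1Dx (s / 2).
have h2 := expR_ge1Dx (- (s / 1000)).
apply: le_trans h2; nra.
Qed.

(** Coefficients of order [k] are at most s^(-k) times the value at [s = k / n]. Two of the
    nontrivial factors are set aside: choosing them costs n^4 after squaring, and the second bound
    on the tail gives s^(2p+4) for them, hence k^(2p+4) / n^(2p). The other factors use the first
    bound and sum to (1 + u)^(2n), which exp(-k) beats. The last power of [k] is the loss in
    [fact_le]. *)
Lemma occupancy_small a t s n k p : 1 / 2 <= a <= 1 -> 1 / 2 <= t ->
  (2 <= n)%N -> (0 < k)%N -> s = k%:R / n%:R -> s <= 8 ->
  (forall K, \sum_(i < K) cosh_tail a i * s ^+ i <=
     (t * (99 / 100 * (expR (s / 2) - 1))) ^+ 2) ->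
  (forall K, \sum_(i < K) cosh_tail a i * s ^+ i <= s ^+ p.+2 * expR s) ->
  occupancy a t n k <= 16 * expR 17 *
    (k%:R ^+ (2 * p + 5) * expR (- (k%:R / 500))) / n%:R ^+ (2 * p).
Proof.
move=> a1 t1 n2 k0 sE s8 hg1 hg2.
have t0 : 0 < t by apply: lt_le_trans t1; lra.
have n0 : (0 < n)%N by exact: ltn_trans n2.
have [n0' k0'] : (0 < n%:R :> R) /\ (0 < k%:R :> R) by rewrite !ltr0n.
have s0 : 0 < s by rewrite sE divr_gt0.
set g := \sum_(i < k.+1) cosh_tail a i * s ^+ i.
have gt0 i : 0 <= cosh_tail a i * s ^+ i.
  by rewrite mulr_ge0 ?cosh_tail_ge0 ?exprn_ge0// ltW.
have g0 : 0 <= g by exact: sumr_ge0.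
have mc m : mcoef (fun=> cosh_tail a) n k m <= 'C(n, m)%:R * (s ^- k * g ^+ m).
  apply: (@mcoef_le _ _ (fun m k => s ^- k * g ^+ m) k) => //.
  - by move=> i; exact: cosh_tail_ge0.
  - move=> {}m _; rewrite expr0 mulr1; case: m => [|m]; first by rewrite expr0 invr1.
    by rewrite invr_ge0 exprn_ge0// ltW.
  move=> {}m j jk.
  have -> : \sum_(i < j.+1) cosh_tail a i * (s ^- (j - i) * g ^+ m) =
     s ^- j * g ^+ m * \sum_(i < j.+1) cosh_tail a i * s ^+ i.
    rewrite mulr_sumr; apply: eq_bigr => i _.
    have ij : (i <= j)%N by rewrite -ltnS.
    rewrite (_ : s ^+ j = s ^+ (j - i) * s ^+ i); last by rewrite -exprD subnK.
    have := expf_neq0 i (lt0r_neq0 s0); have := expf_neq0 (j - i) (lt0r_neq0 s0).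
    move: (s ^+ i) (s ^+ (j - i)) (g ^+ m) (cosh_tail a i) => x y z w y0 x0.
    by field; rewrite x0 y0.
  rewrite exprSr mulrA ler_wpM2l//.
    by rewrite mulr_ge0 ?exprn_ge0// invr_ge0 exprn_ge0// ltW.
  rewrite /g -(big_mkord xpredT (fun i => cosh_tail a i * s ^+ i)).
  rewrite -[leRHS](big_mkord xpredT (fun i => cosh_tail a i * s ^+ i)).
  by rewrite [leRHS](big_cat_nat (n := j.+1))//= lerDl sumr_ge0.
apply: (le_trans (occupancy_le mc (ltW t0))).
set u := 99 / 100 * (expR (s / 2) - 1).
have u0 : 0 <= u.
  have := expR_ge1Dx (s / 2); rewrite /u; lra.
have gu : g <= (t * u) ^+ 2 by exact: hg1.
have gs : g <= s ^+ p.+2 * expR s by exact: hg2.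
have hsum : \sum_(m < n.-1) 'C(n, m.+2)%:R ^+ 2 / (t ^+ m.+2) ^+ 2 * g ^+ m.+2 <=
    n%:R ^+ 4 * 16 * g ^+ 2 * (1 + u) ^+ (2 * n).
  case: n n2 {n0 n0' sE mc} => [//|[//|n]] _; rewrite -[n.+2.-1]/n.+1.
  have ui : (1 + u) ^+ (2 * n) <= (1 + u) ^+ (2 * n.+2).
    by apply: ler_weXn2l; [rewrite lerDl|rewrite leq_mul2l/= -addn2 leq_addr].
  have c0 : 0 <= n.+2%:R ^+ 4 * 16 * g ^+ 2 by rewrite !mulr_ge0 ?exprn_ge0.
  apply: le_trans (ler_wpM2l c0 ui).
  have := sum_sqr_binomial_le n u0 ler01; rewrite [u + 1]addrC => /(ler_wpM2l c0).
  apply: le_trans; rewrite mulr_sumr; apply: ler_sum => m _.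
  rewrite expr1n mulr1.
  have hc := bin_shift2_le n m.
  have hc2 : 'C(n.+2, m.+2)%:R ^+ 2 <= (n.+2%:R ^+ 2 * 'C(n, m)%:R) ^+ 2 :> R.
    by apply: lerXn2r => //; rewrite nnegrE// mulr_ge0// exprn_ge0.
  (* Only g^m is traded for (tu)^(2m); g^2 is kept for the power of [s]. The leftover t^(-4) is at
     most 16 because t >= 1/2. *)
  have hgm : g ^+ m.+2 / (t ^+ m.+2) ^+ 2 <= 16 * g ^+ 2 * (u ^+ m) ^+ 2.
    have h1 : g ^+ m <= (t ^+ m) ^+ 2 * (u ^+ m) ^+ 2.
      rewrite -exprMn -exprMn -exprM mulnC exprM.
      by apply: lerXn2r => //; rewrite nnegrE// sqr_ge0.
    rewrite ler_pdivrMr; last by rewrite !exprn_gt0.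
    rewrite -(addn2 m) !exprD.
    have h2 : 1 <= 16 * (t ^+ 2) ^+ 2.
      have : 1 / 4 <= t ^+ 2 by rewrite expr2; nra.
      by rewrite [(t ^+ 2) ^+ 2]expr2; nra.
    rewrite [leRHS](_ : _ = g ^+ 2 * ((t ^+ m) ^+ 2 * (u ^+ m) ^+ 2) * (16 * (t ^+ 2) ^+ 2)); last first.
      by move: (t ^+ m) (u ^+ m) => x y; ring.
    rewrite mulrC -[leLHS]mulr1; apply: ler_pM => //.
      by rewrite mulr_ge0// exprn_ge0.
    by rewrite ler_wpM2l ?sqr_ge0.
  rewrite mulrAC -mulrA.
  apply: (le_trans (ler_pM (sqr_ge0 _) _ hc2 hgm)).
    by rewrite divr_ge0 ?sqr_ge0 ?exprn_ge0.
  rewrite le_eqVlt; apply/orP; left; apply/eqP.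
  by move: (u ^+ m) ('C(n, m)%:R : R) (n.+2%:R : R) => x y z; ring.
have T0 : 0 <= k`!%:R / n%:R ^+ k * s ^- k.
  by rewrite mulr_ge0 ?divr_ge0 ?invr_ge0 ?exprn_ge0// ltW.
apply: (le_trans (ler_wpM2l T0 hsum)).
(* The choice [s = k / n] cancels n^k and leaves k! / k^k. *)
have hk : k`!%:R / n%:R ^+ k * s ^- k <= expR 1 * k%:R * expR (- k%:R).
  have -> : k`!%:R / n%:R ^+ k * s ^- k = k`!%:R / k%:R ^+ k.
    by rewrite sE expr_div_n invf_div mulrA mulfVK// expf_neq0// gt_eqF.
  rewrite ler_pdivrMr ?exprn_gt0//; apply: (le_trans (fact_le k0)).
  by rewrite exprS le_eqVlt; apply/orP; left; apply/eqP; ring.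
have hg : g ^+ 2 <= (s ^+ p.+2 * expR 8) ^+ 2.
  apply: lerXn2r; rewrite ?nnegrE//; first by rewrite mulr_ge0 ?exprn_ge0 ?expR_ge0// ltW.
  by apply: (le_trans gs); rewrite ler_wpM2l ?exprn_ge0 ?ler_expR// ltW.
have hu : expR (- k%:R) * (1 + u) ^+ (2 * n) <= expR (- (k%:R / 500)).
  have -> : expR (- k%:R) = expR (- (s / 2)) ^+ (2 * n).
    rewrite -expRM_natl natrM; congr expR; rewrite sE; field; rewrite gt_eqF//.
  have -> : expR (- (k%:R / 500)) = expR (- (s / 1000)) ^+ (2 * n).
    rewrite -expRM_natl natrM; congr expR; rewrite sE; field; rewrite gt_eqF//.
  rewrite -exprMn; apply: lerXn2r; rewrite ?nnegrE ?expR_ge0//.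
    by rewrite mulr_ge0 ?expR_ge0 ?addr_ge0.
  by apply: expR_decay; rewrite ltW.
have c1 : 0 <= n%:R ^+ 4 * 16 * g ^+ 2 * (1 + u) ^+ (2 * n).
  by rewrite !mulr_ge0 ?exprn_ge0 ?addr_ge0 ?sqr_ge0.
apply: (le_trans (ler_wpM2r c1 hk)).
rewrite [leLHS](_ : _ = (16 * expR 1 * k%:R * n%:R ^+ 4) * g ^+ 2 *
   (expR (- k%:R) * (1 + u) ^+ (2 * n))); last first.
  by move: ((1 + u) ^+ _) => z; ring.
have c2 : 0 <= 16 * expR 1 * k%:R * n%:R ^+ 4 :> R.
  by rewrite !mulr_ge0 ?exprn_ge0 ?expR_ge0.
apply: (@le_trans _ _ ((16 * expR 1 * k%:R * n%:R ^+ 4) * (s ^+ p.+2 * expR 8) ^+ 2 *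
   expR (- (k%:R / 500)))).
  apply: ler_pM hu; rewrite ?mulr_ge0 ?expR_ge0 ?exprn_ge0 ?addr_ge0//.
  by rewrite ler_wpM2l.
have e17 : expR 17 = expR 1 * expR 8 ^+ 2 :> R.
  by rewrite -expRM_natl -expRD; congr expR; lra.
have nn : n%:R != 0 :> R by rewrite gt_eqF.
rewrite le_eqVlt; apply/orP; left; apply/eqP.
have -> : k%:R ^+ (2 * p + 5) = (k%:R ^+ p.+2) ^+ 2 * k%:R :> R.
  rewrite (_ : 2 * p + 5 = p.+2 * 2 + 1)%N; last by clear; lia.
  by rewrite exprD exprM expr1.
have -> : n%:R ^+ (2 * p) = (n%:R ^+ p) ^+ 2 :> R by rewrite -exprM mulnC.
have -> : s ^+ p.+2 = k%:R ^+ p.+2 / (n%:R ^+ p * n%:R ^+ 2).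
  by rewrite sE expr_div_n -exprD addn2.
have := expf_neq0 p nn; rewrite e17.
move: (n%:R ^+ p : R) (k%:R ^+ p.+2 : R) (expR (- (k%:R / 500))) => x y z x0.
by field; rewrite x0 nn.
Qed.

Lemma expR1_le4 : expR 1 <= 4 :> R.
Proof.
have h : expR (1 / 2) * expR (- (1 / 2)) = 1 :> R by rewrite -expRD subrr expR0.
have h0 := expR_ge1Dx (- (1 / 2) : R).
have e0 : 0 < expR (1 / 2 : R) by exact: expR_gt0.
have h2 : expR (1 / 2) <= 2 :> R by nra.
have -> : expR 1 = expR (1 / 2) * expR (1 / 2) :> R by rewrite -expRD; congr expR; field.
nra.
Qed.

Lemma pow_expR_decay (c j k : nat) : (0 < c)%N ->
  k%:R ^+ j * expR (- (k%:R / c%:R)) <= (j`! * c ^ j)%:R :> R.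
Proof.
move=> c0; have c0' : (0 : R) < c%:R by rewrite ltr0n.
have x0 : 0 <= k%:R / c%:R :> R by rewrite divr_ge0.
rewrite expRN ler_pdivrMr ?expR_gt0// natrM natrX.
have := ler_wpM2l (exprn_ge0 j (ltW c0')) (le_expR_fact j x0).
rewrite expr_div_n mulrCA divff ?mulr1 ?expf_neq0 ?gt_eqF//.
by move=> /le_trans; apply; rewrite mulrA [_ ^+ _ * _]mulrC.
Qed.

Lemma cosh_tail_shift a s m K : 1 / 2 <= a <= 1 -> 0 <= s ->
  \sum_(i < K) cosh_tail a i * s ^+ i <= \sum_(i < m) cosh_tail a i * s ^+ i +
    s ^+ m * \sum_(i < K) cosh_tail a (m + i) * s ^+ i.
Proof.
move=> a1 s0; have h i : 0 <= cosh_tail a i * s ^+ i.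
  by rewrite mulr_ge0 ?cosh_tail_ge0 ?exprn_ge0.
apply: (@le_trans _ _ (\sum_(i < m + K) cosh_tail a i * s ^+ i)).
  rewrite -(big_mkord xpredT (fun i => cosh_tail a i * s ^+ i)).
  rewrite -[leRHS](big_mkord xpredT (fun i => cosh_tail a i * s ^+ i)).
  by rewrite [leRHS](big_cat_nat (n := K))//= ?leq_addl// lerDl sumr_ge0.
rewrite big_split_ord/= lerD2l mulr_sumr; apply: ler_sum => i _.
by rewrite exprD mulrCA.
Qed.

Lemma cosh_tail_sum_le a s p K : 1 / 2 <= a <= 1 -> 0 <= s ->
  (forall i, (i < p)%N -> cosh_tail a i = 0) ->
  \sum_(i < K) cosh_tail a i * s ^+ i <= s ^+ p * expR s.
Proof.
move=> a1 s0 h; apply: (le_trans (cosh_tail_shift p K a1 s0)).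
rewrite big1 ?add0r => [|i _]; last by rewrite h ?mul0r.
rewrite ler_wpM2l ?exprn_ge0//.
have a11 : 1 / 2 <= (1 : R) <= 1 by lra.
have := sum_cosh_weight_le K a11 s0; rewrite /cosh_mean subrr mul0r addr0 mul1r.
apply: le_trans; apply: ler_sum => i _.
rewrite /cosh_weight subrr mul0r addr0 mul1r mulrC ler_wpM2l ?exprn_ge0//.
rewrite /cosh_tail; case: ifP => _; first by rewrite invr_ge0.
apply: (@le_trans _ _ ((p + i)`!%:R^-1)).
  by rewrite ler_piMl ?invr_ge0// cosh_weight_le1.
by rewrite lef_pV2 ?posrE ?ltr0n ?fact_gt0// ler_nat leq_fact ?leq_addl.
Qed.

Lemma cosh_tail_sum_le_mean a s K : 1 / 2 <= a <= 1 -> 0 <= s ->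
  \sum_(i < K) cosh_tail a i * s ^+ i <=
  cosh_mean a s - 1 - (2 * a - 1) * s - s ^+ 2 / 2.
Proof.
move=> a1 s0; apply: (le_trans (cosh_tail_shift 3 K a1 s0)).
rewrite [X in X + _]big1 ?add0r => [|i _]; last by rewrite /cosh_tail ltn_ord mul0r.
have := sum_cosh_weight_le (3 + K) a1 s0; rewrite big_split_ord/=.
rewrite mulr_sumr [X in _ -> X <= _](eq_bigr
  (fun i : 'I_K => cosh_weight a (3 + i) * (s ^+ (3 + i) / (3 + i)`!%:R))); last first.
  by move=> i _; rewrite /cosh_tail /= exprD; ring.
move: (\sum_(i < K) _) => z.
rewrite !big_ord_recl big_ord0 /= /cosh_weight /bump /= expr0 expr1.
rewrite -[(1 + (1 + 0))%N]/2%N -[(1 + 0)%N]/1%N -[2`!]/2%N -[1`!]/1%N -[0`!]/1%N.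
rewrite expr0 expr1 sqrrN expr1n !divr1; lra.
Qed.

Lemma is_derive_expR_scale (c x : R) :
  is_derive x 1 (fun x => expR (c * x)) (c * expR (c * x)).
Proof.
have d : is_derive x 1 (fun x : R => c * x) c.
  by apply: (is_derive_eq (is_deriveZ c (is_derive_id x 1))); rewrite /GRing.scale/= mulr1.
by apply: (is_derive_eq (is_derive1_comp (is_derive_expR _) d)); rewrite mulrC.
Qed.

Lemma is_derive_expR_comb (A B C D E F x : R) : is_derive x 1
  (fun x => A * expR (1 * x) + B * expR (1 / 2 * x) + C * expR (-1 * x) + D + E * x + F * (x * x))
  (A * expR (1 * x) + B / 2 * expR (1 / 2 * x) - C * expR (-1 * x) + E + 2 * F * x).
Proof.
have dx := is_derive_id x (1 : R).
apply: (is_derive_eq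
  (is_deriveD (is_deriveD (is_deriveD (is_deriveD (is_deriveD
    (is_deriveZ A (is_derive_expR_scale 1 x))
    (is_deriveZ B (is_derive_expR_scale (1 / 2) x)))
    (is_deriveZ C (is_derive_expR_scale (-1) x)))
    (is_derive_cst D x 1))
    (is_deriveZ E dx))
    (is_deriveZ F (is_deriveM dx dx)))).
by rewrite /GRing.scale/=; field.
Qed.
Lemma sqr_expR_half s : expR (1 / 2 * s) * expR (1 / 2 * s) = expR (1 * s) :> R.
Proof. by rewrite -expRD; congr expR; field. Qed.

(** The first two hypotheses say that the value and the slope vanish at 0, the third that the second
    derivative is nonnegative; [is_derive_expR_comb] keeps both derivatives in one family. *)
Lemma expR_comb_ge0 (A B C D E F : R) : A + B + C + D = 0 ->
  A + B / 2 - C + E = 0 ->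
  (forall s, 0 <= s -> 0 <= A * expR (1 * s) + B / 4 * expR (1 / 2 * s) +
     C * expR (-1 * s) + 2 * F) ->
  forall s, 0 <= s -> 0 <= A * expR (1 * s) + B * expR (1 / 2 * s) +
     C * expR (-1 * s) + D + E * s + F * (s * s).
Proof.
move=> h0 h1 h2.
apply: (nonneg_of_derive (is_derive_expR_comb A B C D E F)).
  by rewrite !mulr0 expR0; lra.
move=> s s0.
suff : 0 <= A * expR (1 * s) + B / 2 * expR (1 / 2 * s) + (- C) * expR (-1 * s) +
    E + 2 * F * s + 0 * (s * s) by rewrite mul0r addr0 (mulNr C).
apply: (nonneg_of_derive (is_derive_expR_comb A (B / 2) (- C) E (2 * F) 0)) => //.
  by rewrite !mulr0 expR0; lra.
move=> x x0; have := h2 _ x0.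
rewrite !mulr0 !mul0r !addr0 (_ : B / 2 / 2 = B / 4); last by field.
by rewrite (mulNr C) opprK.
Qed.

Lemma cosh_tail1_le s K : 0 <= s ->
  \sum_(i < K) cosh_tail 1 i * s ^+ i <=
  (11 / 10 * (99 / 100 * (expR (s / 2) - 1))) ^+ 2.
Proof.
move=> s0; have a1 : 1 / 2 <= (1 : R) <= 1 by lra.
apply: (le_trans (cosh_tail_sum_le_mean K a1 s0)).
rewrite /cosh_mean subrr mul0r addr0 mul1r.
have -> : s / 2 = 1 / 2 * s by field.
(* This is 8/7 (exp(s/2) - 1)^2 minus the remainder exp(s) - 1 - s - s^2/2. The constant 8/7 is
   below (11/10 · 99/100)^2 = 1.185921. *)
have : 0 <= 1 / 7 * expR (1 * s) + (- (16 / 7)) * expR (1 / 2 * s) +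
     0 * expR (-1 * s) + 15 / 7 + 1 * s + 1 / 2 * (s * s).
  apply: expR_comb_ge0 => //; [lra|lra|] => {s0}s s0.
  rewrite -sqr_expR_half; have := sqr_ge0 (expR (1 / 2 * s) - 2); nra.
rewrite -[X in expR X - _](mul1r s) -sqr_expR_half.
have : 1 <= expR (1 / 2 * s) by rewrite -[leLHS]expR0 ler_expR; lra.
move: (expR _) => y y1 h; nra.
Qed.

Lemma cosh_tail_half_le s K : 0 <= s ->
  \sum_(i < K) cosh_tail (1 / 2) i * s ^+ i <=
  (96 / 125 * (99 / 100 * (expR (s / 2) - 1))) ^+ 2.
Proof.
move=> s0; have a1 : 1 / 2 <= (1 / 2 : R) <= 1 by lra.
apply: (le_trans (cosh_tail_sum_le_mean K a1 s0)); rewrite /cosh_mean.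
have -> : s / 2 = 1 / 2 * s by field.
(* This is 4/7 (exp(s/2) - 1)^2 minus the remainder cosh(s) - 1 - s^2/2. The constant 4/7 is below
   (96/125 · 99/100)^2, which is about 0.578. *)
have : 0 <= 1 / 14 * expR (1 * s) + (- (8 / 7)) * expR (1 / 2 * s) +
     (- (1 / 2)) * expR (-1 * s) + 11 / 7 + 0 * s + 1 / 2 * (s * s).
  apply: expR_comb_ge0 => //; [lra|lra|] => {s0}s s0.
  rewrite -sqr_expR_half; have := sqr_ge0 (expR (1 / 2 * s) - 2).
  have : expR (-1 * s) <= 1 by rewrite -[leRHS]expR0 ler_expR; lra.
  nra.
rewrite -(sqr_expR_half s) (_ : expR s = expR (1 / 2 * s) * expR (1 / 2 * s)); last first.
  by rewrite sqr_expR_half mul1r.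
rewrite (_ : expR (- s) = expR (-1 * s)); last by rewrite mulN1r.
have : 1 <= expR (1 / 2 * s) by rewrite -[leLHS]expR0 ler_expR; lra.
move: (expR (1 / 2 * s)) (expR (-1 * s)) => y z y1 h; nra.
Qed.

Lemma cosh_tail1_small i : (i < 3)%N -> cosh_tail 1 i = 0 :> R.
Proof. by rewrite /cosh_tail => ->. Qed.

Lemma cosh_tail_half_small i : (i < 4)%N -> cosh_tail (1 / 2) i = 0 :> R.
Proof.
case: i => [|[|[|[|i]]]]//= _; rewrite /cosh_tail /cosh_weight/= -signr_odd/= expr1.
by rewrite (_ : 1 / 2 + _ = 0 :> R) ?mul0r//; lra.
Qed.

Lemma cosh_mean1_large s : cosh_mean 1 s * expR (- s) <= (93 / 100 * (11 / 10)) ^+ 2.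
Proof. by rewrite /cosh_mean subrr mul0r addr0 mul1r -expRD subrr expR0; lra. Qed.

Lemma cosh_mean_half_large s : 8 <= s ->
  cosh_mean (1 / 2) s * expR (- s) <= (93 / 100 * (96 / 125)) ^+ 2.
Proof.
move=> s8; rewrite /cosh_mean mulrDl -!mulrA -!expRD subrr expR0.
(* exp(s/2) >= 1 + s/2 >= 5 gives exp(-2s) <= 5^(-4), so the left side is at most (1 + 1/625)/2,
   while the right side exceeds 0.51. *)
have h1 := expR_ge1Dx (- (- s / 4 - s / 4)).
have h2 : expR (- s / 4 - s / 4) * expR (- (- s / 4 - s / 4)) = 1.
  by rewrite -expRD subrr expR0.
have h3 : expR (- s - s) = (expR (- s / 4 - s / 4)) ^+ 4.
  by rewrite -expRM_natl; congr expR; field.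
have h4 : expR (- s / 4 - s / 4) <= 1 / 5.
  have := expR_gt0 (- s / 4 - s / 4); nra.
have : expR (- s - s) <= (1 / 5) ^+ 4.
  rewrite h3; move: (1 / 5) h4 => c h4; apply: lerXn2r => //; rewrite nnegrE ?expR_ge0//.
  by apply: le_trans h4; exact: expR_ge0.
lra.
Qed.

Lemma expR17_le : expR 17 <= (4 ^ 17)%:R :> R.
Proof.
rewrite natrX (_ : expR 17 = expR 1 ^+ 17); last by rewrite -expRM_natl mulr1.
by apply: lerXn2r; rewrite ?nnegrE ?expR_ge0 ?expR1_le4.
Qed.

End OccupancyBound.

(* [a = 1] is the general case and [a = 1 / 2] the symmetric one, where
   [cosh_weight a] keeps the even indices only. *)
Definition admissible (R : realType) (a t : R) (p : nat) :=
  [/\ 1 / 2 <= a <= 1, 1 / 2 <= t,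
    (forall s K, 0 <= s -> \sum_(i < K) cosh_tail a i * s ^+ i <=
       (t * (99 / 100 * (expR (s / 2) - 1))) ^+ 2),
    (forall i, (i < p.+2)%N -> cosh_tail a i = 0) &
    (forall s, 8 <= s -> cosh_mean a s * expR (- s) <= (93 / 100 * t) ^+ 2)].

(** Each [t] has its square just below the reciprocal of the threshold on [Delta]: 1.21 < 1/0.82
    here, and 0.589824 < 1/1.69 in the symmetric case. The exponent p + 2 is the first order that
    survives, 3 here and 4 there. *)
Lemma admissible1 (R : realType) : @admissible R 1 (11 / 10) 1.
Proof.
split; [lra|lra| | |].
- by move=> s K; exact: cosh_tail1_le.
- exact: cosh_tail1_small.
- by move=> s _; exact: cosh_mean1_large.
Qed.

Lemma admissible_half (R : realType) : @admissible R (1 / 2) (96 / 125) 2.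
Proof.
split; [lra|lra| | |].
- by move=> s K; exact: cosh_tail_half_le.
- exact: cosh_tail_half_small.
- exact: cosh_mean_half_large.
Qed.

(** The constant is a natural number chosen before the field [R], since the theorem fixes its
    constants before [R]; this is why exp(17) is replaced by 4^17. *)
Lemma occupancy_bound p : exists C : nat, forall (R : realType) (a t : R) n k,
  admissible a t p -> (2 <= n)%N -> (0 < k)%N ->
  occupancy a t n k <= C%:R / n%:R ^+ (2 * p).
Proof.
set j := (2 * p + 5)%N; set l := (2 * p)%N.
(* The two summands serve the two regimes: the first bounds k^j exp(-k/500) for k/n <= 8, the second
   n^l exp(-n/100) beyond. *)
exists (16 * 4 ^ 17 * (j`! * 500 ^ j) + 2 * (l`! * 100 ^ l))%N.
move=> R a t n k [a1 t1 h1 h2 h3] n2 k0.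
have n0 : (0 < n)%N by exact: ltn_trans n2.
have n0' : 0 < n%:R ^+ l :> R by rewrite exprn_gt0// ltr0n.
have t0 : 0 < t by apply: lt_le_trans t1; lra.
have s0 : 0 <= k%:R / n%:R :> R by rewrite divr_ge0.
have := @expR17_le R; move: (4 ^ 17)%N => c e17.
rewrite natrD mulrDl; have [s8|/ltW s8] := leP (k%:R / n%:R : R) 8.
  apply: (le_trans (occupancy_small a1 t1 n2 k0 erefl s8 (fun K => h1 _ K s0) _)).
    by move=> K; apply: cosh_tail_sum_le h2.
  rewrite -/j -/l; apply: ler_wpDr; first exact: divr_ge0 (ler0n _ _) (ltW n0').
  rewrite ler_pM2r ?invr_gt0//.
  rewrite natrM [(16 * _)%:R]natrM -mulrA -mulrA ler_wpM2l//.
  apply: ler_pM; rewrite ?mulr_ge0 ?expR_ge0 ?exprn_ge0//.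
  exact: (@pow_expR_decay R 500 j k isT).
apply: (le_trans (occupancy_large a1 t0 n0 k0 erefl s8 (h3 _ s8))).
apply: ler_wpDl; first exact: divr_ge0 (ler0n _ _) (ltW n0').
rewrite natrM -mulrA ler_wpM2l// ler_pdivlMr// mulrC.
apply: le_trans (@pow_expR_decay R 100 l n isT).
rewrite ler_wpM2l ?exprn_ge0//.
rewrite [X in _ <= X](_ : _ = expR (- (1 / 200)) ^+ (2 * n)).
  have : 199 / 200 <= expR (- (1 / 200)) :> R by apply: le_trans (expR_ge1Dx _); lra.
  have : 0 <= 199 / 200 :> R by lra.
  move: (199 / 200) => q q0 q1.
  by apply: lerXn2r => //; rewrite nnegrE expR_ge0.
by rewrite -expRM_natl natrM; congr expR; field.
Qed.

(** * The inequality for the weighted coefficient sum *)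

Section CoreInequality.
Context {R : realType}.
Variables (a t : R) (p n : nat) (B : nat -> nat -> R) (chi : nat -> R) (c : nat -> nat -> R).
Hypotheses (apt : admissible a t p) (n2 : (2 <= n)%N).
Hypothesis B_even : forall j i, (i < 3)%N || (cosh_weight a i != 1) -> B j i = 0.
Hypothesis B_chi : forall j N, \sum_(i < N) i`!%:R * B j i ^+ 2 <= chi j.
Hypothesis c0 : forall k, c 0%N k = (k == 0%N)%:R.
Hypothesis cS : forall m k, c m.+1 k = c m k + \sum_(i < k.+1) B m i * c m (k - i)%N.

Let D := (\sum_(j < n) chi j) / n%:R.

Let n0' : 0 < n%:R :> R. Proof. by rewrite ltr0n (ltn_trans _ n2). Qed.

Let chi0 j : 0 <= chi j.
Proof. by have := B_chi j 0; rewrite big_ord0. Qed.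

Let D0 : 0 <= D. Proof. by rewrite divr_ge0 ?sumr_ge0. Qed.

Let a1 : 1 / 2 <= a <= 1. Proof. by case: apt. Qed.

Let t0 : 0 < t. Proof. by case: apt => _ t1 _ _ _; apply: lt_le_trans t1; lra. Qed.

Let H j i := i`!%:R * B j i ^+ 2.

Let H0 j i : 0 <= H j i. Proof. by rewrite mulr_ge0// sqr_ge0. Qed.

Let w0 k : 0 <= k`!%:R / n%:R ^+ k :> R.
Proof. by rewrite divr_ge0 ?exprn_ge0. Qed.

Let occupancy_ge0 k : 0 <= occupancy a t n k.
Proof.
apply: mulr_ge0 => //; apply: sumr_ge0 => m _.
rewrite mulr_ge0 ?divr_ge0 ?sqr_ge0 ?mcoef_ge0// => _ i.
exact: cosh_tail_ge0.
Qed.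

Lemma core_B_small j i : (i < p.+2)%N -> B j i = 0.
Proof.
move=> ip; have [i3|i3] := leqP 3 i; last by rewrite B_even// i3.
case: apt => _ _ _ /(_ _ ip) + _; rewrite /cosh_tail ltnNge i3/= => h.
apply: B_even; apply/orP; right; apply/eqP => w1; move: h; rewrite w1 mul1r.
by move/eqP; rewrite invr_eq0 pnatr_eq0 -leqn0 leqNgt fact_gt0.
Qed.

Lemma core_B_sqr j i : B j i ^+ 2 <= cosh_tail a i * H j i.
Proof.
have [hi|] := boolP ((i < 3)%N || (cosh_weight a i != 1)).
  by rewrite B_even// expr0n/= mulr_ge0 ?cosh_tail_ge0.
rewrite negb_or negbK => /andP[i3 /eqP w]; rewrite /cosh_tail (negbTE i3) w mul1r /H.
by rewrite mulrA mulVf ?mul1r// pnatr_eq0 -lt0n fact_gt0.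
Qed.

(** Cauchy-Schwarz over the [n] variables costs a factor n, and only orders k >= p + 2 contribute,
    so n / n^k <= 1 / n^(p+1). One more power of n is absorbed in the average [D]. *)
Lemma core_linear N :
  \sum_(1 <= k < N) k`!%:R / n%:R ^+ k * mcoef B n k 1 ^+ 2 <= D / n%:R ^+ p.
Proof.
have h k : k`!%:R / n%:R ^+ k * mcoef B n k 1 ^+ 2 <=
    \sum_(j < n) H j k / n%:R ^+ p.+1.
  rewrite mcoef_1; have [kp|kp] := ltnP k p.+2.
    rewrite big1 => [|j _]; last exact: core_B_small.
    by rewrite expr0n/= mulr0 sumr_ge0// => j _; rewrite divr_ge0// exprn_ge0// ltW.
  have cs := @cauchy_schwarz_sum R _ (index_enum 'I_n) xpredT (fun j => B j k)
     (fun=> 1) (fun j => B j k ^+ 2) _ _ _.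
  apply: (@le_trans _ _ (k`!%:R / n%:R ^+ k * (n%:R * \sum_(j < n) B j k ^+ 2))).
    apply: ler_wpM2l => //; move: cs; rewrite sumr_const card_ord; apply => // i _.
      exact: sqr_ge0.
    by rewrite mul1r.
  rewrite mulr_sumr mulr_sumr; apply: ler_sum => j _.
  rewrite /H [leRHS](_ : _ = k`!%:R * B j k ^+ 2 * n%:R / n%:R ^+ p.+2); last first.
    by rewrite [n%:R ^+ p.+2]exprS; field; rewrite expf_neq0// gt_eqF.
  rewrite [leLHS](_ : _ = k`!%:R * B j k ^+ 2 * n%:R / n%:R ^+ k); last by ring.
  apply: ler_wpM2l; first exact: mulr_ge0 (H0 j k) (ltW n0').
  rewrite lef_pV2 ?posrE ?exprn_gt0//; apply: ler_weXn2l => //.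
  by rewrite ler1n (ltn_trans _ n2).
apply: (le_trans (ler_sum _ (fun k _ => h k))).
rewrite exchange_big/= /D -mulrA mulr_suml; apply: ler_sum => j _.
rewrite -mulr_suml -invfM -exprS ler_wpM2r// ?invr_ge0 ?exprn_ge0//.
apply: le_trans (B_chi j N); rewrite -(big_mkord xpredT (H j)).
case: N => [|N]; first by rewrite !big_geq.
by rewrite [leRHS]big_nat_recl//= big_add1/= lerDr.
Qed.

(** After Cauchy-Schwarz the first factor is [occupancy], bounded by [q] for every order. In the
    second, the binomial from Maclaurin's inequality cancels the weight and leaves the geometric
    series of t^2 D starting at exponent 2. *)
Lemma core_higher N q : (forall k, (0 < k)%N -> occupancy a t n k <= q) ->
  t ^+ 2 * D < 1 ->
  \sum_(1 <= k < N) k`!%:R / n%:R ^+ k * (\sum_(m < n.-1) mcoef B n k m.+2) ^+ 2 <=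
  q * ((t ^+ 2 * D) ^+ 2 / (1 - t ^+ 2 * D)).
Proof.
move=> hq tD.
have q0 : 0 <= q.
  by apply: le_trans (hq 1%N isT).
pose E k := \sum_(m < n.-1) (t ^+ m.+2) ^+ 2 / 'C(n, m.+2)%:R * mcoef H n k m.+2.
have mn (m : 'I_n.-1) : (m.+2 <= n)%N by move: (ltn_ord m); rewrite ltn_predRL.
have C0 (m : 'I_n.-1) : 0 < 'C(n, m.+2)%:R :> R by rewrite ltr0n bin_gt0 mn.
have hk k : (0 < k)%N ->
    k`!%:R / n%:R ^+ k * (\sum_(m < n.-1) mcoef B n k m.+2) ^+ 2 <= q * E k.
  move=> k0; have E0 : 0 <= E k.
    apply: sumr_ge0 => m _; rewrite mulr_ge0 ?mcoef_ge0//.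
    by rewrite divr_ge0 ?sqr_ge0.
  apply: le_trans (ler_wpM2r E0 (hq k k0)).
  rewrite /occupancy -[leRHS]mulrA; apply: ler_wpM2l => //.
  apply: cauchy_schwarz_sum => m _.
  - rewrite mulr_ge0 ?mcoef_ge0 ?divr_ge0 ?sqr_ge0//.
    by move=> _ i; exact: cosh_tail_ge0.
  - by rewrite mulr_ge0 ?mcoef_ge0 ?divr_ge0 ?sqr_ge0.
  have h := @mcoef_cauchy_schwarz _ B (fun=> cosh_tail a) H n k m.+2
     (fun _ i => cosh_tail_ge0 i a1) H0 core_B_sqr.
  apply: (le_trans h); rewrite le_eqVlt; apply/orP; left; apply/eqP.
  have tm : t ^+ m.+2 != 0 by rewrite expf_neq0// gt_eqF.
  by field; rewrite tm gt_eqF.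
rewrite big_nat_cond; apply: (@le_trans _ _ (\sum_(1 <= k < N | (1 <= k < N)%N && true) q * E k)).
  by apply: ler_sum => k /andP[/andP[k0 _] _]; exact: hk.
rewrite -big_nat_cond -mulr_sumr ler_wpM2l//.
rewrite exchange_big/=.
apply: (@le_trans _ _ (\sum_(m < n.-1) (t ^+ 2 * D) ^+ m.+2)).
  apply: ler_sum => m _; rewrite -mulr_sumr.
  have hm : \sum_(1 <= k < N) mcoef H n k m.+2 <= 'C(n, m.+2)%:R * D ^+ m.+2.
    apply: le_trans (mcoef_maclaurin n m.+2 H0 (fun j => B_chi j N)).
    rewrite -(big_mkord xpredT (fun k => mcoef H n k m.+2)).
    case: N => [|N]; first by rewrite !big_geq.
    by rewrite [leRHS]big_nat_recl//= big_add1/= lerDr mcoef_ge0.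
  apply: (le_trans (ler_wpM2l _ hm)); first by rewrite divr_ge0 ?sqr_ge0.
  by rewrite mulrA mulfVK ?gt_eqF// [leRHS]exprMn exprAC.
set x := t ^+ 2 * D; have x0 : 0 <= x by rewrite mulr_ge0 ?sqr_ge0.
rewrite ler_pdivlMr ?subr_gt0//.
have -> : \sum_(m < n.-1) x ^+ m.+2 = x ^+ 2 * \sum_(m < n.-1) x ^+ m.
  by rewrite mulr_sumr; apply: eq_bigr => m _; rewrite -exprD.
rewrite -mulrA -[leRHS]mulr1 ler_wpM2l ?sqr_ge0//.
by rewrite -[1 - x]opprB mulrN mulrC -subrX1 opprB gerBl exprn_ge0.
Qed.

Lemma sqrD_le_weighted (M u v : R) : 1 < M ->
  (u + v) ^+ 2 <= M / (M - 1) * u ^+ 2 + M * v ^+ 2.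
Proof.
move=> M1; rewrite -subr_ge0.
have -> : M / (M - 1) * u ^+ 2 + M * v ^+ 2 - (u + v) ^+ 2 =
  (u - (M - 1) * v) ^+ 2 / (M - 1).
  by field; rewrite subr_eq0 gt_eqF.
by rewrite divr_ge0 ?sqr_ge0// subr_ge0 ltW.
Qed.

(** With M = n^p, the weight M / (M - 1) on the linear part turns D / M into exactly D / (M - 1).
    The weight M on the rest is affordable because its bound carries M^(-2). *)
Lemma core_inequality N (C : R) : (0 < p)%N ->
  (forall k, (0 < k)%N -> occupancy a t n k <= C / n%:R ^+ (2 * p)) ->
  t ^+ 2 * D < 1 ->
  \sum_(1 <= k < N) k`!%:R / n%:R ^+ k * c n k ^+ 2 <=
  (D + C * ((t ^+ 2 * D) ^+ 2 / (1 - t ^+ 2 * D))) / (n%:R ^+ p - 1).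
Proof.
move=> p0 hC tD; set M := n%:R ^+ p.
have M1 : 1 < M by rewrite exprn_egt1// -?lt0n// ltr1n.
have M0 : 0 < M by apply: lt_trans M1.
have Mn1 : 0 < M - 1 by rewrite subr_gt0.
apply: (@le_trans _ _ (\sum_(1 <= k < N) (
   M / (M - 1) * (k`!%:R / n%:R ^+ k * mcoef B n k 1 ^+ 2) +
   M * (k`!%:R / n%:R ^+ k * (\sum_(m < n.-1) mcoef B n k m.+2) ^+ 2)))).
  rewrite big_nat_cond [leRHS]big_nat_cond; apply: ler_sum => k /andP[/andP[k0 _] _].
  rewrite (mcoef_sum n k c0 cS).
  have -> : \sum_(m < n.+1) mcoef B n k m = mcoef B n k 1 + \sum_(m < n.-1) mcoef B n k m.+2.
    case: (n) n2 => [//|[//|n']] _; rewrite big_ord_recl big_ord_recl mcoef_0.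
    by rewrite eqn0Ngt k0 add0r.
  rewrite [leRHS](_ : _ = k`!%:R / n%:R ^+ k * (M / (M - 1) * mcoef B n k 1 ^+ 2 +
    M * (\sum_(m < n.-1) mcoef B n k m.+2) ^+ 2)); last by rewrite mulrDr !(mulrCA (_ / _ ^+ k)).
  apply: ler_wpM2l => //.
  exact: sqrD_le_weighted.
rewrite big_split/= -!mulr_sumr.
apply: (le_trans (lerD (ler_wpM2l _ (core_linear N)) (ler_wpM2l _ (core_higher N hC tD)))).
- by rewrite divr_ge0 ?ltW.
- exact: ltW.
set X := _ / (1 - _); have X0 : 0 <= X.
  by rewrite divr_ge0 ?sqr_ge0// subr_ge0 ltW.
have C0 : 0 <= C.
  have : 0 <= C / n%:R ^+ (2 * p).
    by apply: le_trans (hC 1%N isT).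
  by rewrite pmulr_lge0// invr_gt0 exprn_gt0.
have -> : n%:R ^+ (2 * p) = M ^+ 2 :> R by rewrite -exprM mulnC.
rewrite -/M mulrDl; apply: lerD.
  by rewrite le_eqVlt; apply/orP; left; apply/eqP; field; rewrite !gt_eqF.
rewrite [leLHS](_ : _ = C * X / M); last by field; rewrite !gt_eqF.
apply: ler_wpM2l; first exact: mulr_ge0.
by rewrite lef_pV2 ?posrE// gerBl.
Qed.

End CoreInequality.

(** * Hermite moments under the Gaussian law *)

Section IntegralDensity.
Context d (T : measurableType d) (R : realType).
Variables (nu : {finite_measure set T -> \bar R}) (mu : {sigma_finite_measure set T -> \bar R}).
Variable p : T -> R.
Hypotheses (mp : measurable_fun setT p) (p0 : forall x, 0 <= p x).
Hypothesis nuE : forall A, measurable A -> nu A = (\int[mu]_(x in A) (p x)%:E)%E.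

Lemma density_dominates : nu `<< mu.
Proof.
apply/null_content_dominatesP => A mA A0; rewrite nuE//.
by apply: null_set_integral => //; exact/measurable_funTS/measurable_EFinP.
Qed.

(** The Radon-Nikodym derivative has the same integrals as [p] over all measurable sets, hence
    agrees with it almost everywhere. The generality serves both the Gaussian law against Lebesgue
    measure and a law against the Gaussian. *)
Lemma ge0_integral_density (f : T -> \bar R) : (forall x, 0 <= f x)%E ->
  measurable_fun setT f ->
  (\int[nu]_x f x = \int[mu]_x (f x * (p x)%:E))%E.
Proof.
move=> f0 mf; have numu := density_dominates.
rewrite -(Radon_Nikodym_SigmaFinite.change_of_variables numu)//.
set g := Radon_Nikodym_SigmaFinite.f nu mu.
have ig : mu.-integrable setT g by exact: Radon_Nikodym_SigmaFinite.f_integrable.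
have mg := measurable_int _ ig.
have gp : ae_eq mu setT g (EFin \o p).
  apply: integral_ae_eq => //; first exact/measurable_EFinP.
  by move=> E _ mE; rewrite -Radon_Nikodym_SigmaFinite.f_integral// nuE.
apply: ge0_ae_eq_integral => //.
- exact: emeasurable_funM.
- by apply: emeasurable_funM => //; exact/measurable_EFinP.
- by move=> x _; rewrite mule_ge0// Radon_Nikodym_SigmaFinite.f_ge0.
- by move=> x _; rewrite mule_ge0// lee_fin.
by apply: filterS gp => x /= h _; rewrite h.
Qed.

Lemma integrable_densityP (f : T -> R) : measurable_fun setT f ->
  nu.-integrable setT (EFin \o f) <-> mu.-integrable setT (EFin \o (f \* p)).
Proof.
move=> mf.
have e : (\int[nu]_x `|(f x)%:E| = \int[mu]_x `|(f x * p x)%:E|)%E.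
  rewrite ge0_integral_density//.
    by apply: eq_integral => x _; rewrite /= normrM [`|p x|]ger0_norm.
  by apply: measurableT_comp => //; exact/measurable_EFinP.
split=> /integrableP[_ h]; apply/integrableP; split.
- by apply/measurable_EFinP; exact: measurable_funM.
- by move: h; rewrite /= e.
- exact/measurable_EFinP.
- by rewrite /= e.
Qed.

(** f is the difference of the nonnegative functions f + |f| and |f|, and the integral of the latter
    is finite and can be subtracted. *)
Lemma integral_density (f : T -> R) : nu.-integrable setT (EFin \o f) ->
  (\int[nu]_x (f x)%:E = \int[mu]_x (f x * p x)%:E)%E.
Proof.
move=> fi; have mf : measurable_fun setT f by exact/measurable_EFinP/(measurable_int _ fi).
have fpi : mu.-integrable setT (EFin \o (f \* p)) by exact/integrable_densityP.
have ai : nu.-integrable setT (EFin \o (fun x => `|f x|)) by exact: integrable_norm.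
have mn : measurable_fun setT (fun x => `|f x|) by exact: measurableT_comp.
have api : mu.-integrable setT (EFin \o ((fun x => `|f x|) \* p)) by exact/integrable_densityP.
have faD : (\int[nu]_x (f x + `|f x|)%:E =
    \int[nu]_x (f x)%:E + \int[nu]_x (`|f x|)%:E)%E.
  by under eq_integral do rewrite EFinD; rewrite integralD.
have faDp : (\int[mu]_x ((f x + `|f x|) * p x)%:E =
    \int[mu]_x (f x * p x)%:E + \int[mu]_x (`|f x| * p x)%:E)%E.
  by under eq_integral do rewrite mulrDl EFinD; rewrite integralD.
have e1 : (\int[nu]_x (`|f x|)%:E = \int[mu]_x (`|f x| * p x)%:E)%E.
  rewrite ge0_integral_density//; first exact/measurable_EFinP.
have e2 : (\int[nu]_x (f x + `|f x|)%:E = \int[mu]_x ((f x + `|f x|) * p x)%:E)%E.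
  rewrite ge0_integral_density//.
    by move=> x; rewrite lee_fin -lerBlDl sub0r ler_normr lexx orbT.
  by apply/measurable_EFinP; exact: measurable_funD.
have : (\int[nu]_x (`|f x|)%:E)%E \is a fin_num by exact: integrable_fin_num.
move: faD; rewrite e2 faDp e1 => /[swap] h.
by move=> /(congr1 (fun z => z - \int[mu]_x (`|f x| * p x)%:E)%E); rewrite !addeK.
Qed.

End IntegralDensity.

(** * Exponential moments and Gaussian integration by parts *)

Section ExpMoments.
Context {R : realType}.
Implicit Types (f g : R -> R) (q : {poly R}).

Local Notation RT := (measurableTypeR R).

Definition exp_moments (nu : {measure set RT -> \bar R}) :=
  forall c : R, nu.-integrable setT (fun x => (expR (c * `|x|))%:E).

(** An algebra of functions that contains the polynomials and is integrable under every law with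
    exponential moments; integrability conditions are discharged through it. *)
Definition exp_bounded f := measurable_fun setT f /\
  exists A c : R, forall x, `|f x| <= A * expR (c * `|x|).

Lemma exp_bounded_integrable (nu : {measure set RT -> \bar R}) f : exp_moments nu -> exp_bounded f ->
  nu.-integrable setT (EFin \o f).
Proof.
move=> hnu [mf [A [c fA]]].
apply: (@le_integrable _ RT R nu setT _ _ (fun x => (A * expR (c * `|x|))%:E)) => //.
- exact/measurable_EFinP.
- by move=> x _ /=; rewrite lee_fin (le_trans (fA x))// ler_norm.
- rewrite (_ : (fun x => _) = (fun x : RT => A%:E * (expR (c * `|x|))%:E)%E)//.
  by apply: integrableZl => //; exact: hnu.
Qed.

Lemma exp_bounded_cst (a : R) : exp_bounded (cst a).
Proof.
split; first exact: measurable_cst.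
by exists `|a|, 0 => x; rewrite mul0r expR0 mulr1.
Qed.

Lemma expR_norm_le_max (c c' x : R) : c <= c' -> expR (c * `|x|) <= expR (c' * `|x|).
Proof. by move=> cc'; rewrite ler_expR ler_wpM2r. Qed.

Lemma exp_boundedD f g : exp_bounded f -> exp_bounded g ->
  exp_bounded (fun x => f x + g x).
Proof.
move=> [mf [A [c fA]]] [mg [B [e gB]]]; split; first exact: measurable_funD.
exists (`|A| + `|B|), (Num.max c e) => x; apply: (le_trans (ler_normD _ _)).
have h a b (m : R) : b <= m -> a * expR (b * `|x|) <= `|a| * expR (m * `|x|).
  move=> bm; apply: (@le_trans _ _ (`|a| * expR (b * `|x|))).
    by rewrite ler_wpM2r ?expR_ge0 ?ler_norm.
  by rewrite ler_wpM2l// expR_norm_le_max.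
by rewrite mulrDl lerD// ?(le_trans (fA x))// ?(le_trans (gB x))// h// le_max lexx ?orbT.
Qed.

Lemma exp_boundedM f g : exp_bounded f -> exp_bounded g ->
  exp_bounded (fun x => f x * g x).
Proof.
move=> [mf [A [c fA]]] [mg [B [e gB]]]; split; first exact: measurable_funM.
exists (A * B), (c + e) => x; rewrite normrM.
by rewrite mulrDl expRD mulrACA ler_pM.
Qed.

Lemma exp_bounded_horner q : exp_bounded (fun x => q.[x]).
Proof.
elim/poly_ind: q => [|q a IH].
  by under eq_fun do rewrite horner0; exact: exp_bounded_cst.
under eq_fun do rewrite !hornerE; apply: exp_boundedD; last exact: exp_bounded_cst.
apply: exp_boundedM => //; split; first exact: measurable_id.
by exists 1, 1 => x; rewrite !mul1r; apply: le_trans (expR_ge1Dx _); rewrite lerDr.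
Qed.

Lemma exp_bounded_sqr f : exp_bounded f -> exp_bounded (fun x => f x ^+ 2).
Proof. by move=> hf; under eq_fun do rewrite expr2; exact: exp_boundedM. Qed.

Local Notation gauss := (normal_prob (0 : R) 1 : probability RT R).
Local Notation lam := (@lebesgue_measure R).

Lemma std_normal_densityE : normal_pdf (0 : R) 1 = @std_normal_density R.
Proof.
apply/funext => x; rewrite /normal_pdf oner_eq0 /std_normal_density.
by rewrite /normal_peak /normal_fun subr0 expr1n mul1r mulrC mulr_natl.
Qed.

Lemma std_normal_density_gt0 x : 0 < @std_normal_density R x.
Proof.
by rewrite divr_gt0 ?expR_gt0// sqrtr_gt0 mulr_gt0// pi_gt0.
Qed.

Lemma measurable_std_normal_density : measurable_fun setT (@std_normal_density R).
Proof. by rewrite -std_normal_densityE; exact: measurable_normal_pdf. Qed.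

Lemma gaussE (A : set R) : measurable A ->
  gauss A = (\int[lam]_(x in A) (@std_normal_density R x)%:E)%E.
Proof. by rewrite -std_normal_densityE. Qed.

(** Completing the square: exponential tilting moves the normal density to mean [c]. *)
Lemma normal_pdf_shift (c x : R) :
  expR (c * x) * normal_pdf 0 1 x = expR (c ^+ 2 / 2) * normal_pdf c 1 x.
Proof.
rewrite /normal_pdf oner_eq0 /normal_fun.
rewrite mulrCA [RHS]mulrCA -!expRD; congr (_ * expR _).
by rewrite expr1n mulr2n; field.
Qed.

Lemma gauss_exp_moments : exp_moments gauss.
Proof.
move=> c.
have mexp (a : R) : measurable_fun setT (fun x : R => expR (a * x)).
  by apply: measurableT_comp => //; exact: measurable_funM.
have h (a : R) : gauss.-integrable setT (EFin \o (fun x => expR (a * x))).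
  apply/(@integrable_densityP _ RT R gauss lam (@std_normal_density R)) => //.
  - exact: measurable_std_normal_density.
  - by move=> x; rewrite ltW ?std_normal_density_gt0.
  - exact: gaussE.
  - exact: mexp.
  rewrite -std_normal_densityE.
  have -> : (EFin \o ((fun x => expR (a * x)) \* normal_pdf 0 1)) =
      (fun x => (expR (a ^+ 2 / 2))%:E * (normal_pdf a 1 x)%:E)%E.
    by apply/funext => x /=; rewrite normal_pdf_shift.
  exact/integrableZl/integrable_normal_pdf.
apply: (@le_integrable _ RT R gauss setT _ _ (fun x => ((expR (c * x))%:E + (expR (- c * x))%:E)%E)) => //.
- apply/measurable_EFinP; apply: measurableT_comp => //; apply: measurable_funM => //.
- move=> x _; rewrite -EFinD /= lee_fin.
  rewrite [leLHS]ger0_norm ?expR_ge0// [leRHS]ger0_norm ?addr_ge0 ?expR_ge0//.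
  have [x0|x0] := ger0P x; first by rewrite lerDl expR_ge0.
  by rewrite mulrN mulNr lerDr expR_ge0.
- apply: integrableD => //; exact: h.
Qed.

Lemma gauss_integrable f : exp_bounded f -> gauss.-integrable setT (EFin \o f).
Proof. exact/exp_bounded_integrable/gauss_exp_moments. Qed.

Lemma std_normal_density_le (c x : R) :
  @std_normal_density R x <= expR (c ^+ 2 / 2) * expR (- (c * `|x|)).
Proof.
rewrite /std_normal_density ler_pdivrMr ?sqrtr_gt0 ?mulr_gt0 ?pi_gt0//.
have s1 : 1 <= Num.sqrt (2 * pi) :> R.
  rewrite -[leLHS]sqrtr1 ler_wsqrtr//; have := @pi_ge2 R; lra.
rewrite -expRD -[leLHS]mulr1; apply: ler_pM; rewrite ?expR_ge0//.
rewrite ler_expR; have := sqr_ge0 (`|x| - c); rewrite sqrrB real_normK ?num_real//; lra.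
Qed.

Lemma is_derive_std_normal_density (x : R) :
  is_derive x (1 : R) (@std_normal_density R) (- x * @std_normal_density R x).
Proof.
have dx := is_derive_id x (1 : R).
have d1 : is_derive x (1 : R) (fun x : R => - (x ^+ 2) / 2) (- x).
  have -> : (fun x : R => - (x ^+ 2) / 2) = (fun x => (- 2^-1) * (x * x)).
    by apply/funext => y; rewrite expr2; field.
  apply: (is_derive_eq (is_deriveZ (- 2^-1) (is_deriveM dx dx))).
  by rewrite /GRing.scale/=; field.
have d2 := is_derive1_comp (is_derive_expR _) d1.
have -> : @std_normal_density R = (fun x => (Num.sqrt (2 * pi))^-1 *
    (expR \o (fun x : R => - (x ^+ 2) / 2)) x).
  by apply/funext => y; rewrite /std_normal_density mulrC.
apply: (is_derive_eq (is_deriveZ _ d2)).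
by rewrite /GRing.scale/=; ring.
Qed.

Lemma is_derive_horner_gauss q (x : R) :
  is_derive x (1 : R) (fun x => q.[x] * @std_normal_density R x)
    ((q^`() - 'X * q).[x] * @std_normal_density R x).
Proof.
apply: (is_derive_eq (is_deriveM (is_derive_poly q x) (is_derive_std_normal_density x))).
by rewrite hornerD hornerN hornerM hornerX /GRing.scale/=; ring.
Qed.

Lemma cvg_horner_gauss q (u : nat -> R) : (forall n, `|u n| = n.+1%:R) ->
  (q.[u n] * @std_normal_density R (u n)) @[n --> \oo] --> 0.
Proof.
move=> un; have [_ [A [c qA]]] := exp_bounded_horner q.
have h : forall n, `|q.[u n] * @std_normal_density R (u n)| <=
    A * expR ((c + 1) ^+ 2 / 2) * expR (- n.+1%:R).
  move=> n; rewrite normrM [X in _ * X <= _]ger0_norm; last exact/ltW/std_normal_density_gt0.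
  apply: (le_trans (ler_pM _ _ (qA _) (std_normal_density_le (c + 1) _))) => //.
    by rewrite ltW ?std_normal_density_gt0.
  rewrite mulrACA -expRD mulrDl mul1r opprD addrA subrr add0r un.
  exact: lexx.
apply/norm_cvg0P; apply: (@squeeze_cvgr _ _ _ _ (cst 0) (fun n => A * expR ((c + 1) ^+ 2 / 2) * expR (- n.+1%:R))).
- by apply: nearW => n; rewrite normr_ge0/= h.
- exact: cvg_cst.
- rewrite -[X in _ --> X](mulr0 (A * expR ((c + 1) ^+ 2 / 2))).
  apply: cvgMr; rewrite (cvg_shiftS (fun n => expR (- n%:R)))/=; exact: cvgn_expR.
Qed.

(** The integrand is the derivative of q times the Gaussian density. The fundamental theorem on
    growing symmetric intervals leaves boundary terms that tend to 0, and dominated convergence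
    gives the whole line. *)
Lemma integral_horner_gauss q :
  (\int[lam]_x ((q^`() - 'X * q).[x] * @std_normal_density R x)%:E = 0)%E.
Proof.
pose f x := (q^`() - 'X * q).[x] * @std_normal_density R x.
pose F x := q.[x] * @std_normal_density R x.
have fi : lam.-integrable setT (EFin \o f).
  apply/(@integrable_densityP _ RT R gauss lam (@std_normal_density R)) => //.
  - exact: measurable_std_normal_density.
  - by move=> x; rewrite ltW ?std_normal_density_gt0.
  - exact: gaussE.
  - by have [] := exp_bounded_horner (q^`() - 'X * q).
  - exact/gauss_integrable/exp_bounded_horner.
pose f_ (n : nat) := (EFin \o f) \_ `[- n.+1%:R, n.+1%:R].
have mf := measurable_int _ fi.
have [_ _ cv] : [/\ lam.-integrable setT (EFin \o f),
    (\int[lam]_x `|f_ n x - (EFin \o f) x|)%E @[n --> \oo] --> 0%E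
  & (\int[lam]_x f_ n x)%E @[n --> \oo] --> (\int[lam]_x (EFin \o f) x)%E].
  apply: (@dominated_convergence _ RT R lam setT _ f_ (EFin \o f) (abse \o (EFin \o f))) => //.
  - move=> n; apply/measurable_restrict => //.
    by apply: measurable_funS mf.
  - apply/aeW => x _; apply: cvg_near_cst; exists (Num.bound `|x|) => // n /= hn.
    rewrite /f_ patchE mem_set//= in_itv/= -ler_norml.
    apply: (le_trans (ltW (archi_boundP (normr_ge0 x)))).
    by rewrite ler_nat (leq_trans hn).
  - exact: integrable_abse.
  - apply/aeW => x n _; rewrite /f_ patchE; case: ifPn => // _.
    by rewrite abse0 abse_ge0.
have cont (g : R -> R) (dg : R -> R) (x : R) :
    (forall y : R, is_derive y (1 : R) g (dg y)) -> {for x, continuous g}.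
  move=> h; apply/differentiable_continuous/derivable1_diffP.
  by have [] := h x.
have cF x : {for x, continuous F} by apply: cont => y; exact: is_derive_horner_gauss.
have cf x : {for x, continuous f} by apply: cont => y; exact: is_derive_horner_gauss.
have e n : (\int[lam]_x f_ n x = (F n.+1%:R - F (- n.+1%:R))%:E)%E.
  rewrite /f_ -integral_mkcond EFinB; apply: continuous_FTC2.
  - by rewrite gtrN// ltr0n.
  - by apply: continuous_subspaceT => x; exact: cf.
  - split.
    + by move=> x _; have [] := is_derive_horner_gauss q x.
    + by apply: cvg_at_right_filter; exact: cF.
    + by apply: cvg_at_left_filter; exact: cF.
  - by move=> x _; rewrite derive1E; have [_ ->] := is_derive_horner_gauss q x.
have cv0 : (\int[lam]_x f_ n x)%E @[n --> \oo] --> 0%E.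
  under eq_fun do rewrite e.
  apply: cvg_EFin; first by apply: nearW.
  rewrite -[X in _ --> X](subrr 0); apply: cvgB.
    by apply: (@cvg_horner_gauss q (fun n => n.+1%:R)) => n; rewrite ger0_norm.
  by apply: (@cvg_horner_gauss q (fun n => - n.+1%:R)) => n; rewrite normrN ger0_norm.
by rewrite -[LHS](cvg_lim _ cv)// (cvg_lim _ cv0).
Qed.

Lemma gauss_by_parts q : \int[gauss]_x ('X * q).[x] = \int[gauss]_x q^`().[x].
Proof.
apply/esym/eqP; rewrite -subr_eq0 -RintegralB//.
  rewrite /Rintegral; under eq_integral do rewrite -hornerN -hornerD.
  rewrite (@integral_density _ RT R gauss lam (@std_normal_density R)).
  - by rewrite integral_horner_gauss.
  - exact: measurable_std_normal_density.
  - by move=> x; rewrite ltW ?std_normal_density_gt0.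
  - exact: gaussE.
  - exact/gauss_integrable/exp_bounded_horner.
- exact/gauss_integrable/exp_bounded_horner.
- exact/gauss_integrable/exp_bounded_horner.
Qed.

End ExpMoments.

(** * Hermite polynomials: addition formula and orthogonality *)

Section Hermite.
Context {R : realType}.
Implicit Types (s u x y : R) (q : {poly R}) (k : nat).

(** Carrying two consecutive polynomials makes the three-term recurrence structural. *)
Fixpoint hermite_pair s k : {poly R} * {poly R} :=
  if k is k'.+1 then
    let: (a, b) := hermite_pair s k' in (b, k'.+2%:R^-1 *: ('X * b - s *: a))
  else (1, 'X).

(* [hermite s k] is the Hermite polynomial of variance [s] divided by [k`!],
   with generating function [expR (t * x - s * t ^+ 2 / 2)]. *)
Definition hermite s k := (hermite_pair s k).1.

Lemma hermite0 s : hermite s 0 = 1. Proof. by []. Qed.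

Lemma hermite1 s : hermite s 1 = 'X. Proof. by []. Qed.

Lemma hermiteSS s k :
  k.+2%:R *: hermite s k.+2 = 'X * hermite s k.+1 - s *: hermite s k.
Proof.
rewrite /hermite /=; case: (hermite_pair s k) => a b /=.
by rewrite scalerA divff ?scale1r// pnatr_eq0.
Qed.

Lemma hermite_horner s k x :
  k.+2%:R * (hermite s k.+2).[x] = x * (hermite s k.+1).[x] - s * (hermite s k).[x].
Proof.
by have /(congr1 (fun q => q.[x])) := hermiteSS s k; rewrite !hornerE.
Qed.

Lemma nat2_ind (P : nat -> Prop) : P 0%N -> P 1%N ->
  (forall k, P k -> P k.+1 -> P k.+2) -> forall k, P k.
Proof.
move=> P0 P1 PS k; suff : P k /\ P k.+1 by case.
by elim: k => // k [Pk PSk]; split => //; exact: PS.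
Qed.

Lemma deriv_hermite s k : (hermite s k.+1)^`() = hermite s k.
Proof.
elim/nat2_ind: k => [| |k IH1 IH2]; first by rewrite hermite1 derivX.
  have d1 : (s *: (1 : {poly R}))^`() = 0 by rewrite derivZ -polyC1 derivC scaler0.
  have k0 : 2%:R != 0 :> R by rewrite pnatr_eq0.
  apply: (scalerI k0); rewrite -derivZ hermiteSS hermite0 hermite1.
  by rewrite derivB derivM derivX d1 mul1r mulr1 subr0 scaler_nat mulr2n.
have k0 : k.+3%:R != 0 :> R by rewrite pnatr_eq0.
apply: (scalerI k0); rewrite -derivZ hermiteSS derivB derivM derivX derivZ.
rewrite IH2 IH1 mul1r -addrA -hermiteSS.
by rewrite -[X in X + _]scale1r -scalerDl -mulrS.
Qed.

Definition convolution (a b : nat -> R) k := \sum_(i < k.+1) a i * b (k - i)%N.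

Lemma convolutionC a b k : convolution a b k = convolution b a k.
Proof.
rewrite /convolution (reindex_inj rev_ord_inj)/=; apply: eq_bigr => i _.
by rewrite subSS subKn; [exact: mulrC|rewrite -ltnS].
Qed.

(** The hypotheses say that the generating function A of [a] solves A' = (x - s t) A. The claim
    compares the coefficients of t^(k+2) in t A' B = t (x - s t) A B. *)
Lemma convolution_deriv x s (a b : nat -> R) k : a 1%N = x * a 0%N ->
  (forall k, k.+2%:R * a k.+2 = x * a k.+1 - s * a k) ->
  \sum_(i < k.+3) i%:R * (a i * b (k.+2 - i)%N) =
  x * convolution a b k.+1 - s * convolution a b k.
Proof.
move=> a1 aS; rewrite big_ord_recl mul0r add0r big_ord_recl/= /convolution.
rewrite [in RHS]big_ord_recl /= subSS !subn0 mulrDr a1 mul1r -mulrA -addrA.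
congr (_ + _); rewrite !mulr_sumr -sumrB; apply: eq_bigr => i _.
by rewrite /bump/= !add1n !subSS mulrA aS; ring.
Qed.

(** Both sides satisfy the recurrence with data x + y and s + u; for the convolution this is the
    product rule t (AB)' = (t A') B + A (t B'). *)
Lemma hermiteD s u x y k : (hermite (s + u) k).[x + y] =
  convolution (fun i => (hermite s i).[x]) (fun i => (hermite u i).[y]) k.
Proof.
set a := fun i => _; set b := fun i => (hermite u i).[y].
have a0 : a 0%N = 1 by rewrite /a hermite0 hornerC.
have b0 : b 0%N = 1 by rewrite /b hermite0 hornerC.
have a1 : a 1%N = x by rewrite /a hermite1 hornerX.
have b1 : b 1%N = y by rewrite /b hermite1 hornerX.
elim/nat2_ind: k => [| |k IH1 IH2].
- by rewrite hermite0 hornerC /convolution big_ord1 a0 b0 mulr1.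
- rewrite hermite1 hornerX /convolution big_ord_recl big_ord1/= /bump/= a0 b0 a1 b1.
  by rewrite mulr1 mul1r addrC.
have k0 : k.+2%:R != 0 :> R by rewrite pnatr_eq0.
apply: (mulfI k0); rewrite hermite_horner IH1 IH2.
have -> : k.+2%:R * convolution a b k.+2 =
   \sum_(i < k.+3) i%:R * (a i * b (k.+2 - i)%N) +
   \sum_(i < k.+3) i%:R * (b i * a (k.+2 - i)%N).
  rewrite [X in _ + X](reindex_inj rev_ord_inj)/= -big_split/= mulr_sumr.
  apply: eq_bigr => i _; have ik : (i <= k.+2)%N by rewrite -ltnS.
  rewrite subSS subKn// [b _ * _]mulrC -mulrDl -natrD; congr (_%:R * _).
  by rewrite subnKC.
rewrite (@convolution_deriv x s) ?a1 ?a0 ?mulr1//; last first.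
  by move=> j; exact: hermite_horner.
rewrite (@convolution_deriv y u) ?b1 ?b0 ?mulr1//; last first.
  by move=> j; exact: hermite_horner.
by rewrite ![convolution b a _]convolutionC; ring.
Qed.

(** Used with r = -1 for parity, with r^2 = 1/n to normalise the sum, and with r = 0 for the empty
    sum. *)
Lemma hermite_scale s r k x :
  (hermite (r ^+ 2 * s) k).[r * x] = r ^+ k * (hermite s k).[x].
Proof.
elim/nat2_ind: k => [| |k IH1 IH2].
- by rewrite !hermite0 !hornerC mulr1.
- by rewrite !hermite1 !hornerX expr1.
have k0 : k.+2%:R != 0 :> R by rewrite pnatr_eq0.
apply: (mulfI k0); rewrite hermite_horner IH1 IH2 [RHS]mulrCA hermite_horner !exprS.
by move: (r ^+ k) => z; ring.
Qed.

Lemma hermiteN s k x : (hermite s k).[- x] = (-1) ^+ k * (hermite s k).[x].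
Proof. by rewrite -hermite_scale sqrrN expr1n mul1r mulN1r. Qed.

(** The span of the Hermite polynomials contains 1 and is stable under multiplication by X, because
    the recurrence expresses X times one of them through its neighbours. *)
Lemma hermite_basis q : exists N (b : nat -> R), q = \sum_(k < N) b k *: hermite 1 k.
Proof.
pose span q := exists N (b : nat -> R), q = \sum_(k < N) b k *: hermite 1 k.
have span0 : span 0 by exists 0%N, (fun=> 0); rewrite big_ord0.
have spanZD a p q' : span p -> span q' -> span (a *: p + q').
  move=> [N [b ->]] [M [c ->]]; exists (N + M)%N.
  exists (fun k => a * (if (k < N)%N then b k else 0) + (if (k < M)%N then c k else 0)).
  under [RHS]eq_bigr do rewrite scalerDl; rewrite big_split/=; congr (_ + _).
    rewrite scaler_sumr big_split_ord/= [X in _ = _ + X]big1 ?addr0.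
      by apply: eq_bigr => i _; rewrite ltn_ord scalerA.
    by move=> i _; rewrite ltnNge leq_addr/= mulr0 scale0r.
  rewrite addnC big_split_ord/= [X in _ = _ + X]big1 ?addr0.
    by apply: eq_bigr => i _; rewrite ltn_ord.
  by move=> i _; rewrite ltnNge leq_addr/= scale0r.
have spanH k : span (hermite 1 k).
  exists k.+1, (fun i => (i == k)%:R); rewrite big_ord_recr/= eqxx scale1r.
  by rewrite big1 ?add0r// => i _; rewrite ltn_eqF ?ltn_ord// scale0r.
have spanX k : span ('X * hermite 1 k).
  case: k => [|k]; first by rewrite mulr1; exact: (spanH 1%N).
  have -> : 'X * hermite 1 k.+1 = k.+2%:R *: hermite 1 k.+2 + hermite 1 k.
    by rewrite hermiteSS scale1r subrK.
  exact: (spanZD _ _ _).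
elim/poly_ind: q => [//|q a [N [b qE]]].
have -> : q * 'X + a%:P = 1 *: ('X * q) + (a *: hermite 1 0 + 0).
  by rewrite addr0 scale1r mulrC hermite0 alg_polyC.
apply: (spanZD _ _ _); last exact: (spanZD _ _ _).
rewrite qE mulr_sumr; elim: N {qE} => [|N IH]; first by rewrite big_ord0.
rewrite big_ord_recr/= addrC -scalerAr; exact: (spanZD _ _ _).
Qed.

Local Notation RT := (measurableTypeR R).
Local Notation gauss := (normal_prob (0 : R) 1 : probability RT R).

Lemma gauss_horner_integrable q : gauss.-integrable setT (EFin \o (fun x => q.[x])).
Proof. exact/gauss_integrable/exp_bounded_horner. Qed.

Lemma RintegralD_horner (nu : {measure set RT -> \bar R}) p q : exp_moments nu ->
  \int[nu]_x (p + q).[x] = \int[nu]_x p.[x] + \int[nu]_x q.[x].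
Proof.
move=> hnu; rewrite -RintegralD//; try by apply: exp_bounded_integrable => //; exact: exp_bounded_horner.
by apply: eq_Rintegral => x _; rewrite hornerD.
Qed.

Lemma RintegralZ_horner (nu : {measure set RT -> \bar R}) a q : exp_moments nu ->
  \int[nu]_x (a *: q).[x] = a * \int[nu]_x q.[x].
Proof.
move=> hnu; rewrite -RintegralZl//; last by apply: exp_bounded_integrable => //; exact: exp_bounded_horner.
by apply: eq_Rintegral => x _; rewrite hornerZ.
Qed.

Lemma Rintegral_sum_horner (nu : {measure set RT -> \bar R}) N (p : nat -> {poly R}) :
  exp_moments nu ->
  \int[nu]_x (\sum_(k < N) p k).[x] = \sum_(k < N) \int[nu]_x (p k).[x].
Proof.
move=> hnu; elim: N => [|N IH].
  rewrite !big_ord0 -(scale0r (0 : {poly R})) RintegralZ_horner//.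
  by rewrite mul0r.
by rewrite !big_ord_recr/= RintegralD_horner// IH.
Qed.

(** The raising identity writes (k+1) times the next polynomial as X H - H' with H the current one.
    Integrating X H q by parts produces H' q + H q', and the H' q terms cancel. *)
Lemma hermite_ortho_step k q :
  k.+1%:R * \int[gauss]_x (hermite 1 k.+1 * q).[x] = \int[gauss]_x (hermite 1 k * q^`()).[x].
Proof.
have gm := @gauss_exp_moments R.
have e : k.+1%:R *: hermite 1 k.+1 = 'X * hermite 1 k - (hermite 1 k)^`().
  case: k => [|k]; first by rewrite hermite0 hermite1 mulr1 derivC subr0 scale1r.
  by rewrite hermiteSS deriv_hermite scale1r.
rewrite -RintegralZ_horner// scalerAl e mulrBl -mulrA -scaleN1r RintegralD_horner//.
rewrite RintegralZ_horner// gauss_by_parts derivM RintegralD_horner//.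
by rewrite mulN1r addrC addKr.
Qed.

Lemma hermite_ortho j k :
  \int[gauss]_x (hermite 1 j * hermite 1 k).[x] = (j == k)%:R / k`!%:R.
Proof.
have h0 i : \int[gauss]_x (hermite 1 i.+1 * 1).[x] = 0.
  have i0 : i.+1%:R != 0 :> R by rewrite pnatr_eq0.
  apply: (mulfI i0); rewrite hermite_ortho_step derivC !mulr0.
  by rewrite -(scale0r (0 : {poly R})) RintegralZ_horner ?mul0r//; exact: gauss_exp_moments.
elim: j k => [|j IH] [|k].
- rewrite !hermite0 mulr1 fact0 divr1.
  under eq_Rintegral do rewrite hornerC.
  by rewrite Rintegral_cst//= (@probability_setT _ _ _ gauss) mulr1.
- by rewrite mulrC hermite0 h0 mul0r.
- by rewrite hermite0 h0 mul0r.
have j0 : j.+1%:R != 0 :> R by rewrite pnatr_eq0.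
apply: (mulfI j0); rewrite hermite_ortho_step deriv_hermite IH eqSS factS natrM.
have [->|_] := eqVneq j k; last by rewrite !mul0r mulr0.
by rewrite !mul1r invfM mulrA divff ?mul1r// pnatr_eq0.
Qed.

End Hermite.

(** * Hermite moments: the dual functional and Bessel's inequality *)

Section HermiteMoments.
Context {R : realType}.
Local Notation RT := (measurableTypeR R).
Local Notation gauss := (normal_prob (0 : R) 1 : probability RT R).
Implicit Types (mu : {measure set RT -> \bar R}) (q : {poly R}) (N k : nat).

Definition hermite_moment mu k : R := \int[mu]_x (hermite 1 k).[x].

Lemma integral_hermite_sum mu N (b : nat -> R) : exp_moments mu ->
  \int[mu]_x (\sum_(k < N) b k *: hermite 1 k).[x] =
  \sum_(k < N) b k * hermite_moment mu k.
Proof.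
move=> hmu; rewrite (Rintegral_sum_horner _ (fun k => b k *: hermite 1 k))//.
by apply: eq_bigr => k _; rewrite RintegralZ_horner.
Qed.

Lemma gauss_hermite_sum_sqr N (b : nat -> R) :
  \int[gauss]_x ((\sum_(k < N) b k *: hermite 1 k) * (\sum_(k < N) b k *: hermite 1 k)).[x] =
  \sum_(k < N) b k ^+ 2 / k`!%:R.
Proof.
have gm := @gauss_exp_moments R.
set Q := \sum_(k < N) _.
have -> : Q * Q = \sum_(k < N) b k *: (hermite 1 k * Q).
  by rewrite {1}/Q mulr_suml; apply: eq_bigr => k _; rewrite scalerAl.
rewrite (Rintegral_sum_horner _ (fun k => b k *: (hermite 1 k * Q)))//.
apply: eq_bigr => k _; rewrite RintegralZ_horner// expr2 -mulrA; congr (_ * _).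
have -> : hermite 1 k * Q = \sum_(j < N) b j *: (hermite 1 k * hermite 1 j).
  by rewrite /Q mulr_sumr; apply: eq_bigr => j _; rewrite scalerAr.
rewrite (Rintegral_sum_horner _ (fun j => b j *: (hermite 1 k * hermite 1 j)))//.
rewrite (bigD1 k)//= RintegralZ_horner// hermite_ortho eqxx mul1r big1 ?addr0//.
move=> j jk; rewrite RintegralZ_horner// hermite_ortho.
have /negbTE -> : (k != j :> nat) by rewrite eq_sym.
by rewrite mul0r mulr0.
Qed.

(** Expand [q] in the Hermite basis and apply Cauchy-Schwarz to the weights k! and 1/k!. The sum
    starts at order 0, so [K] includes the moment 1 of the constant. *)
Lemma hermite_moment_functional mu K : exp_moments mu ->
  (forall N, \sum_(k < N) k`!%:R * hermite_moment mu k ^+ 2 <= K) ->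
  forall q, (\int[mu]_x q.[x]) ^+ 2 <= K * \int[gauss]_x (q * q).[x].
Proof.
move=> hmu hK q; have [N [b ->]] := hermite_basis q.
rewrite integral_hermite_sum// gauss_hermite_sum_sqr.
have s0 : 0 <= \sum_(k < N) b k ^+ 2 / k`!%:R.
  by apply: sumr_ge0 => k _; rewrite divr_ge0 ?sqr_ge0.
apply: le_trans (ler_wpM2r s0 (hK N)).
apply: cauchy_schwarz_sum => k _.
- by rewrite mulr_ge0 ?sqr_ge0.
- by rewrite divr_ge0 ?sqr_ge0.
have k0 : k`!%:R != 0 :> R by rewrite pnatr_eq0 -lt0n fact_gt0.
by rewrite le_eqVlt; apply/orP; left; apply/eqP; field.
Qed.

Section Density.
Variables (mu : probability RT R) (f : R -> R).
Hypotheses (mf : measurable_fun setT f) (f0 : forall x, 0 <= f x).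
Hypothesis muE : forall A : set RT, measurable A -> mu A = (\int[gauss]_(x in A) (f x)%:E)%E.
Let V : \bar R := (\int[gauss]_x ((f x - 1) ^+ 2)%:E)%E.
Hypothesis Vy : (V < +oo)%E.

Let mf1 : measurable_fun setT (fun x => (f x - 1) ^+ 2).
Proof. by apply: measurable_funX; exact: measurable_funB. Qed.

Let V_integrable : gauss.-integrable setT (EFin \o (fun x => (f x - 1) ^+ 2)).
Proof.
apply/integrableP; split; first exact/measurable_EFinP.
by under eq_integral do rewrite /= ger0_norm ?sqr_ge0//.
Qed.

(** A finite [V] puts the density [f] in L^2 of the Gaussian, and the product of [f] with an
    exponential is bounded by the squared exponential plus (f - 1)^2 + 1. *)
Lemma density_exp_moments : exp_moments mu.
Proof.
move=> c; have mexp (a : R) : measurable_fun setT (fun x : R => expR (a * `|x|)).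
  by apply: measurableT_comp => //; apply: measurable_funM => //; exact: measurableT_comp.
apply/(@integrable_densityP _ RT R mu gauss f) => //; first exact: mexp.
apply: (@le_integrable _ RT R gauss setT _ _ (fun x =>
  ((expR (2 * c * `|x|))%:E + (((f x - 1) ^+ 2)%:E + 1%:E))%E)) => //.
- by apply/measurable_EFinP; apply: measurable_funM => //; exact: mexp.
- move=> x _ /=; rewrite lee_fin ger0_norm ?mulr_ge0 ?expR_ge0//.
  apply: le_trans (ler_norm _).
  have -> : expR (2 * c * `|x|) = expR (c * `|x|) ^+ 2.
    by rewrite -expRM_natl mulrA.
  have := sqr_ge0 (2 * expR (c * `|x|) - f x); have := sqr_ge0 (f x - 2); nra.
- apply: integrableD => //; first exact: gauss_exp_moments.
  apply: integrableD => //; exact: finite_measure_integrable_cst.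
Qed.

(** With [Q] the projection of f - 1 on finitely many Hermite polynomials, the pointwise bound (f -
    1)^2 >= 2 (f - 1) Q - Q^2 is integrated; the integral of Q f and that of Q^2 both equal the
    partial sum. The coefficient of order 0 is set to 0 because f - 1 has mean 0. *)
Lemma hermite_moment_bessel N :
  ((\sum_(1 <= k < N) k`!%:R * hermite_moment mu k ^+ 2)%:E <= V)%E.
Proof.
have hmu := density_exp_moments.
pose b k : R := if k == 0%N then 0 else k`!%:R * hermite_moment mu k.
pose Q := \sum_(k < N) b k *: hermite 1 k.
set S := \sum_(1 <= k < N) _.
have f_neq0 k : k`!%:R != 0 :> R by rewrite pnatr_eq0 -lt0n fact_gt0.
have sumE (F : nat -> R) : F 0%N = 0 -> \sum_(k < N) F k = \sum_(1 <= k < N) F k.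
  move=> F0; rewrite -(big_mkord xpredT F); case: (N) => [|n]; first by rewrite !big_geq.
  by rewrite big_nat_recl//= F0 add0r big_add1.
have S1 : \int[mu]_x Q.[x] = S.
  rewrite integral_hermite_sum// (sumE (fun k => b k * hermite_moment mu k)) ?mul0r//.
  rewrite big_nat_cond [RHS]big_nat_cond; apply: eq_bigr => k /andP[/andP[k0 _] _].
  by rewrite /b eqn0Ngt k0/= expr2 mulrA.
have S2 : \int[gauss]_x (Q * Q).[x] = S.
  rewrite gauss_hermite_sum_sqr (sumE (fun k => b k ^+ 2 / k`!%:R)) ?expr0n ?mul0r//.
  rewrite big_nat_cond [RHS]big_nat_cond; apply: eq_bigr => k /andP[/andP[k0 _] _].
  by rewrite /b eqn0Ngt k0/=; field.
have S3 : \int[gauss]_x Q.[x] = 0.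
  rewrite integral_hermite_sum; last exact: gauss_exp_moments.
  rewrite big1// => k _; rewrite /b /hermite_moment; case: eqP => [->|/eqP k0]; rewrite ?mul0r//.
  have := @hermite_ortho R k 0; rewrite (negbTE k0) mul0r => h.
  rewrite -[X in _ * X = _]/(\int[gauss]_x (hermite 1 k).[x]) -[hermite 1 k in X in _ * X]mulr1.
  by rewrite h mulr0.
have mQ : measurable_fun setT (horner Q) by exact: measurable_poly.
have iQf : gauss.-integrable setT (EFin \o (fun x => Q.[x] * f x)).
  apply/(@integrable_densityP _ RT R mu gauss f) => //.
  exact: (exp_bounded_integrable hmu (exp_bounded_horner Q)).
have S4 : \int[gauss]_x (Q.[x] * f x) = S.
  rewrite -S1 /Rintegral (@integral_density _ RT R mu gauss f)//.
  exact: (exp_bounded_integrable hmu (exp_bounded_horner Q)).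
have iQ := gauss_horner_integrable Q.
have iQQ := gauss_horner_integrable (Q * Q).
have i1 : gauss.-integrable setT (EFin \o (fun x => 2 * (Q.[x] * f x) )).
  exact: (integrableZl _ 2 iQf).
have i2 : gauss.-integrable setT (EFin \o (fun x => 2 * Q.[x])).
  exact: (integrableZl _ 2 iQ).
pose g x := 2 * (Q.[x] * f x) - 2 * Q.[x] - (Q * Q).[x].
have i3 : gauss.-integrable setT (EFin \o (fun x => 2 * (Q.[x] * f x) - 2 * Q.[x])).
  exact: (integrableB _ i1 i2).
have ig : gauss.-integrable setT (EFin \o g).
  exact: (integrableB _ i3 iQQ).
have Sg : \int[gauss]_x g x = S.
  rewrite RintegralB// RintegralB// !RintegralZl// S4 S3 S2; ring.
rewrite -Sg /Rintegral fineK; last exact: integrable_fin_num.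
apply: le_integral => // x _; rewrite /= lee_fin /g hornerM.
by have := sqr_ge0 (f x - 1 - Q.[x]); nra.
Qed.

End Density.
End HermiteMoments.

(** * Density of polynomials and existence of the density *)

Section PolynomialDensity.
Context {R : realType}.
Local Notation RT := (measurableTypeR R).
Implicit Types (f g : R -> R) (q : {poly R}).

Lemma cvg_norm_le (u : nat -> R) (l M : R) :
  u n @[n --> \oo] --> l -> (forall n, `|u n| <= M) -> `|l| <= M.
Proof.
move=> ul uM; have nl : `|u n| @[n --> \oo] --> `|l| by exact: cvg_norm.
rewrite -(cvg_lim _ nl)//; apply: limr_le; last exact: nearW.
by apply/cvg_ex; exists `|l|.
Qed.

Lemma exp_bounded_lim (g_ : nat -> R -> R) g (A c : R) :
  (forall n, measurable_fun setT (g_ n)) ->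
  (forall x, g_ n x @[n --> \oo] --> g x) ->
  (forall n x, `|g_ n x| <= A * expR (c * `|x|)) -> exp_bounded g.
Proof.
move=> mg gg gA; split; first exact: (measurable_fun_cvg mg).
by exists A, c => x; apply: cvg_norm_le (gg x) _ => n.
Qed.

Variable nu : {measure set RT -> \bar R}.
Hypothesis hnu : exp_moments nu.

Definition poly_approx g := exp_bounded g /\
  forall e : R, 0 < e -> exists q, \int[nu]_x (g x - q.[x]) ^+ 2 <= e.

Let eb_integrable f : exp_bounded f -> nu.-integrable setT (EFin \o f).
Proof. exact: exp_bounded_integrable. Qed.

Lemma exp_boundedZ (a : R) f : exp_bounded f -> exp_bounded (fun x => a * f x).
Proof. by move=> hf; apply: exp_boundedM => //; exact: exp_bounded_cst. Qed.

Lemma exp_boundedB f g : exp_bounded f -> exp_bounded g ->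
  exp_bounded (fun x => f x - g x).
Proof.
move=> hf hg; under eq_fun do rewrite -mulN1r.
by apply: exp_boundedD => //; exact: exp_boundedZ.
Qed.

Lemma Rintegral_sqrD_le f g h : exp_bounded f -> exp_bounded g -> exp_bounded h ->
  (forall x, h x = f x + g x) ->
  \int[nu]_x (h x) ^+ 2 <= 2 * \int[nu]_x (f x) ^+ 2 + 2 * \int[nu]_x (g x) ^+ 2.
Proof.
move=> hf hg hh hE; have [sf sg] := (exp_bounded_sqr hf, exp_bounded_sqr hg).
rewrite -!RintegralZl//; try exact: eb_integrable.
rewrite -RintegralD//; try by apply: eb_integrable; exact: exp_boundedZ.
apply: le_Rintegral => //.
- exact/eb_integrable/exp_bounded_sqr.
- by apply: eb_integrable; apply: exp_boundedD; exact: exp_boundedZ.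
by move=> x _; rewrite hE; have := sqr_ge0 (f x - g x); nra.
Qed.

Lemma poly_approx_horner q : poly_approx (fun x => q.[x]).
Proof.
split; first exact: exp_bounded_horner.
move=> e e0; exists q; under eq_Rintegral do rewrite subrr expr0n.
by rewrite Rintegral_cst// mul0r ltW.
Qed.

Lemma poly_approxD f g : poly_approx f -> poly_approx g ->
  poly_approx (fun x => f x + g x).
Proof.
move=> [hf fa] [hg ga]; split; first exact: exp_boundedD.
move=> e e0; have e4 : 0 < e / 4 by lra.
have [p hp] := fa _ e4; have [q hq] := ga _ e4; exists (p + q).
have bf := exp_boundedB hf (exp_bounded_horner p).
have bg := exp_boundedB hg (exp_bounded_horner q).
apply: (le_trans (Rintegral_sqrD_le bf bg _ _)); last lra.
- by apply: exp_boundedB; [exact: exp_boundedD|exact: exp_bounded_horner].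
- by move=> x; rewrite hornerD; ring.
Qed.

Lemma poly_approxZ (a : R) f : poly_approx f -> poly_approx (fun x => a * f x).
Proof.
move=> [hf fa]; split; first exact: exp_boundedZ.
move=> e e0; have a0 : 0 < a ^+ 2 + 1 by have := sqr_ge0 a; lra.
have [p hp] := fa _ (divr_gt0 e0 a0); exists (a *: p).
have bf := exp_bounded_sqr (exp_boundedB hf (exp_bounded_horner p)).
under eq_Rintegral do rewrite hornerZ -mulrBr exprMn.
rewrite RintegralZl//; last exact: eb_integrable.
apply: (le_trans (ler_wpM2l (sqr_ge0 a) hp)).
rewrite mulrCA; apply: ler_piMr; first exact: ltW.
by rewrite ler_pdivrMr//; lra.
Qed.

Lemma cvg_Rintegral_sqr (g_ : nat -> R -> R) g (A c : R) :
  (forall n, measurable_fun setT (g_ n)) -> 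
  (forall x, g_ n x @[n --> \oo] --> g x) ->
  (forall n x, `|g_ n x| <= A * expR (c * `|x|)) ->
  \int[nu]_x (g x - g_ n x) ^+ 2 @[n --> \oo] --> 0.
Proof.
move=> mg gg gA; have [mg' _] := exp_bounded_lim mg gg gA.
have gA' x : `|g x| <= A * expR (c * `|x|) by apply: cvg_norm_le (gg x) _ => n.
pose f_ n x := ((g x - g_ n x) ^+ 2)%:E.
have [_ _ cv] : [/\ nu.-integrable setT (cst 0%E),
    (\int[nu]_x `|f_ n x - cst 0 x|)%E @[n --> \oo] --> 0%E
  & (\int[nu]_x f_ n x)%E @[n --> \oo] --> (\int[nu]_x cst 0 x)%E].
  apply: (@dominated_convergence _ RT R nu setT _ f_ (cst 0%E)
     (fun x => ((4 * A ^+ 2) * expR (2 * c * `|x|))%:E)) => //.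
  - by move=> n; apply/measurable_EFinP; apply: measurable_funX; apply: measurable_funB => //; exact: mg.
  - apply/aeW => x _; apply: cvg_EFin; first exact: nearW.
    rewrite /= -[X in _ --> X](expr0n R 2) -[X in X ^+ 2](subrr (g x)).
    by apply: cvgM; (apply: cvgB; [exact: cvg_cst|exact: gg]).
  - exact: (integrableZl _ _ (hnu (2 * c))).
  - apply/aeW => x n _ /=; rewrite lee_fin ger0_norm ?sqr_ge0//.
    rewrite -real_normK ?num_real//.
    have -> : 4 * A ^+ 2 * expR (2 * c * `|x|) = (2 * (A * expR (c * `|x|))) ^+ 2.
      rewrite (_ : expR (2 * c * `|x|) = expR (c * `|x|) ^+ 2); first by ring.
      by rewrite -expRM_natl mulrA.
    rewrite ler_pXn2r ?nnegrE//.
      apply: (le_trans (ler_normB _ _)); have := gA n x; have := gA' x; lra.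
    by have := normr_ge0 (g x); have := gA' x; lra.
move: cv; rewrite integral0 => cv.
rewrite (_ : (fun n => _) = fine \o (fun n => (\int[nu]_x f_ n x)%E))//.
exact: fine_cvg.
Qed.

(** A common exponential majorant makes dominated convergence hold in L^2. Indicators are reached
    from polynomials by iterating this closure. *)
Lemma poly_approx_lim (g_ : nat -> R -> R) g (A c : R) :
  (forall n, poly_approx (g_ n)) -> (forall x, g_ n x @[n --> \oo] --> g x) ->
  (forall n x, `|g_ n x| <= A * expR (c * `|x|)) -> poly_approx g.
Proof.
move=> pg gg gA; have mg n : measurable_fun setT (g_ n) by have [[]] := pg n.
have hg := exp_bounded_lim mg gg gA; split => // e e0.
have e4 : 0 < e / 4 by lra.
have /cvgrPdist_le /(_ _ e4)[N _ /(_ N (leqnn N))] := cvg_Rintegral_sqr mg gg gA.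
rewrite /= sub0r normrN => hN.
have [hgN /(_ _ e4)[q hq]] := pg N; exists q.
have bf := exp_boundedB hg hgN.
have bg := exp_boundedB hgN (exp_bounded_horner q).
apply: (le_trans (Rintegral_sqrD_le bf bg _ _)).
- by apply: exp_boundedB => //; exact: exp_bounded_horner.
- by move=> x; ring.
by have := le_trans (ler_norm _) hN; lra.
Qed.

(** Stronger than [poly_approx]: pointwise polynomial limits under one exponential bound are stable
    under products, whereas L^2 approximation alone does not pass to products. *)
Definition exp_limit g := exists q : nat -> {poly R},
  (forall x, (q n).[x] @[n --> \oo] --> g x) /\
  exists A c : R, forall n x, `|(q n).[x]| <= A * expR (c * `|x|).

Lemma exp_limit_approx g : exp_limit g -> poly_approx g.
Proof.
move=> [q [qg [A [c qA]]]].
by apply: (poly_approx_lim (fun n => poly_approx_horner (q n)) qg qA).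
Qed.

Lemma exp_limit_cst (a : R) : exp_limit (cst a).
Proof.
exists (fun=> a%:P); split => [x|].
  by under eq_fun do rewrite hornerC; exact: cvg_cst.
by exists `|a|, 0 => n x; rewrite hornerC mul0r expR0 mulr1.
Qed.

Lemma exp_limitD f g : exp_limit f -> exp_limit g -> exp_limit (fun x => f x + g x).
Proof.
move=> [p [pf [A [c pA]]]] [q [qg [B [d qB]]]].
exists (fun n => p n + q n); split => [x|].
  by under eq_fun do rewrite hornerD; apply: cvgD.
exists (`|A| + `|B|), (Num.max c d) => n x; rewrite hornerD.
have h a b (m : R) : b <= m -> a * expR (b * `|x|) <= `|a| * expR (m * `|x|).
  move=> bm; apply: (@le_trans _ _ (`|a| * expR (b * `|x|))).
    by rewrite ler_wpM2r ?expR_ge0 ?ler_norm.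
  by rewrite ler_wpM2l// expR_norm_le_max.
apply: (le_trans (ler_normD _ _)).
by rewrite mulrDl lerD// ?(le_trans (pA n x))// ?(le_trans (qB n x))// h// le_max lexx ?orbT.
Qed.

Lemma exp_limitM f g : exp_limit f -> exp_limit g -> exp_limit (fun x => f x * g x).
Proof.
move=> [p [pf [A [c pA]]]] [q [qg [B [d qB]]]].
exists (fun n => p n * q n); split => [x|].
  by under eq_fun do rewrite hornerM; apply: cvgM.
exists (A * B), (c + d) => n x; rewrite hornerM normrM.
by rewrite mulrDl expRD mulrACA ler_pM.
Qed.

Lemma exp_limitX f n : exp_limit f -> exp_limit (fun x => f x ^+ n).
Proof.
move=> hf; elim: n => [|n IH].
  by under eq_fun do rewrite expr0; exact: exp_limit_cst.
by under eq_fun do rewrite exprS; exact: exp_limitM.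
Qed.

(** Every Taylor polynomial of sin at y is at most exp(|y|) in absolute value, and |tx + b| <=
    |t||x| + |b|. *)
Lemma exp_limit_sin (t b : R) : exp_limit (fun x => sin (t * x + b)).
Proof.
pose P n : {poly R} := \poly_(i < n) ((odd i)%:R * (-1) ^+ i.-1./2 / i`!%:R).
have PE n (y : R) : (P n).[y] = series (sin_coeff y) n.
  rewrite horner_poly /series/= big_mkord; apply: eq_bigr => i _.
  by rewrite /sin_coeff/= mulrAC.
exists (fun n => P n \Po (t *: 'X + b%:P)); split => [x|].
  under eq_fun do rewrite horner_comp !hornerE PE.
  by rewrite unlock; exact: is_cvg_series_sin_coeff.
exists (expR `|b|), `|t| => n x; rewrite horner_comp !hornerE.
apply: (@le_trans _ _ (expR `|t * x + b|)); last first.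
  by rewrite -expRD ler_expR addrC -normrM ler_normD.
have a11 : 1 / 2 <= (1 : R) <= 1 by lra.
have := sum_cosh_weight_le n a11 (normr_ge0 (t * x + b)).
rewrite /cosh_mean subrr mul0r addr0 mul1r; apply: le_trans.
rewrite horner_poly; apply: (le_trans (ler_norm_sum _ _ _)); apply: ler_sum => i _.
rewrite /cosh_weight subrr mul0r addr0 mul1r !normrM normrX normrV ?unitfE; last first.
  by rewrite pnatr_eq0 -lt0n fact_gt0.
rewrite !normrX normrN1 expr1n mulr1 [`|i`!%:R|]ger0_norm// [`|(odd i)%:R|]ger0_norm//.
rewrite [leRHS]mulrC -mulrA ler_piMl//; last by case: (odd i).
Qed.

(* The powers [(1 - v ^ n) ^ (2 ^ n)] separate [v < 1 / 2] from [v > 1 / 2];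
   at the threshold they converge to some number which is never computed. *)
Definition step_seq (y : R) (n : nat) : R := (1 - ((1 - y) / 2) ^+ n) ^+ (2 ^ n).

Lemma step_seq_itv y n : -1 <= y <= 1 -> 0 <= step_seq y n <= 1.
Proof.
move=> /andP[y1 y2]; have v0 : 0 <= (1 - y) / 2 by lra.
have v1 : (1 - y) / 2 <= 1 by lra.
have h0 := exprn_ge0 n v0; have h1 := exprn_ile1 n v0 v1.
by rewrite exprn_ge0 ?exprn_ile1//; lra.
Qed.

Lemma one_minus_pow_ge (x : R) n : 0 <= x <= 1 -> 1 - n%:R * x <= (1 - x) ^+ n.
Proof.
move=> /andP[x0 x1]; elim: n => [|n IH]; first by rewrite mul0r subr0.
rewrite exprS; apply: (@le_trans _ _ ((1 - x) * (1 - n%:R * x))); last first.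
  by rewrite ler_wpM2l// subr_ge0.
rewrite -natr1 -subr_ge0 (_ : _ - _ = n%:R * x ^+ 2); last by ring.
by rewrite mulr_ge0// sqr_ge0.
Qed.

Lemma cvg_step_seq_pos y : 0 < y <= 1 -> step_seq y n @[n --> \oo] --> (1 : R).
Proof.
move=> /andP[y0 y1]; have y11 : -1 <= y <= 1 by lra.
apply: (@squeeze_cvgr _ _ _ _ (fun n => 1 - (1 - y) ^+ n) (cst 1)).
- apply: nearW => n; have /andP[_ s1] := step_seq_itv n y11.
  rewrite s1 andbT; have v0 : 0 <= (1 - y) / 2 by lra.
  have v1 : (1 - y) / 2 <= 1 by lra.
  (* With v = (1 - y)/2, Bernoulli's inequality loses 2^n v^n = (1 - y)^n, which tends to 0 for 0 <
     y <= 1. *)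
  apply: le_trans (one_minus_pow_ge (2 ^ n) _); last by rewrite exprn_ge0 ?exprn_ile1.
  by rewrite natrX -exprMn mulrC divfK.
- rewrite -[X in _ --> X]subr0; apply: cvgB; first exact: cvg_cst.
  apply: cvg_expr; rewrite ger0_norm; lra.
- exact: cvg_cst.
Qed.

(** With z = ((1 - y)/2)^n and M = 2^n, the sequence is (1 - z)^M. Since (1 - z)^M (1 + z)^M <= 1
    and (1 + z)^M >= M z = (1 - y)^n, it is at most (1 - y)^(-n). *)
Lemma cvg_step_seq_neg y : -1 <= y < 0 -> step_seq y n @[n --> \oo] --> (0 : R).
Proof.
move=> /andP[y0 y1]; have y11 : -1 <= y <= 1 by lra.
have v0 : 0 < (1 - y) / 2 by lra.
have v1 : (1 - y) / 2 <= 1 by lra.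
apply: (@squeeze_cvgr _ _ _ _ (cst 0) (fun n => ((1 - y)^-1) ^+ n)).
- apply: nearW => n; have /andP[-> _]/= := step_seq_itv n y11.
  rewrite exprVn -[leRHS]mul1r ler_pdivlMr; last by rewrite exprn_gt0; lra.
  have vn0 := exprn_ge0 n (ltW v0); have vn1 := exprn_ile1 n (ltW v0) v1.
  apply: (@le_trans _ _ (step_seq y n * (1 + ((1 - y) / 2) ^+ n) ^+ (2 ^ n))).
    have /andP[s0 _] := step_seq_itv n y11; apply: ler_wpM2l => //.
    have -> : (1 - y) ^+ n = (2 ^ n)%:R * ((1 - y) / 2) ^+ n.
      by rewrite natrX -exprMn mulrC divfK.
    move: (((1 - y) / 2) ^+ n) vn0 {vn1} => z z0; move: (2 ^ n)%N => m.
    elim: m => [|m IH]; first by rewrite mul0r expr0.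
    rewrite exprS -natr1; apply: (@le_trans _ _ (1 * ((1 + z) ^+ m) + z * 1)); first by lra.
    have : 1 <= (1 + z) ^+ m by rewrite exprn_ege1// lerDl.
    nra.
  rewrite /step_seq -exprMn; apply: exprn_ile1; nra.
- exact: cvg_cst.
- apply: cvg_expr; rewrite ger0_norm ?invr_ge0; last lra.
  by rewrite invf_lt1; lra.
Qed.

(** The sequence increases because (1 - z/2)^2 >= 1 - z with z = 2^(-n), and it is bounded by 1. *)
Lemma is_cvg_step_seq0 : cvgn (step_seq 0).
Proof.
apply: nondecreasing_is_cvgn; last first.
  have y11 : -1 <= (0 : R) <= 1 by lra.
  by exists 1 => _ [n _ <-]; have /andP[_ ->] := step_seq_itv n y11.
apply/nondecreasing_seqP => n; rewrite /step_seq subr0 expnS exprM.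
apply: lerXn2r; rewrite ?nnegrE ?sqr_ge0//.
  by rewrite subr_ge0 exprn_ile1//; lra.
rewrite [(1 / 2) ^+ n.+1]exprS; have := sqr_ge0 ((1 / 2 : R) ^+ n); move: ((1 / 2) ^+ n) => z; nra.
Qed.

Definition step (y : R) : R := limn (step_seq y).

Lemma stepE y : -1 <= y <= 1 -> step y = if y == 0 then step 0 else (0 < y)%R%:R.
Proof.
move=> /andP[y0 y1]; case: eqP => [->//|/eqP yn0].
have [yp|yn] := ltP 0 y; first by apply/cvg_lim => //; apply: cvg_step_seq_pos; rewrite yp.
by apply/cvg_lim => //; apply: cvg_step_seq_neg; rewrite y0 lt_neqAle yn0.
Qed.

Lemma cvg_step y : -1 <= y <= 1 -> step_seq y n @[n --> \oo] --> step y.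
Proof.
move=> /andP[y0 y1]; have [->|yn0] := eqVneq y 0; first exact: is_cvg_step_seq0.
apply/cvg_ex; exists ((0 < y)%R%:R); have [yp|yn] := ltP 0 y.
  by apply: cvg_step_seq_pos; rewrite yp.
by apply: cvg_step_seq_neg; rewrite y0 lt_neqAle yn0.
Qed.

Lemma step_le1 y : -1 <= y <= 1 -> `|step y| <= 1.
Proof.
move=> y1; apply: cvg_norm_le (cvg_step y1) _ => n.
by have /andP[? ?] := step_seq_itv n y1; rewrite ger0_norm.
Qed.

Lemma sin_itv (x : R) : -1 <= sin x <= 1.
Proof. by rewrite sin_geN1 sin_le1. Qed.

(** Composing with sin confines the argument to [-1, 1], where [step_seq] is bounded and converges;
    each [step_seq] is a polynomial in the sine, hence an [exp_limit]. *)
Lemma poly_approx_step_sin (t b : R) : poly_approx (fun x => step (sin (t * x + b))).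
Proof.
apply: (@poly_approx_lim (fun n x => step_seq (sin (t * x + b)) n) _ 1 0).
- move=> n; apply: exp_limit_approx; apply: exp_limitX.
  have h := exp_limit_sin t b.
  rewrite (_ : (fun x => _) = (fun x => 1 + (-1) * ((2^-1 + (- 2^-1) * sin (t * x + b)) ^+ n))).
    apply: exp_limitD; first exact: exp_limit_cst.
    apply: exp_limitM; first exact: exp_limit_cst.
    apply: exp_limitX; apply: exp_limitD; first exact: exp_limit_cst.
    by apply: exp_limitM => //; exact: exp_limit_cst.
  apply/funext => x; rewrite mulN1r; by congr (1 - _ ^+ n); field.
- by move=> x; apply: cvg_step; exact: sin_itv.
- move=> n x; rewrite mul0r expR0 mul1r.
  by have /andP[? ?] := step_seq_itv n (sin_itv (t * x + b)); rewrite ger0_norm.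
Qed.

Definition step_at (a x : R) : R := if x == a then step 0 else (a < x)%R%:R.

Lemma step_at_le1 a x : `|step_at a x| <= 1.
Proof.
rewrite /step_at; case: ifP => _; first by apply: step_le1; lra.
by rewrite normr_nat lern1 leq_b1.
Qed.

(** Slow sines undo the periodicity: once |x - a| < (n+1) pi, the sign of sin((x - a)/(n+1)) is that
    of x - a, so the sequence is eventually constant at each point. *)
Lemma poly_approx_step_at (a : R) : poly_approx (step_at a).
Proof.
apply: (@poly_approx_lim (fun n x => step (sin (n.+1%:R^-1 * x + (- (n.+1%:R^-1 * a))))) _ 1 0).
- by move=> n; exact: poly_approx_step_sin.
- move=> x; apply: cvg_near_cst.
  have pi0 := @pi_gt0 R.
  exists (Num.bound (`|x - a| / pi)) => // n /= hn.
  have n0 : 0 < n.+1%:R :> R by [].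
  have h : `|x - a| < n.+1%:R * pi.
    have := archi_boundP (divr_ge0 (normr_ge0 (x - a)) (ltW pi0)).
    rewrite ltr_pdivrMr// => /lt_le_trans; apply.
    by rewrite ler_pM2r// ler_nat (leq_trans hn).
  have -> : n.+1%:R^-1 * x - n.+1%:R^-1 * a = (x - a) / n.+1%:R by rewrite -mulrBr mulrC.
  rewrite stepE ?sin_itv// /step_at; have [xa|ax|->] := ltgtP a x.
  + have s : 0 < sin ((x - a) / n.+1%:R).
      apply: sin_gt0_pi; rewrite divr_gt0 ?subr_gt0//= ltr_pdivrMr// mulrC.
      by move: h; rewrite gtr0_norm ?subr_gt0.
    by rewrite s gt_eqF.
  + have s : sin ((x - a) / n.+1%:R) < 0.
      rewrite -oppr_gt0 -sinN -mulNr opprB; apply: sin_gt0_pi.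
      rewrite divr_gt0 ?subr_gt0//= ltr_pdivrMr// mulrC.
      by move: h; rewrite ltr0_norm ?subr_lt0// opprB.
    by rewrite (lt_eqF s) (lt_gtF s).
  + by rewrite subrr mul0r sin0 eqxx.
- move=> n x; rewrite mul0r expR0 mul1r; apply: step_le1; exact: sin_itv.
Qed.

(** Moving the jump to a - 1/(n+1) removes the unknown value at the threshold from the limit. *)
Lemma poly_approx_ray (a : R) : poly_approx (\1_(`[a, +oo[ : set R)).
Proof.
apply: (@poly_approx_lim (fun n => step_at (a - n.+1%:R^-1)) _ 1 0).
- by move=> n; exact: poly_approx_step_at.
- move=> x; rewrite indicE; have [ax|xa] := leP a x.
    apply: cvg_near_cst; apply: nearW => n.
    have : a - n.+1%:R^-1 < x by apply: lt_le_trans ax; rewrite gtrBl invr_gt0.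
    rewrite /step_at => h; rewrite gt_eqF// h.
    by rewrite mem_set//= in_itv/= ax.
  apply: cvg_near_cst; exists (Num.bound (a - x)^-1) => // n /= hn.
  have ax0 : 0 < a - x by rewrite subr_gt0.
  have h : x < a - n.+1%:R^-1.
    rewrite ltrBrDr -ltrBrDl invf_plt ?posrE//.
    have := archi_boundP (ltW (_ : 0 < (a - x)^-1)); rewrite invr_gt0 => /(_ ax0).
    by move=> /lt_le_trans; apply; rewrite ler_nat (leq_trans hn).
  rewrite /step_at (lt_eqF h) (lt_gtF h) memNset//= in_itv/= andbT.
  by rewrite leNgt xa.
- by move=> n x; rewrite mul0r expR0 mul1r; exact: step_at_le1.
Qed.

Lemma sum_indic_trivIset (F : (set RT)^nat) (k n : nat) x :
  trivIset setT F -> F k x -> \sum_(i < n) (\1_(F i) x : R) = (k < n)%N%:R.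
Proof.
move=> tF Fkx; elim: n => [|n IH]; first by rewrite big_ord0.
rewrite big_ord_recr/= IH indicE ltnS [(k <= n)%N]leq_eqVlt.
have [<-|kn] := eqVneq k n; first by rewrite ltnn mem_set// add0r.
rewrite memNset ?addr0// => Fnx; move/eqP: kn; apply.
by apply: (tF k n) => //; exists x.
Qed.

(** Dynkin induction from the rays. In a disjoint union the partial sums of indicators stay between
    0 and 1, so [poly_approx_lim] applies with a constant majorant. *)
Lemma poly_approx_indic (A : set RT) : measurable A -> poly_approx (\1_A).
Proof.
have mE : @measurable _ RT = <<s @RGenCInfty.G R >> by exact: RGenCInfty.measurableE.
move=> mA; have {mA} : <<s @RGenCInfty.G R >> A by rewrite -mE.
pose P (A : set RT) := poly_approx (\1_A).
have P1 : P setT.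
  rewrite /P; have := poly_approx_horner 1%:P; congr poly_approx.
  by apply/funext => x; rewrite hornerC indicT.
apply: (dynkin_induction (P := P) mE) => //.
- move=> _ _ [x ->] [y ->]; exists (Num.max x y); apply/seteqP.
  by split => z /=; rewrite !in_itv/= !andbT ge_max => /andP.
- by move=> _ [x ->]; exact: poly_approx_ray.
- move=> S mS PS; rewrite /P.
  have := poly_approxD P1 (poly_approxZ (-1) PS); congr poly_approx.
  apply/funext => x; rewrite !indicE in_setT in_setC mulN1r.
  by case: (x \in S); rewrite ?subrr ?subr0.
- move=> F mF tF PF; apply: (@poly_approx_lim (fun n x => \sum_(i < n) \1_(F i) x) _ 1 0).
  + elim=> [|n IH].
      have := poly_approx_horner 0; congr poly_approx.
      by apply/funext => x; rewrite horner0 big_ord0.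
    have := poly_approxD IH (PF n); congr poly_approx.
    by apply/funext => x; rewrite big_ord_recr.
  + move=> x; apply: cvg_near_cst; rewrite indicE.
    have [[k _ Fkx]|nF] := pselect ((\bigcup_k F k) x).
      exists k.+1 => // n /= kn; rewrite (sum_indic_trivIset n tF Fkx) kn.
      by rewrite mem_set//; exists k.
    apply: nearW => n; rewrite memNset// big1// => i _.
    by rewrite indicE memNset// => Fix; apply: nF; exists i.
  + move=> n x; rewrite mul0r expR0 mul1r.
    have [[k _ Fkx]|nF] := pselect ((\bigcup_k F k) x).
      by rewrite (sum_indic_trivIset n tF Fkx) normr_nat lern1 leq_b1.
    rewrite big1 ?normr0// => i _.
    by rewrite indicE memNset// => Fix; apply: nF; exists i.
Qed.

Import HBNNSimple.

Lemma poly_approx_nnsfun (g : {nnsfun RT >-> R}) : poly_approx (fun x => g x).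
Proof.
rewrite (_ : (fun x => g x) = fun x => \sum_(y <- finmap.enum_fset (fset_set (range g))) y * \1_(g @^-1` [set y]) x).
  elim: (finmap.enum_fset _) => [|y s IH].
    have := poly_approx_horner 0; congr poly_approx.
    by apply/funext => x; rewrite horner0 big_nil.
  under eq_fun do rewrite big_cons; apply: poly_approxD => //.
  by apply: poly_approxZ; apply: poly_approx_indic; exact: measurable_sfunP.
apply/funext => x; rewrite [LHS]fimfunE fsbig_finite//; exact: fimfunP.
Qed.

End PolynomialDensity.

(** * From the bounded functional to a square-integrable density *)

Section PolynomialDuality.
Context {R : realType}.
Local Notation RT := (measurableTypeR R).
Local Notation gauss := (normal_prob (0 : R) 1 : probability RT R).

Lemma mul2_le_of_sqr_le (a x y : R) :
  0 <= x -> 0 <= y -> a ^+ 2 <= x * y -> 2 * a <= x + y.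
Proof.
move=> x0 y0 axy; rewrite leNgt; apply/negP => lt; have := sqr_ge0 (x - y).
have : 0 < (2 * a - (x + y)) * (2 * a + (x + y)) by apply: mulr_gt0; lra.
nra.
Qed.

Lemma Rintegral_probability_cst d (T : measurableType d) (m : probability T R) (a : R) :
  \int[m]_x a = a.
Proof.
rewrite Rintegral_cst//; have := @probability_setT _ _ _ m.
by rewrite /= => h; rewrite [m _]h mulr1.
Qed.

Variables (mu : probability RT R) (K : R).
Hypothesis hmu : exp_moments mu.
Hypothesis hK : forall q, (\int[mu]_x q.[x]) ^+ 2 <= K * \int[gauss]_x (q * q).[x].

Local Notation nu := (measure_add gauss mu).

Lemma exp_moments_measure_add : exp_moments nu.
Proof.
move=> c; have mexp : measurable_fun setT (EFin \o (fun x : R => expR (c * `|x|))).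
  by apply/measurable_EFinP; apply: measurableT_comp => //; apply: measurable_funM => //; exact: measurableT_comp.
apply/integrableP; split => //.
rewrite ge0_integral_measure_add//; last exact: measurableT_comp.
have /integrableP[_ h1] := @gauss_exp_moments R c.
by have /integrableP[_ h2] := hmu c; exact: lte_add_pinfty.
Qed.

Lemma Rintegral_measure_add (g : R -> R) : exp_bounded g -> (forall x, 0 <= g x) ->
  \int[nu]_x g x = \int[gauss]_x g x + \int[mu]_x g x.
Proof.
move=> hg g0; rewrite /Rintegral ge0_integral_measure_add//; first last.
- by apply/measurable_EFinP; case: hg.
- by move=> x _; rewrite lee_fin.
by rewrite fineD//; apply: integrable_fin_num => //; apply: exp_bounded_integrable => //; exact: gauss_exp_moments.
Qed.

Lemma K_ge0 : 0 <= K.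
Proof.
have := hK 1; rewrite mulr1; under eq_Rintegral do rewrite hornerC.
under [X in _ <= _ * X]eq_Rintegral do rewrite hornerC.
by rewrite !Rintegral_probability_cst !mulr1; exact: le_trans.
Qed.

(** Approximating in L^2 of [nu] controls the error under both laws with one polynomial. The bound
    is the root-free form of E g <= sqrt(K) times the Gaussian norm of g. *)
Lemma poly_approx_duality (g : R -> R) : poly_approx nu g ->
  2 * \int[mu]_x g x <= K + \int[gauss]_x (g x) ^+ 2.
Proof.
move=> [hg ga]; have hnu := exp_moments_measure_add.
have K0 := K_ge0.
have ib f (m : {measure set RT -> \bar R}) : exp_moments m -> exp_bounded f ->
  m.-integrable setT (EFin \o f) by exact: exp_bounded_integrable.
have hga := @gauss_exp_moments R.
set B := \int[gauss]_x (g x) ^+ 2.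
have B0 : 0 <= B by apply: Rintegral_ge0 => x _; exact: sqr_ge0.
apply/ler_addgt0Pr => e e0.
(* Once G + M <= t^2, the four errors t, M/t, G and G/t are each at most t. Together with t B from
   the Young inequality they amount to t (B + 4) <= e. *)
pose t := e / (B + 4 + e).
have D0 : 0 < B + 4 + e by lra.
have t0 : 0 < t by rewrite divr_gt0.
have t1 : t <= 1 by rewrite ler_pdivrMr// mul1r; lra.
have tB : t * (B + 4) <= e.
  by rewrite -mulrA ler_piMr//; [exact: ltW|rewrite mulrC ler_pdivrMr// mul1r; lra].
have [q] := ga _ (exprn_gt0 2 t0).
have hq := exp_bounded_horner q; have hgq := exp_boundedB hg hq.
have sgq := exp_bounded_sqr hgq; have sg := exp_bounded_sqr hg.
have gq0 x : 0 <= (g x - q.[x]) ^+ 2 by exact: sqr_ge0.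
rewrite Rintegral_measure_add//.
set G := \int[gauss]_x _; set M := \int[mu]_x _ => GM.
have G0 : 0 <= G by apply: Rintegral_ge0.
have M0 : 0 <= M by apply: Rintegral_ge0.
have h1 : 2 * \int[mu]_x g x <= 2 * \int[mu]_x q.[x] + (t + t^-1 * M).
  rewrite -!RintegralZl//; try exact: ib.
  rewrite -[X in _ <= _ + (X + _)](Rintegral_probability_cst mu).
  rewrite -!RintegralD//; try by apply: ib => //; do ?[exact: exp_boundedZ|exact: exp_bounded_cst|apply: exp_boundedD].
  apply: le_Rintegral => //; try by apply: ib => //; do ?[exact: exp_boundedZ|exact: exp_bounded_cst|apply: exp_boundedD].
  move=> x _; rewrite -subr_ge0.
  have -> : 2 * q.[x] + (t + t^-1 * (g x - q.[x]) ^+ 2) - 2 * g x = t^-1 * (g x - q.[x] - t) ^+ 2.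
    by field; rewrite gt_eqF.
  by rewrite mulr_ge0 ?sqr_ge0// invr_ge0 ltW.
have h2 : \int[gauss]_x (q * q).[x] <= (1 + t) * B + (1 + t^-1) * G.
  rewrite -!RintegralZl//; try exact: ib.
  rewrite -!RintegralD//; try by apply: ib => //; do ?[exact: exp_boundedZ].
  apply: le_Rintegral => //; try by apply: ib => //; do ?[exact: exp_bounded_horner|exact: exp_boundedZ|apply: exp_boundedD].
  move=> x _; rewrite hornerM -subr_ge0.
  have -> : (1 + t) * g x ^+ 2 + (1 + t^-1) * (g x - q.[x]) ^+ 2 - q.[x] * q.[x]
    = t^-1 * ((1 + t) * g x - q.[x]) ^+ 2.
    by field; rewrite gt_eqF.
  by rewrite mulr_ge0 ?sqr_ge0// invr_ge0 ltW.
have h3 : 2 * \int[mu]_x q.[x] <= K + \int[gauss]_x (q * q).[x].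
  have Q0 : 0 <= \int[gauss]_x (q * q).[x].
    by apply: Rintegral_ge0 => x _; rewrite hornerM -expr2 sqr_ge0.
  exact: mul2_le_of_sqr_le.
have h4 : t^-1 * M <= t by rewrite mulrC ler_pdivrMr// -expr2; lra.
have h5 : t^-1 * G <= t by rewrite mulrC ler_pdivrMr// -expr2; lra.
have h6 : G <= t by nra.
have : \int[mu]_x q.[x] = \int[mu]_x q.[x] by [].
move: h1 h2 h3 h4 h5 h6 tB; clear; set I := \int[mu]_x g x; set J := \int[mu]_x _.
by set L := \int[gauss]_x _; nra.
Qed.

(** On a Gaussian null set [A], the test function c 1_A has zero Gaussian norm, so 2 c mu(A) <= K
    for every c, which forces mu(A) = 0. *)
Lemma duality_dominates : mu `<< gauss.
Proof.
apply/null_content_dominatesP => A mA A0.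
have /= h : forall c : R, 2 * (c * fine (mu A)) <= K.
  move=> c; have := poly_approx_duality (poly_approxZ exp_moments_measure_add c
    (poly_approx_indic exp_moments_measure_add mA)).
  have hA : exp_bounded (\1_A : R -> R) by case: (poly_approx_indic exp_moments_measure_add mA).
  rewrite RintegralZl//; last exact: exp_bounded_integrable.
  have -> : \int[gauss]_x (c * \1_A x) ^+ 2 = 0.
    have e x : (c * \1_A x) ^+ 2 = c ^+ 2 * \1_A x :> R.
      by rewrite exprMn indicE; case: (_ \in A); rewrite ?expr1n ?expr0n.
    under eq_Rintegral do rewrite e.
    rewrite RintegralZl//; last exact: gauss_integrable.
    by rewrite /Rintegral integral_indic// setIT A0 mulr0.
  by rewrite addr0 /Rintegral integral_indic// setIT.
have fA : mu A \is a fin_num by exact: fin_num_measure.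
have m0 : 0 <= fine (mu A) by exact: fine_ge0.
have K0 := K_ge0.
rewrite -(fineK fA); congr EFin; apply/eqP; rewrite eq_le m0 andbT leNgt; apply/negP => m1.
by have := h ((K + 1) / fine (mu A)); rewrite divfK ?gt_eqF//; lra.
Qed.

Import HBNNSimple.

Lemma duality_density : exists f : R -> R,
  [/\ measurable_fun setT f, forall x, 0 <= f x,
     forall A : set RT, measurable A -> mu A = (\int[gauss]_(x in A) (f x)%:E)%E &
     (\int[gauss]_x ((f x - 1) ^+ 2)%:E <= (K - 1)%:E)%E].
Proof.
have [f0 [f0_ge0 f0_fin f0i muE0]] := radon_nikodym_sigma_finite duality_dominates.
pose f x := fine (f0 x); have fE x : (f x)%:E = f0 x by rewrite fineK.
have mf : measurable_fun setT f by apply: measurableT_comp => //; exact: measurable_int f0i.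
have f_ge0 x : 0 <= f x by exact/fine_ge0.
have muE (A : set RT) : measurable A -> mu A = (\int[gauss]_(x in A) (f x)%:E)%E.
  by move=> mA; rewrite muE0//; apply: eq_integral => x _; rewrite fE.
have mEf : measurable_fun [set: RT] (EFin \o f) by exact/measurable_EFinP.
pose g := nnsfun_approx measurableT mEf.
have gx x : g n x @[n --> \oo] --> f x.
  have := cvg_nnsfun_approx measurableT mEf (fun x _ => f_ge0 x : (0 <= (f x)%:E)%E) (I : setT x).
  by move=> /fine_cvgP[].
have gnd x m n : (m <= n)%N -> g m x <= g n x.
  by move=> mn; have /lefP := nd_nnsfun_approx measurableT mEf mn; exact.
have gf n x : g n x <= f x.
  rewrite -(cvg_lim _ (gx x))//.
  apply: (@nondecreasing_cvgn_le _ (fun n => g n x)); last by apply/cvg_ex; exists (f x).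
  by move=> m k; exact: gnd.
(* Square integrability of [f] is not yet known, so the test function is a simple function g_n <= f.
   Then 2 E(g_n f) <= K + E(g_n^2) and g_n^2 <= g_n f give the bound. *)
have gK n : \int[gauss]_x (g n x) ^+ 2 <= K.
  have ga := poly_approx_nnsfun exp_moments_measure_add (g n).
  have [hg _] := ga; have mg : measurable_fun setT (g n : R -> R) by case: hg.
  have := poly_approx_duality ga.
  have gi : mu.-integrable setT (EFin \o (g n : R -> R)) by exact: exp_bounded_integrable.
  have gfi : gauss.-integrable setT (EFin \o ((g n : R -> R) \* f)).
    exact/(@integrable_densityP _ RT R mu gauss f).
  have -> : \int[mu]_x g n x = \int[gauss]_x (g n x * f x).
    by rewrite /Rintegral (@integral_density _ RT R mu gauss f).
  have : \int[gauss]_x (g n x) ^+ 2 <= \int[gauss]_x (g n x * f x).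
    apply: le_Rintegral => //; first exact/gauss_integrable/exp_bounded_sqr.
    by move=> x _; rewrite expr2 ler_wpM2l.
  lra.
have hgn n : exp_bounded (g n : R -> R).
  by have [] := poly_approx_nnsfun exp_moments_measure_add (g n).
have f2K : (\int[gauss]_x ((f x) ^+ 2)%:E <= K%:E)%E.
  have cv : (\int[gauss]_x ((g n x) ^+ 2)%:E)%E @[n --> \oo] --> (\int[gauss]_x ((f x) ^+ 2)%:E)%E.
    have -> : (\int[gauss]_x ((f x) ^+ 2)%:E = \int[gauss]_x limn (fun n => ((g n x) ^+ 2)%:E))%E.
      apply: eq_integral => x _; apply/esym/cvg_lim => //; apply: cvg_EFin; first exact: nearW.
      by apply: cvgM; exact: gx.
    apply: cvg_monotone_convergence => //.
    - by move=> n; apply/measurable_EFinP; apply: measurable_funX; have [] := hgn n.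
    - by move=> n x _; rewrite lee_fin sqr_ge0.
    - by move=> x _ m n mn; rewrite lee_fin lerXn2r ?nnegrE// gnd.
  apply: (cvge_to_le cv); apply: nearW => n.
  have := gK n; rewrite -lee_fin /Rintegral fineK//.
  exact/integrable_fin_num/gauss_integrable/exp_bounded_sqr.
exists f; split => //.
have mf2 : measurable_fun [set: RT] (fun x => (f x - 1) ^+ 2).
  by apply: measurable_funX; exact: measurable_funB.
have h0 x : (0 <= ((f x - 1) ^+ 2)%:E)%E by rewrite lee_fin sqr_ge0.
have f1 : (\int[gauss]_x (f x)%:E = 1)%E by rewrite -muE// probability_setT.
(* The identity (f - 1)^2 + 2 f = f^2 + 1 has only nonnegative terms, so extended integrals can be
   added, and E f = 1 yields E (f - 1)^2 + 2 = E f^2 + 1. *)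
have e1 : (\int[gauss]_x ((f x - 1) ^+ 2)%:E + 2 = \int[gauss]_x ((f x - 1) ^+ 2 + 2 * f x)%:E)%E.
  have -> : (fun x => ((f x - 1) ^+ 2 + 2 * f x)%:E) =
      (fun x => (((f x - 1) ^+ 2)%:E + 2%:E * (f x)%:E)%E) by [].
  rewrite ge0_integralD//; first last.
  - by apply: emeasurable_funM => //; exact/measurable_EFinP.
  - by move=> x _; rewrite -EFinM lee_fin mulr_ge0.
  - exact/measurable_EFinP.
  congr (_ + _)%E; rewrite (@ge0_integralZl_EFin _ RT R gauss _ measurableT (EFin \o f))//.
    by rewrite f1 mule1.
  by move=> x _; rewrite /= lee_fin.
have e2 : (\int[gauss]_x (f x ^+ 2)%:E + 1 = \int[gauss]_x ((f x - 1) ^+ 2 + 2 * f x)%:E)%E.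
  have -> : (fun x => ((f x - 1) ^+ 2 + 2 * f x)%:E) = (fun x => (f x ^+ 2)%:E + 1%:E)%E.
    by apply/funext => x; rewrite -EFinD; congr EFin; ring.
  rewrite ge0_integralD//; first last.
  - by apply/measurable_EFinP; exact: measurable_funX.
  - by move=> x _; rewrite lee_fin sqr_ge0.
  congr (_ + _)%E; rewrite integral_cst// mul1e; exact/esym/probability_setT.
rewrite -e2 in e1; have : (\int[gauss]_x ((f x - 1) ^+ 2)%:E + 2 <= (K + 1)%:E)%E.
  by rewrite e1 EFinD leeD2r.
have : (0 <= \int[gauss]_x ((f x - 1) ^+ 2)%:E)%E by exact: integral_ge0.
case: (\int[gauss]_x _)%E => [r||]//.
by rewrite -EFinD !lee_fin; lra.
Qed.

End PolynomialDuality.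

(** * Moments of sums of independent variables *)

Section Independence.
Context d (T : measurableType d) (R : realType) (P : probability T R).
Local Notation RT := (measurableTypeR R).

Definition law (Y : T -> R) (mY : measurable_fun setT Y) : probability RT R :=
  distribution P (@mfun_Sub _ _ T RT Y (mem_set mY)).

Lemma lawE (Y : T -> R) (mY : measurable_fun setT Y) (A : set RT) :
  law mY A = P (Y @^-1` A).
Proof. by []. Qed.

Lemma ge0_integral_law (Y : T -> R) (mY : measurable_fun setT Y) (f : R -> \bar R) :
  measurable_fun [set: RT] f -> (forall x, 0 <= f x)%E ->
  (\int[law mY]_x f x = \int[P]_t f (Y t))%E.
Proof. by move=> mf f0; rewrite ge0_integral_distribution. Qed.

Lemma integrable_law (Y : T -> R) (mY : measurable_fun setT Y) (f : R -> R) :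
  measurable_fun [set: RT] f ->
  (law mY).-integrable setT (EFin \o f) <-> P.-integrable setT (EFin \o (f \o Y)).
Proof.
move=> mf; have e : (\int[law mY]_x `|(f x)%:E| = \int[P]_t `|(f (Y t))%:E|)%E.
  rewrite ge0_integral_law//; apply: measurableT_comp => //; exact/measurable_EFinP.
split=> /integrableP[_ h]; apply/integrableP; split.
- by apply/measurable_EFinP; apply: measurableT_comp.
- by rewrite -e.
- exact/measurable_EFinP.
- by rewrite e.
Qed.

Lemma Rintegral_law (Y : T -> R) (mY : measurable_fun setT Y) (f : R -> R) :
  (law mY).-integrable setT (EFin \o f) -> \int[law mY]_x f x = \int[P]_t f (Y t).
Proof.
move=> hf; have mf := measurable_int _ hf.
rewrite /Rintegral (@integral_distribution _ _ T RT R P (@mfun_Sub _ _ T RT Y (mem_set mY)) (EFin \o f))//.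
by apply/integrable_law => //; exact/measurable_EFinP.
Qed.

Definition independent (U V : T -> R) := forall A B : set RT,
  measurable A -> measurable B ->
  P (U @^-1` A `&` V @^-1` B) = (P (U @^-1` A) * P (V @^-1` B))%E.

Variables (U V : T -> R).
Hypotheses (mU : measurable_fun setT U) (mV : measurable_fun setT V).
Hypothesis UV : independent U V.

Let mUV : measurable_fun setT (fun t => (U t, V t) : RT * RT).
Proof. exact: measurable_fun_pair. Qed.

Let joint : probability (RT * RT)%type R :=
  distribution P (mfun_Sub (mem_set mUV) : {mfun T >-> (RT * RT)%type}).

Let jointE (A : set (RT * RT)) : measurable A -> (law mU \x law mV)%E A = joint A.
Proof. by apply: product_measure_unique => A0 B mA mB; rewrite -UV. Qed.

Variables f g : R -> R.
Hypothesis hf : (law mU).-integrable setT (EFin \o f).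
Hypothesis hg : (law mV).-integrable setT (EFin \o g).

Let F (z : RT * RT) : \bar R := (f z.1 * g z.2)%:E.

Let mF : measurable_fun setT F.
Proof.
have mf : measurable_fun [set: RT] f by apply/measurable_EFinP; exact: (measurable_int _ hf).
have mg : measurable_fun [set: RT] g by apply/measurable_EFinP; exact: (measurable_int _ hg).
apply/measurable_EFinP; apply: measurable_funM.
  exact: (measurableT_comp mf measurable_fst).
exact: (measurableT_comp mg measurable_snd).
Qed.

Let iF : (law mU \x law mV)%E.-integrable setT F.
Proof.
apply/integrable12ltyP; first exact: mF.
have e x : (\int[law mV]_y `|F (x, y)| = `|(f x)%:E| * \int[law mV]_y `|(g y)%:E|)%E.
  rewrite -ge0_integralZl//.
  - by apply: eq_integral => y _; rewrite /F/= normrM EFinM.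
  - by apply: measurableT_comp => //; exact: (measurable_int _ hg).
under eq_integral do rewrite e.
rewrite ge0_integralZr//; first last.
- exact: integral_ge0.
- by apply: measurableT_comp => //; exact: (measurable_int _ hf).
have /integrableP[_ h1] := hf; have /integrableP[_ h2] := hg.
by apply: lte_mul_pinfty => //; [exact: integral_ge0|rewrite ge0_fin_numE//; exact: integral_ge0].
Qed.

Lemma independent_integrableM : P.-integrable setT (EFin \o (fun t => f (U t) * g (V t))).
Proof.
have /integrableP[_ h] := iF; apply/integrableP; split.
  exact: (measurableT_comp mF mUV).
move: h; rewrite (eq_measure_integral joint); last by move=> A mA _; exact: jointE.
by rewrite ge0_integral_distribution//; apply: measurableT_comp => //; exact: mF.
Qed.

Lemma independent_RintegralM :
  \int[P]_t (f (U t) * g (V t)) = (\int[law mU]_x f x) * (\int[law mV]_x g x).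
Proof.
have := @integral12_prod_meas1 _ _ RT RT R (law mU) (law mV) F iF.
rewrite (eq_measure_integral joint); last by move=> A mA _; exact: jointE.
rewrite (@integral_distribution _ _ T _ R P (mfun_Sub (mem_set mUV)) F mF independent_integrableM).
rewrite /Rintegral => /(congr1 fine) <-.
have e x : (fubini_F (law mV) F x = (f x)%:E * \int[law mV]_y (g y)%:E)%E.
  by rewrite /fubini_F; under eq_integral do rewrite /F/= EFinM; rewrite integralZl.
transitivity (fine (\int[law mU]_x ((f x)%:E * \int[law mV]_y (g y)%:E))%E).
  by congr fine; apply: eq_integral => x _; exact: e.
rewrite -(fineK (integrable_fin_num measurableT hg)) integralZr//= fineM//.
exact: integrable_fin_num.
Qed.

End Independence.

(** * Independence of partial sums from later variables *)

Section IndependentSums.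
Context d (T : measurableType d) (R : realType) (P : probability T R).
Local Notation RT := (measurableTypeR R).

(** Dynkin induction from rectangles to Borel sets of the plane. It is needed because the event that
    U + V lies in a set is not a rectangle. *)
Lemma independent_event_pair (U V : T -> R) (E : set T) :
  measurable_fun setT U -> measurable_fun setT V -> measurable E ->
  (forall A B : set RT, measurable A -> measurable B ->
    P (U @^-1` A `&` V @^-1` B `&` E) = (P (U @^-1` A `&` V @^-1` B) * P E)%E) ->
  forall C : set (RT * RT), measurable C ->
    P ((fun t => (U t, V t)) @^-1` C `&` E) = (P ((fun t => (U t, V t)) @^-1` C) * P E)%E.
Proof.
move=> mU mV mE UVE; pose W t : RT * RT := (U t, V t).
have mW : measurable_fun setT W by exact: measurable_fun_pair.
have mWC (C : set (RT * RT)) : measurable C -> measurable (W @^-1` C).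
  by move=> mC; rewrite -[_ @^-1` _]setTI; exact: mW.
have fE : P E \is a fin_num by exact: fin_num_measure.
have PE : (P setT * P E)%E = P E by rewrite probability_setT mul1e.
pose Q (C : set (RT * RT)) := P (W @^-1` C `&` E) = (P (W @^-1` C) * P E)%E.
move=> C; rewrite measurable_prod_measurableType; move: C.
apply: (dynkin_induction (P := Q) (measurable_prod_measurableType RT RT)).
- move=> _ _ [A mA [B mB <-]] [A' mA' [B' mB' <-]]; rewrite -setXI.
  by exists (A `&` A'); [exact: measurableI|exists (B `&` B') => //; exact: measurableI].
- by rewrite /Q preimage_setT setTI PE.
- by move=> _ [A mA [B mB <-]]; rewrite /Q -UVE.
- move=> S mS; rewrite /Q -preimage_setC => QS.
  have mWS := mWC _ mS.
  have : P E = (P (E `\` W @^-1` S) + P (W @^-1` S `&` E))%E.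
    by rewrite [W @^-1` S `&` E]setIC; exact: measureDI.
  rewrite QS => e1.
  rewrite setIC -setDE probability_setC// muleBl//.
  by rewrite mul1e [X in (_ = X - _)%E]e1 addeK// fin_numM// fin_num_measure.
- move=> F mF tF QF; rewrite /Q preimage_bigcup setI_bigcupl.
  have tWF : trivIset setT (fun k => W @^-1` F k).
    move=> i j _ _ [t [Fi Fj]]; apply: tF => //; by exists (W t).
  have mWF k : measurable (W @^-1` F k) by exact: mWC.
  rewrite !measure_semi_bigcup//; first last.
  + by apply: bigcup_measurable => k _; exact: measurableI.
  + by move=> i j _ _ [t [[Fi _] [Fj _]]]; apply: tWF => //; exists t.
  + by move=> k; exact: measurableI.
  + exact: bigcup_measurable.
  rewrite muleC -(fineK fE) -nneseriesZl//.
  by apply: eq_eseriesr => k _; rewrite fineK// muleC; exact: QF.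
Qed.

Variables (n : nat) (X : 'I_n -> T -> R).
Hypotheses (mX : forall i, measurable_fun setT (X i)) (iX : mutually_independent P X).

Definition partial_sum (m : nat) (t : T) : R := \sum_(i < n | (i < m)%N) X i t.

Lemma partial_sum0 t : partial_sum 0 t = 0.
Proof. by rewrite /partial_sum big_pred0. Qed.

Lemma partial_sumS (i : 'I_n) t : partial_sum i.+1 t = partial_sum i t + X i t.
Proof.
rewrite /partial_sum (bigD1 i)//= addrC; congr (_ + _); apply: eq_bigl => j.
by rewrite ltnS ltn_neqAle andbC.
Qed.

Lemma partial_sumT t : partial_sum n t = \sum_(i < n) X i t.
Proof. by apply: eq_bigl => i; rewrite ltn_ord. Qed.

Lemma measurable_partial_sum m : measurable_fun setT (partial_sum m).
Proof.
suff -> : partial_sum m = fun t => \sum_(i < n) (if (i < m)%N then X i t else 0).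
  by apply: measurable_sum => i; case: (i < m)%N.
by apply/funext => t; rewrite /partial_sum big_mkcond.
Qed.

Let event (B : 'I_n -> set RT) := \bigcap_(i in [set: 'I_n]) X i @^-1` B i.

Let measurable_event (B : 'I_n -> set RT) :
  (forall i, measurable (B i)) -> measurable (event B).
Proof.
move=> mB; apply: fin_bigcap_measurable => // i _.
by have := mX i measurableT (mB i); rewrite setTI.
Qed.

Let eventD1 (B : 'I_n -> set RT) (i : 'I_n) (C : set RT) :
  B i = setT -> event (fun j => if j == i then C else B j) = X i @^-1` C `&` event B.
Proof.
move=> Bi; apply/seteqP; split => [t h|t [h1 h2] j _]; last first.
  by case: eqP => [->//|_]; exact: h2.
split; first by have := h i I; rewrite eqxx.
by move=> j _; have := h j I; case: eqP => // -> _; rewrite Bi.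
Qed.

Let measurable_if (B : 'I_n -> set RT) (i : 'I_n) (C : set RT) :
  (forall i, measurable (B i)) -> measurable C ->
  forall j, measurable (if j == i then C else B j).
Proof. by move=> mB mC j; case: ifP. Qed.

Let P_eventD1 (B : 'I_n -> set RT) (i : 'I_n) (C : set RT) :
  (forall i, measurable (B i)) -> measurable C -> B i = setT ->
  P (X i @^-1` C `&` event B) = (P (X i @^-1` C) * P (event B))%E.
Proof.
move=> mB mC Bi; rewrite -eventD1// /event !iX//; last exact: measurable_if.
rewrite (bigD1 i)//= [X in (_ = _ * X)%E](bigD1 i)//= eqxx Bi preimage_setT probability_setT mul1e.
by congr (_ * _)%E; apply: eq_bigr => j /negbTE ->.
Qed.

(** The induction requires independence from all later variables jointly: the event may constrain
    coordinates from [m] on, and [B i = setT] below [m] expresses that it constrains no earlier one.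
    One step moves coordinate [m] from the event into the sum. *)
Lemma partial_sum_independent (m : nat) (B : 'I_n -> set RT) (A : set RT) :
  (forall i, measurable (B i)) -> (forall i : 'I_n, (i < m)%N -> B i = setT) ->
  (m <= n)%N -> measurable A ->
  P (partial_sum m @^-1` A `&` event B) = (P (partial_sum m @^-1` A) * P (event B))%E.
Proof.
move=> + + + mA; elim: m B A mA => [|m IH] B A mA mB Bm mn.
  have -> : partial_sum 0 = cst 0 by apply/funext => t; rewrite partial_sum0.
  rewrite preimage_cst; case: ifP => _; first by rewrite setTI probability_setT mul1e.
  by rewrite set0I measure0 mul0e.
pose i := Ordinal mn; have Bi : B i = setT by apply: Bm => /=.
have hA (C D : set RT) : measurable C -> measurable D ->
    P (partial_sum m @^-1` C `&` X i @^-1` D) = (P (partial_sum m @^-1` C) * P (X i @^-1` D))%E.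
  move=> mC mD; pose B0 (j : 'I_n) : set RT := setT.
  have mB0 j : measurable (B0 j) by exact: measurableT.
  have e0 : event B0 = setT by apply/seteqP; split.
  rewrite -[X i @^-1` D]setIT -[in LHS]e0 -(eventD1 D (erefl : B0 i = setT)).
  rewrite IH//; [|exact: measurable_if| |exact: ltnW]; last first.
    by move=> j jm; case: eqP => // ji; rewrite ji ltnn in jm.
  by rewrite eventD1// e0 setIT.
have hE := independent_event_pair (measurable_partial_sum m) (mX i) (measurable_event mB).
have mplus : measurable_fun [set: RT * RT] (fun z => z.1 + z.2 : RT).
  by apply: measurable_funD; [exact: measurable_fst|exact: measurable_snd].
have := hE _ ((fun z => z.1 + z.2) @^-1` A).
have -> : (fun t => (partial_sum m t, X i t)) @^-1` ((fun z => z.1 + z.2) @^-1` A) = partial_sum m.+1 @^-1` A.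
  by apply/seteqP; split => t /=; rewrite -(partial_sumS i).
apply.
  move=> C D mC mD; rewrite -setIA -eventD1// IH//; [|exact: measurable_if| |exact: ltnW]; last first.
    move=> j jm; case: eqP => [ji|_]; first by rewrite ji ltnn in jm.
    by apply: Bm; exact: leqW.
  by rewrite eventD1// P_eventD1// hA// muleA.
by rewrite -[_ @^-1` _]setTI; exact: mplus.
Qed.

Lemma independent_partial_sum (i : 'I_n) : independent P (partial_sum i) (X i).
Proof.
move=> A D mA mD; pose B0 (j : 'I_n) : set RT := setT.
have mB0 j : measurable (B0 j) by exact: measurableT.
have e0 : event B0 = setT by apply/seteqP; split.
rewrite -[X i @^-1` D]setIT -[in LHS]e0 -(eventD1 D (erefl : B0 i = setT)).
rewrite partial_sum_independent//; [|exact: measurable_if| |exact: ltnW].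
  by rewrite eventD1// e0 setIT.
by move=> j jm; case: eqP => // ji; rewrite ji ltnn in jm.
Qed.

End IndependentSums.

(** * Hermite moments of partial sums *)

Section SumMoments.
Context d (T : measurableType d) (R : realType) (P : probability T R).
Local Notation RT := (measurableTypeR R).

Lemma Rintegral_sum N (F : nat -> T -> R) :
  (forall k, P.-integrable setT (EFin \o F k)) ->
  \int[P]_t (\sum_(k < N) F k t) = \sum_(k < N) \int[P]_t F k t.
Proof.
move=> hF; elim: N => [|N IH].
  by under eq_Rintegral do rewrite big_ord0; rewrite Rintegral_cst// mul0r big_ord0.
under eq_Rintegral do rewrite big_ord_recr/=.
rewrite RintegralD//; first by rewrite IH big_ord_recr.
have := @integrable_sum _ T R P setT measurableT _ (index_enum 'I_N) xpredT _ (fun k _ => hF k).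
by apply: eq_integrable => // t _; rewrite /= sumEFin.
Qed.

Lemma hermite_moment0 (mu : probability RT R) : hermite_moment mu 0 = 1.
Proof.
rewrite /hermite_moment hermite0; under eq_Rintegral do rewrite hornerC.
exact: Rintegral_probability_cst.
Qed.

Lemma exp_moments_independentD (U V : T -> R) (mU : measurable_fun setT U)
    (mV : measurable_fun setT V) (mUV : measurable_fun setT (fun t => U t + V t)) :
  independent P U V -> exp_moments (law P mU) -> exp_moments (law P mV) ->
  exp_moments (law P mUV).
Proof.
move=> UV hU hV c; have mexp (a : R) : measurable_fun [set: RT] (fun x : R => expR (a * `|x|)).
  by apply: measurableT_comp => //; apply: measurable_funM => //; exact: measurableT_comp.
apply/(@integrable_law _ _ _ P _ mUV (fun x => expR (c * `|x|))) => //.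
have := independent_integrableM UV (hU `|c|) (hV `|c|).
apply: le_integrable => //.
  apply/measurable_EFinP; exact: (measurableT_comp (mexp c) mUV).
move=> t _ /=; rewrite -expRD lee_fin [leLHS]ger0_norm ?expR_ge0// [leRHS]ger0_norm ?expR_ge0//.
rewrite -mulrDr; apply: (le_trans (expR_norm_le_max _ (ler_norm c))).
by rewrite ler_expR ler_wpM2l// ler_normD.
Qed.

Lemma exp_moments_law_bounded (Y : T -> R) (mY : measurable_fun setT Y) (M : R) :
  (forall t, `|Y t| <= M) -> exp_moments (law P mY).
Proof.
move=> YM c; have mexp (a : R) : measurable_fun [set: RT] (fun x : R => expR (a * `|x|)).
  by apply: measurableT_comp => //; apply: measurable_funM => //; exact: measurableT_comp.
apply/(@integrable_law _ _ _ P _ mY (fun x => expR (c * `|x|))) => //.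
apply: (@le_integrable _ T R P setT _ _ (cst (expR (`|c| * M))%:E)) => //.
- apply/measurable_EFinP; exact: (measurableT_comp (mexp c) mY).
- move=> t _ /=; rewrite lee_fin [leLHS]ger0_norm ?expR_ge0// [leRHS]ger0_norm ?expR_ge0// ler_expR.
  apply: (@le_trans _ _ (`|c| * `|Y t|)); first by rewrite ler_wpM2r// ler_norm.
  by rewrite ler_wpM2l.
- exact: finite_measure_integrable_cst.
Qed.

Lemma law_horner_integrable (Y : T -> R) (mY : measurable_fun setT Y) (q : {poly R}) :
  exp_moments (law P mY) -> (law P mY).-integrable setT (EFin \o (fun x => q.[x])).
Proof. by move=> hY; apply: exp_bounded_integrable => //; exact: exp_bounded_horner. Qed.

Variables (n : nat) (X : 'I_n -> T -> R).
Hypotheses (mX : forall i, measurable_fun setT (X i)) (iX : mutually_independent P X).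
Hypothesis hX : forall i, exp_moments (law P (mX i)).

Local Notation mT := (measurable_partial_sum mX).

Let partial_sumE (i : 'I_n) : partial_sum X i.+1 = fun t => partial_sum X i t + X i t.
Proof. by apply/funext => t; exact: partial_sumS. Qed.

Lemma exp_moments_partial_sum m : (m <= n)%N -> exp_moments (law P (mT m)).
Proof.
elim: m => [_|m IH mn].
  by apply: (@exp_moments_law_bounded _ _ 0) => t; rewrite partial_sum0 normr0.
have hm := IH (ltnW mn); pose i := Ordinal mn.
have mD : measurable_fun setT (fun t => partial_sum X i t + X i t).
  by rewrite -partial_sumE; exact: mT.
have := exp_moments_independentD mD (independent_partial_sum mX iX i) hm (hX i).
move=> h c; have mexp : measurable_fun [set: RT] (fun x : R => expR (c * `|x|)).
  by apply: measurableT_comp => //; apply: measurable_funM => //; exact: measurableT_comp.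
have /integrable_law := h c => /(_ mexp) hc.
apply/(@integrable_law _ _ _ P _ (mT m.+1) (fun x => expR (c * `|x|))) => //.
by rewrite (partial_sumE i).
Qed.

Fixpoint sum_moment (b : nat -> nat -> R) m k : R :=
  if m is m'.+1 then
    sum_moment b m' k + \sum_(i < k.+1) b m' i * sum_moment b m' (k - i)%N
  else (k == 0%N)%:R.

(** The moment 1 of order 0 is split off as the separate summand of [sum_moment], so the value here
    is 0. Indices outside ['I_n] also get 0, because the coefficient inequality takes sequences
    indexed by [nat]. *)
Definition centered_moment j i : R :=
  if i == 0%N then 0
  else if insub j is Some o then hermite_moment (law P (mX o)) i else 0.

Lemma centered_momentE (o : 'I_n) i : (0 < i)%N ->
  centered_moment o i = hermite_moment (law P (mX o)) i.
Proof. by move=> i0; rewrite /centered_moment eqn0Ngt i0/= valK. Qed.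

Lemma hermite_partial_sum m k : (m <= n)%N ->
  \int[law P (mT m)]_x (hermite m%:R k).[x] = sum_moment centered_moment m k.
Proof.
elim: m k => [|m IH] k mn.
  rewrite /= Rintegral_law; last exact/law_horner_integrable/exp_moments_partial_sum.
  under eq_Rintegral do rewrite partial_sum0.
  (* Scaling by r = 0 evaluates the variance-0 polynomial of order [k] at 0 as 0^k. *)
  rewrite Rintegral_probability_cst; have := @hermite_scale R 0 0 k 0.
  rewrite !mul0r mulr0 => ->; case: k => [|k]; first by rewrite hermite0 hornerC mulr1.
  by rewrite expr0n mul0r.
pose i := Ordinal mn; rewrite /= Rintegral_law; last exact/law_horner_integrable/exp_moments_partial_sum.
have hm := exp_moments_partial_sum (ltnW mn).
have e t : (hermite m.+1%:R k).[partial_sum X m.+1 t] =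
    \sum_(j < k.+1) (hermite m%:R (k - j)%N).[partial_sum X i t] * (hermite 1 j).[X i t].
  rewrite (partial_sumS X i) -natr1 hermiteD convolutionC /convolution.
  by apply: eq_bigr => j _; rewrite mulrC.
under eq_Rintegral do rewrite e.
have iUV (j : nat) := independent_integrableM (independent_partial_sum mX iX i)
   (law_horner_integrable (hermite m%:R (k - j)%N) hm) (law_horner_integrable (hermite 1 j) (hX i)).
have eM (j : nat) : \int[P]_t ((hermite m%:R (k - j)%N).[partial_sum X i t] * (hermite 1 j).[X i t]) =
    sum_moment centered_moment m (k - j)%N * hermite_moment (law P (mX i)) j.
  rewrite -IH ?(ltnW mn)//.
  exact: (independent_RintegralM (independent_partial_sum mX iX i)
   (law_horner_integrable (hermite m%:R (k - j)%N) hm) (law_horner_integrable (hermite 1 j) (hX i))).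
rewrite (Rintegral_sum _ iUV).
rewrite (eq_bigr (fun j : 'I_k.+1 => sum_moment centered_moment m (k - j)%N *
  hermite_moment (law P (mX i)) j)); last by move=> j _; exact: eM.
rewrite big_ord_recl [in RHS]big_ord_recl subn0 hermite_moment0.
rewrite mulr1 [centered_moment m 0%N]/(0 : R) mul0r add0r; congr (_ + _); apply: eq_bigr => j _.
by rewrite mulrC -(@centered_momentE i).
Qed.

End SumMoments.

(** * The chi-square distance in terms of Gaussian densities *)

Section ChiSquare.
Context d (T : measurableType d) (R : realType) (P : probability T R).
Local Notation RT := (measurableTypeR R).
Local Notation gauss := (normal_prob (0 : R) 1 : probability RT R).
Local Notation lam := (@lebesgue_measure R).
Local Notation phi := (@std_normal_density R).
Variables (Y : T -> R) (mY : measurable_fun setT Y).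

Let phi0 x : 0 <= phi x. Proof. exact/ltW/std_normal_density_gt0. Qed.
Let mphi : measurable_fun setT phi. Proof. exact: measurable_std_normal_density. Qed.

Let ge0_integral_gauss (f : R -> \bar R) : (forall x, 0 <= f x)%E ->
  measurable_fun [set: RT] f -> (\int[gauss]_x f x = \int[lam]_x (f x * (phi x)%:E))%E.
Proof. by move=> f0 mf; rewrite (@ge0_integral_density _ RT R gauss lam phi)//; exact: gaussE. Qed.

Lemma ge0_integral_gauss_set (A : set RT) (f : R -> R) : measurable A -> (forall x, 0 <= f x) ->
  measurable_fun [set: RT] f ->
  (\int[gauss]_(x in A) (f x)%:E = \int[lam]_(x in A) (f x * phi x)%:E)%E.
Proof.
move=> mA f0 mf; rewrite [LHS]integral_mkcond [RHS]integral_mkcond ge0_integral_gauss//.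
- by apply: eq_integral => x _; rewrite /patch; case: ifP => _; rewrite ?mul0e.
- by move=> x; rewrite /patch; case: ifP => _; rewrite ?lee_fin.
- by apply/(measurable_restrictT _ mA)/measurable_funTS/measurable_EFinP.
Qed.

Lemma density_gauss (p : R -> R) : is_density P Y p ->
  let f := fun x => p x / phi x in
  [/\ measurable_fun setT f, forall x, 0 <= f x,
    forall A : set RT, measurable A -> law P mY A = (\int[gauss]_(x in A) (f x)%:E)%E &
    (\int[lam]_x (((p x / phi x - 1) ^+ 2) * phi x)%:E = \int[gauss]_x ((f x - 1) ^+ 2)%:E)%E].
Proof.
move=> [mp [p0 pE]] f; have mf : measurable_fun setT f.
  apply: measurable_funM => //.
  have -> : (fun x => (phi x)^-1) = fun x => Num.sqrt (2 * pi) * expR (x ^+ 2 / 2).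
    by apply/funext => x; rewrite /std_normal_density invf_div mulNr expRN invrK.
  apply: measurable_funM => //; apply: measurableT_comp => //.
  by apply: measurable_funM => //; exact: measurable_funX.
have f0 x : 0 <= f x by rewrite divr_ge0.
have fK x : f x * phi x = p x by rewrite divfK// gt_eqF// std_normal_density_gt0.
split => //.
- move=> A mA; rewrite ge0_integral_gauss_set// lawE pE//.
  by apply: eq_integral => x _; rewrite fK.
- rewrite ge0_integral_gauss//.
  + by move=> x; rewrite lee_fin sqr_ge0.
  + by apply/measurable_EFinP; apply: measurable_funX; exact: measurable_funB.
Qed.

(** The product of [f] and the normal density is a Lebesgue density of [Y], hence a competitor in
    the infimum. *)
Lemma chi2_normal_le (f : R -> R) : measurable_fun setT f -> (forall x, 0 <= f x) ->
  (forall A : set RT, measurable A -> law P mY A = (\int[gauss]_(x in A) (f x)%:E)%E) ->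
  (chi2_normal P Y <= \int[gauss]_x ((f x - 1) ^+ 2)%:E)%E.
Proof.
move=> mf f0 fE; apply: ereal_inf_lbound => /=; exists (fun x => f x * phi x); split.
  split; first exact: measurable_funM.
  split; first by move=> x; rewrite mulr_ge0.
  by move=> A mA; rewrite -lawE fE// ge0_integral_gauss_set.
rewrite ge0_integral_gauss//.
- by apply: eq_integral => x _; rewrite mulfK// gt_eqF// std_normal_density_gt0.
- by move=> x; rewrite lee_fin sqr_ge0.
- by apply/measurable_EFinP; apply: measurable_funX; exact: measurable_funB.
Qed.

Lemma chi2_normal_ge0 : (0 <= chi2_normal P Y)%E.
Proof.
apply: le_ereal_inf_tmp => _ [p [_ ->]]; apply: integral_ge0 => x _.
by rewrite lee_fin mulr_ge0 ?sqr_ge0.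
Qed.

Lemma chi2_normal_exp_moments : (chi2_normal P Y < +oo)%E -> exp_moments (law P mY).
Proof.
move=> /ereal_inf_lt[_ [p [pY ->]]]; have [mf f0 fE ->] := density_gauss pY.
exact: density_exp_moments.
Qed.

Lemma chi2_normal_bessel N :
  ((\sum_(1 <= k < N) k`!%:R * hermite_moment (law P mY) k ^+ 2)%:E <= chi2_normal P Y)%E.
Proof.
apply: le_ereal_inf_tmp => _ [p [pY ->]]; have [mf f0 fE ->] := density_gauss pY.
have [Vy|] := ltP (\int[gauss]_x ((p x / phi x - 1) ^+ 2)%:E)%E +oo%E.
  exact: (@hermite_moment_bessel R (law P mY) (fun x => p x / phi x)).
by rewrite leye_eq => /eqP ->; rewrite leey.
Qed.

Lemma hermite_moment1 : exp_moments (law P mY) -> ('E_P[Y] = 0)%E ->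
  hermite_moment (law P mY) 1 = 0.
Proof.
move=> hY EY; rewrite /hermite_moment Rintegral_law; last exact: law_horner_integrable.
rewrite hermite1; under eq_Rintegral do rewrite hornerX.
by rewrite /Rintegral; move: EY; rewrite unlock => ->.
Qed.

Lemma hermite_moment2 : exp_moments (law P mY) -> ('E_P[fun t => (Y t ^+ 2)%R] = 1)%E ->
  hermite_moment (law P mY) 2 = 0.
Proof.
move=> hY EY; apply: (mulfI (_ : 2 != 0 :> R)); first by rewrite pnatr_eq0.
rewrite mulr0 /hermite_moment -RintegralZ_horner// hermiteSS hermite1 hermite0 scale1r.
have h1 := law_horner_integrable ('X^2) hY; have h2 := law_horner_integrable 1 hY.
under eq_Rintegral do rewrite hornerD hornerN -expr2.
rewrite RintegralB//; under [X in _ - X]eq_Rintegral do rewrite hornerC.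
rewrite Rintegral_probability_cst Rintegral_law//; under eq_Rintegral do rewrite hornerXn.
by rewrite /Rintegral; move: EY; rewrite unlock => ->; rewrite subrr.
Qed.

Lemma hermite_moment_odd k : exp_moments (law P mY) -> symmetric_rv P Y -> odd k ->
  hermite_moment (law P mY) k = 0.
Proof.
move=> hY sY ok; have mN : measurable_fun setT (fun t => - Y t) by exact: measurableT_comp.
have hk := law_horner_integrable (hermite 1 k) hY.
have e : \int[law P mY]_x (hermite 1 k).[x] = \int[law P mN]_x (hermite 1 k).[x].
  rewrite /Rintegral; congr fine; apply: eq_measure_integral => A mA _.
  by rewrite /= -[LHS]sY.
have mh : measurable_fun [set: RT] (fun x => (hermite 1 k).[x]) by case: (exp_bounded_horner (hermite (1 : R) k)).
have i1 : P.-integrable setT (EFin \o (fun t => (hermite 1 k).[Y t])).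
  by move: hk => /integrable_law; exact.
have i2 : P.-integrable setT (EFin \o (fun t => (hermite 1 k).[- Y t])).
  have := integrableZl measurableT (-1) i1.
  by apply: eq_integrable => // t _; rewrite /= hermiteN -signr_odd ok expr1.
suff : hermite_moment (law P mY) k = - hermite_moment (law P mY) k by lra.
rewrite {1}/hermite_moment e Rintegral_law; last first.
  by apply/(@integrable_law _ _ _ P _ mN (fun x => (hermite 1 k).[x])).
under eq_Rintegral do rewrite hermiteN -signr_odd ok expr1.
by rewrite RintegralZl// mulN1r /hermite_moment Rintegral_law.
Qed.

End ChiSquare.

(** * The bound for the normalised sum *)

Section ChiSquareSum.
Context d (T : measurableType d) (R : realType) (P : probability T R).
Local Notation RT := (measurableTypeR R).
Variables (n : nat) (X : 'I_n -> T -> R).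
Hypotheses (mX : forall i, measurable_fun setT (X i)) (iX : mutually_independent P X).
Hypothesis n2 : (2 <= n)%N.
Hypothesis EX : forall i, ('E_P[X i] = 0)%E.
Hypothesis EX2 : forall i, ('E_P[fun t => (X i t ^+ 2)%R] = 1)%E.
Hypothesis chiX : forall i, (chi2_normal P (X i) < +oo)%E.

Let hX i : exp_moments (law P (mX i)).
Proof. exact: chi2_normal_exp_moments. Qed.

Let n0 : 0 < n%:R :> R. Proof. by rewrite ltr0n (ltn_trans _ n2). Qed.

Let S t := (\sum_(j < n) X j t) / Num.sqrt n%:R.

Let r : R := (Num.sqrt n%:R)^-1.

Let r2n : r ^+ 2 * n%:R = 1.
Proof. by rewrite exprVn sqr_sqrtr ?(ltW n0)// mulVf// gt_eqF. Qed.

Let SE t : S t = r * partial_sum X n t.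
Proof. by rewrite /S partial_sumT mulrC. Qed.

Let mS : measurable_fun setT S.
Proof.
have -> : S = fun t => r * partial_sum X n t by apply/funext.
by apply: measurable_funM => //; exact: measurable_partial_sum.
Qed.

Let hT : exp_moments (law P (measurable_partial_sum mX n)).
Proof. exact: exp_moments_partial_sum. Qed.

Lemma exp_moments_normalized_sum : exp_moments (law P mS).
Proof.
move=> c; have mexp (a : R) : measurable_fun [set: RT] (fun x : R => expR (a * `|x|)).
  by apply: measurableT_comp => //; apply: measurable_funM => //; exact: measurableT_comp.
apply/(@integrable_law _ _ _ P _ mS (fun x => expR (c * `|x|))) => //.
have /integrable_law := hT (c * `|r|); move=> /(_ (mexp (c * `|r|))).
by apply: eq_integrable => // t _; rewrite /= SE normrM mulrA.
Qed.

Let b := centered_moment P mX.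

Lemma hermite_moment_normalized_sum k :
  hermite_moment (law P mS) k = r ^+ k * sum_moment b n k.
Proof.
have hn := law_horner_integrable (hermite n%:R k) hT.
rewrite /hermite_moment Rintegral_law; last exact/law_horner_integrable/exp_moments_normalized_sum.
under eq_Rintegral do rewrite SE -r2n hermite_scale.
rewrite RintegralZl//; last by move: hn => /integrable_law; apply; case: (exp_bounded_horner (hermite (n%:R : R) k)).
by rewrite -(hermite_partial_sum iX hX k (leqnn n)) Rintegral_law.
Qed.

Variables (a t : R) (p C : nat).
Hypotheses (apt : admissible a t p) (p0 : (0 < p)%N).
Hypothesis hC : forall k, (0 < k)%N -> occupancy a t n k <= C%:R / n%:R ^+ (2 * p).
Hypothesis X_even : forall i k, cosh_weight a k != 1 -> hermite_moment (law P (mX i)) k = 0.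

Let D : R := (\sum_(j < n) fine (chi2_normal P (X j))) / n%:R.
Hypothesis tD : t ^+ 2 * D < 1.

Lemma chi2_normalized_sum_le : (chi2_normal P S <=
  ((D + C%:R * ((t ^+ 2 * D) ^+ 2 / (1 - t ^+ 2 * D))) / (n%:R ^+ p - 1))%:E)%E.
Proof.
pose chi j : R := if insub j is Some o then fine (chi2_normal P (X o)) else 0.
have chi_fin o : chi2_normal P (X o) \is a fin_num by rewrite ge0_fin_numE// chi2_normal_ge0.
have b_even j i : (i < 3)%N || (cosh_weight a i != 1) -> b j i = 0.
  rewrite /b /centered_moment => h; case: (eqVneq i 0%N) => // i0.
  case: insubP => // o _ _; move: h => /orP[i3|]; last exact: X_even.
  case: i i0 i3 => [//|[_ _|[_ _|//]]].
    exact: hermite_moment1.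
  exact: hermite_moment2.
have b_chi j N : \sum_(i < N) i`!%:R * b j i ^+ 2 <= chi j.
  rewrite /b /chi /centered_moment; case: insubP => [u _ _|_]; last first.
    by rewrite big1// => i _; rewrite if_same expr0n mulr0.
  rewrite -lee_fin fineK//.
  apply: (le_trans _ (chi2_normal_bessel P (mX u) N)); rewrite lee_fin.
  case: N => [|N]; first by rewrite big_ord0 big_geq.
  rewrite big_ord_recl/= expr0n mulr0 add0r big_add1/= big_mkord.
  exact: ler_sum.
have De : (\sum_(j < n) chi j) / n%:R = D.
  by congr (_ / _); apply: eq_bigr => j _; rewrite /chi valK.
have c0 k : sum_moment b 0 k = (k == 0%N)%:R by [].
have cS m k : sum_moment b m.+1 k =
  sum_moment b m k + \sum_(i < k.+1) b m i * sum_moment b m (k - i)%N by [].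
have core N := core_inequality apt n2 b_even b_chi c0 cS N p0 hC.
rewrite De in core; set E := (_ / _) in core *.
have E0 : 0 <= E by have := core 0%N tD; rewrite big_geq.
(* The 1 is the moment of order 0; [duality_density] returns K - 1 and takes it off again. *)
pose K : R := 1 + E.
have hK N : \sum_(k < N) k`!%:R * hermite_moment (law P mS) k ^+ 2 <= K.
  case: N => [|N]; first by rewrite big_ord0 addr_ge0.
  rewrite big_ord_recl hermite_moment0 fact0 expr1n mulr1 lerD2l.
  have := core N.+1 tD; rewrite big_add1/= big_mkord; apply: le_trans; apply: ler_sum => k _.
  rewrite hermite_moment_normalized_sum exprMn -exprM mulnC exprM /bump leq0n add1n.
  rewrite mulrA exprVn sqr_sqrtr ?(ltW n0)//.
  by rewrite exprVn.
have hq := hermite_moment_functional exp_moments_normalized_sum hK.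
have [f [mf f0 fE hf]] := duality_density exp_moments_normalized_sum hq.
apply: (le_trans (chi2_normal_le mf f0 fE)); apply: (le_trans hf).
by rewrite lee_fin /K addrAC subrr add0r.
Qed.

End ChiSquareSum.

(** * Finiteness, constants and conclusion *)

(** All distances are nonnegative, so a finite bound on their average makes each of them finite,
    which is what supplies the exponential moments. *)
Lemma fine_sum_chi2 d (T : measurableType d) (R : realType) (P : probability T R)
    n (X : 'I_n -> T -> R) (M : R) : (0 < n)%N ->
  ((n%:R)^-1%:E * \sum_(j < n) chi2_normal P (X j) <= M%:E)%E ->
  (forall j, (chi2_normal P (X j) < +oo)%E) /\
  ((n%:R)^-1%:E * \sum_(j < n) chi2_normal P (X j) =
    ((\sum_(j < n) fine (chi2_normal P (X j))) / n%:R)%:E)%E.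
Proof.
move=> n0 h; have n0' : 0 < n%:R :> R by rewrite ltr0n.
have V0 j : (0 <= chi2_normal P (X j))%E by exact: chi2_normal_ge0.
have sy : (\sum_(j < n) chi2_normal P (X j) < +oo)%E.
  rewrite ltNge leye_eq; apply/negP => /eqP sE; move: h.
  by rewrite sE gt0_muley ?lte_fin ?invr_gt0// leye_eq.
have Vy j : (chi2_normal P (X j) < +oo)%E.
  apply: le_lt_trans sy; rewrite (bigD1 j)//= leeDl//.
  by apply: sume_ge0.
split => //; rewrite mulrC EFinM; congr (_ * _)%E.
rewrite -sumEFin; apply: eq_bigr => j _; rewrite fineK// ge0_fin_numE//.
Qed.

(** [m] bounds x^2 / (1 - x D). The added 1 makes the final constant positive even when [C] is 0. *)
Lemma chi2_error_le (R : realType) (x D m : R) (C : nat) :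
  0 <= x -> 0 <= D -> x * D < 1 -> x ^+ 2 <= m * (1 - x * D) -> 0 <= m ->
  D + C%:R * ((x * D) ^+ 2 / (1 - x * D)) <= D + (C%:R * m + 1) * (D * D).
Proof.
move=> x0 D0 xD xm m0; rewrite lerD2l.
have h : (x * D) ^+ 2 / (1 - x * D) <= m * (D * D).
  rewrite ler_pdivrMr ?subr_gt0// [leLHS]exprMn.
  rewrite (_ : m * (D * D) * _ = m * (1 - x * D) * D ^+ 2); last by ring.
  by rewrite ler_wpM2r// sqr_ge0.
apply: (le_trans (ler_wpM2l (ler0n _ C) h)).
by rewrite [leRHS]mulrDl mul1r [leLHS]mulrA lerDl mulr_ge0.
Qed.

Theorem theorem2 :
  exists C C1 : rat, 0 < C /\ 0 < C1 /\
  forall (R : realType) (n : nat) (d : measure_display) (T : measurableType d)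
         (P : probability T R)
         (X : 'I_n -> T -> R),
    (2 <= n)%N ->
    (forall j, measurable_fun setT (X j)) ->
    mutually_independent P X ->
    (forall j, ('E_P[X j] = 0)%E) ->
    (forall j, ('E_P[fun t => (X j t ^+ 2)%R] = 1)%E) ->
    let S := fun t => (\sum_(j < n) X j t) / Num.sqrt (n%:R) in
    let Delta := ((n%:R)^-1%:E * \sum_(j < n) chi2_normal P (X j))%E in
    ((Delta <= (82 / 100)%:E)%E ->
       (chi2_normal P S <=
          ((n%:R - 1)^-1)%:E * (Delta + (ratr C : R)%:E * (Delta * Delta)))%E) /\
    ((forall j, symmetric_rv P (X j)) -> (Delta <= (169 / 100)%:E)%E ->
       (chi2_normal P S <=
          ((n%:R ^+ 2 - 1)^-1)%:E * (Delta + (ratr C1 : R)%:E * (Delta * Delta)))%E).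
Proof.
have [C hC] := occupancy_bound 1; have [C1 hC1] := occupancy_bound 2.
(* With [t ^ 2 = 1.21] and [t ^ 2 = 0.589824], [t ^ 4 / (1 - t ^ 2 * Delta)] is
   at most 260 when [Delta <= 0.82] and 110 when [Delta <= 1.69]. *)
exists (C * 260 + 1)%N%:R, (C1 * 110 + 1)%N%:R; rewrite !ltr0n !addn1; split => //; split => //.
move=> R n d T P X n2 mX iX EX EX2 S Delta.
have n0 : 0 < n%:R :> R by rewrite ltr0n (ltn_trans _ n2).
set D : R := (\sum_(j < n) fine (chi2_normal P (X j))) / n%:R.
have D0 : 0 <= D.
  by apply: divr_ge0 => //; apply: sumr_ge0 => j _; rewrite fine_ge0// chi2_normal_ge0.
split => [DM|sX DM]; have [chiX DE] := fine_sum_chi2 (ltnW n2) DM.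
- move: DM; rewrite /Delta DE -/D lee_fin => DM.
  have t2 : (11 / 10) ^+ 2 = 121 / 100 :> R by field.
  have tD : (11 / 10) ^+ 2 * D < 1 by rewrite t2; lra.
  have X_even (i : 'I_n) k : cosh_weight 1 k != 1 :> R -> hermite_moment (law P (mX i)) k = 0.
    by rewrite /cosh_weight subrr mul0r addr0 eqxx.
  have := chi2_normalized_sum_le iX n2 EX EX2 chiX (admissible1 R) isT
    (fun k => hC R _ _ n k (admissible1 R) n2) X_even tD.
  move/le_trans; apply.
  rewrite -/D -[leRHS]/(((n%:R - 1)^-1 * (D + ratr (C * 260).+1%:R * (D * D)))%:E).
  rewrite lee_fin expr1 mulrC ler_wpM2l//.
    by rewrite invr_ge0 subr_ge0 ler1n (ltn_trans _ n2).
  rewrite ratr_nat -[X in X * (D * D)]natr1 natrM.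
  by apply: chi2_error_le => //; rewrite ?t2; lra.
- move: DM; rewrite /Delta DE -/D lee_fin => DM.
  have t2 : (96 / 125) ^+ 2 = 9216 / 15625 :> R by field.
  have tD : (96 / 125) ^+ 2 * D < 1 by rewrite t2; lra.
  have X_even (i : 'I_n) k : cosh_weight (1 / 2) k != 1 :> R -> hermite_moment (law P (mX i)) k = 0.
    move=> h; apply: hermite_moment_odd => //; first exact: chi2_normal_exp_moments.
    move: h; rewrite /cosh_weight -signr_odd; case: (odd k) => //.
    by rewrite expr0 mulr1 addrC subrK eqxx.
  have := chi2_normalized_sum_le iX n2 EX EX2 chiX (admissible_half R) isT
    (fun k => hC1 R _ _ n k (admissible_half R) n2) X_even tD.
  move/le_trans; apply.
  rewrite -/D -[leRHS]/(((n%:R ^+ 2 - 1)^-1 * (D + ratr (C1 * 110).+1%:R * (D * D)))%:E).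
  rewrite lee_fin mulrC ler_wpM2l//.
    by rewrite invr_ge0 subr_ge0 exprn_ege1// ler1n (ltn_trans _ n2).
  rewrite ratr_nat -[X in X * (D * D)]natr1 natrM.
  by apply: chi2_error_le => //; rewrite ?t2; lra.
Qed.
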